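(* Let $T$ be a correspondence on a compact metric space $(X,d)$. (i) For every continuous function $\phi:\mathcal{O}_2(T)\to\mathbb{R}$, the variational principle holds: $$P_{\rm top}(T,\phi)=\max_{\mathcal{Q},\mu}\left\{\mathfrak{h}_\mu(\mathcal{Q})+\int_X\int_{T(x_1)}\phi(x_1,x_2)\,d\mathcal{Q}_{x_1}(x_2)\,d\mu(x_1)\right\},\qquad( * )$$ where $\mathcal{Q}$ ranges over all transition probability kernels on $X$ supported by $T$, and $\mu$ ranges over all Borel probability measures on $X$; the same equality (with the maximum attained) holds when $\mu$ ranges only over the $\mathcal{Q}$-invariant Borel probability measures on $X$. (ii) For every continuous $\phi:\mathcal{O}_2(T)\to\mathbb{R}$, every pair $(\mathcal{Q},\mu)$ (with $\mathcal{Q}$ a transition probability kernel on $X$ supported by $T$ and $\mu$ a Borel probability measure on $X$) which attains the maximum in $( * )$ satisfies $\mu\mathcal{Q}=\mu$, i.e. $\mu$ is $\mathcal{Q}$-invariant. (iii) For every transition probability kernel $\mathcal{Q}$ on $X$ supported by $T$ and every Borel probability measure $\mu$ on $X$, the inverse variational principle holds: $$\mathfrak{h}_\mu(\mathcal{Q})=\inf_{\phi\in C(\mathcal{O}_2(T))}\left\{P_{\rm top}(T,\phi)-\int_X\int_{T(x_1)}\phi(x_1,x_2)\,d\mathcal{Q}_{x_1}(x_2)\,d\mu(x_1)\right\}.$$ (iv) $0\le h_\mu(\mathcal{Q})\le\mathfrak{h}_\mu(\mathcal{Q})$ for every transition probability kernel $\mathcal{Q}$ on $X$ supported by $T$ and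 every $\mathcal{Q}$-invariant Borel probability measure $\mu$ on $X$.
   Context: Correspondences. Let $(X,d)$ be a compact metric space and $\mathcal{F}(X)$ the set of nonempty closed subsets of $X$. A correspondence on $X$ is a map $T:X\to\mathcal{F}(X)$ such that for every $x\in X$ and every open neighborhood $U$ of $T(x)$ there is an open neighborhood $V$ of $x$ with $T(y)\subset U$ for all $y\in V$ (equivalently, the graph of $T$ is closed in $X^2$). For $n\in\mathbb{N}$, $\mathcal{O}_n(T)=\{(x_1,\dots,x_n)\in X^n: x_{i+1}\in T(x_i),\ 1\le i\le n-1\}$, with the metric $d_n((x_i),(y_i))=\max_id(x_i,y_i)$. $C(\mathcal{O}_2(T))$ is the space of real-valued continuous functions on $\mathcal{O}_2(T)$. Topological pressure. For $\phi\in C(\mathcal{O}_2(T))$ put $S_n\phi(x_1,\dots,x_{n+1})=\sum_{i=1}^n\phi(x_i,x_{i+1})$ on $\mathcal{O}_{n+1}(T)$, and $$P_{\rm top}(T,\phi)=\lim_{\epsilon\to0^+}\limsup_{n\to\infty}\frac1n\log\sup_{E}\sum_{\underline{x}\in E}e^{S_n\phi(\underline{x})}\in(-\infty,+\infty],$$ where $E$ ranges over all $\epsilon$-separated subsets (distinct points at distance $\ge\epsilon$) of $(\mathcal{O}_{n+1}(T),d_{n+1})$. Kernels. $\mathscr{B}(X)$ is the (completed) Borel $\sigma$-algebra. A transition probability kernel on $X$ is a map $\mathcal{Q}:X\times\mathscr{B}(X)\to[0,1]$ such that $\mathcal{Q}_x:=\mathcal{Q}(x,\cdot)$ is a probability measure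 for each $x$ and $x\mapsto\mathcal{Q}(x,A)$ is measurable for each $A$. It is supported by $T$ if $\mathcal{Q}_x(T(x))=1$ for every $x\in X$. For a Borel probability measure $\mu$, $(\mu\mathcal{Q})(A)=\int_X\mathcal{Q}(x,A)\,d\mu(x)$; $\mu$ is $\mathcal{Q}$-invariant if $\mu\mathcal{Q}=\mu$. Define kernels $\mathcal{Q}^{[n]}$ from $X$ to $X^{n+1}$ by $\mathcal{Q}^{[0]}_x=\delta_x$ and $\mathcal{Q}^{[n]}(x,A)=\int_{X^n}\mathcal{Q}(x_n,\{x_{n+1}:(x_1,\dots,x_{n+1})\in A\})\,d\mathcal{Q}^{[n-1]}_x(x_1,\dots,x_n)$, and $(\mu\mathcal{Q}^{[n]})(A)=\int_X\mathcal{Q}^{[n]}(x,A)\,d\mu(x)$. Measure-theoretic entropy. For $\mathcal{Q}$-invariant $\mu$ and a finite measurable partition $\mathcal{A}$ of $X$, let $\mathcal{A}^n=\{A_1\times\cdots\times A_n:A_i\in\mathcal{A}\}$, $H_\nu(\mathcal{B})=-\sum_{B\in\mathcal{B}}\nu(B)\log\nu(B)$, $h_\mu(\mathcal{Q},\mathcal{A})=\lim_{n\to\infty}\frac1nH_{\mu\mathcal{Q}^{[n-1]}}(\mathcal{A}^n)$, and $h_\mu(\mathcal{Q})=\sup_{\mathcal{A}}h_\mu(\mathcal{Q},\mathcal{A})$ over all finite measurable partitions. Abstract measure-theoretic entropy. For a transition probability kernel $\mathcal{Q}$ on $X$ supported by $T$ and any Borel probability measure $\mu$ on $X$, $$\mathfrak{h}_\mu(\mathcal{Q})=\inf_{\phi\in\mathcal{C}_T}\int_X\int_{T(x_1)}\phi(x_1,x_2)\,d\mathcal{Q}_{x_1}(x_2)\,d\mu(x_1),\qquad\mathcal{C}_T=\{\phi\in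 C(\mathcal{O}_2(T)):P_{\rm top}(T,-\phi)\le0\}.$$
   Formalization: Part (ii) is stated only for φ with P_top(T,φ) < +∞; when the pressure is +∞ every pair (Q,μ) attains the maximum, so (ii) fails there (e.g. X=[0,1], T(x)=X, Q_x=δ_0, μ=δ_1). *)

(* Defs.v *)
From HB Require Import structures.
From mathcomp Require Import all_boot all_order all_algebra.
From mathcomp Require Import all_classical all_reals all_analysis.

Set Implicit Arguments.
Unset Strict Implicit.
Unset Printing Implicit Defensive.

Import Order.TTheory GRing.Theory Num.Theory.
Import numFieldNormedType.Exports.

Local Open Scope classical_set_scope.
Local Open Scope ring_scope.

(* The library puts a generated sigma-algebra on pointed types only.  Pointedness
   says that the space is nonempty; no definition below uses the base point. *)
#[short(type="pmetricType")]
HB.structure Definition PointedMetric (K : numDomainType) :=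
  { M of Metric K M & Pointed M }.

Notation borel X := (g_sigma_algebraType (@open X)).

Section correspondences.
Context {R : realType} {X : pmetricType R}.
Implicit Types (T : X -> set X) (phi : X * X -> R).

Definition correspondence T :=
  [/\ forall x, T x !=set0,
      forall x, closed (T x) &
      forall x (U : set X), open U -> T x `<=` U ->
        exists V : set X, [/\ open V, V x & forall y, V y -> T y `<=` U]].

(* [step x i] is the pair (x_i, x_(i+1)) of consecutive entries of x. *)
Definition step n (x : n.+1.-tuple X) (i : 'I_n) : X * X :=
  (tnth x (widen_ord (leqnSn n) i), tnth x (lift ord0 i)).

(* [orbits T n] is O_(n+1)(T). *)
Definition orbits T n : set (n.+1.-tuple X) :=
  [set x | forall i : 'I_n, T (step x i).1 (step x i).2].

(* O_2(T), with X^2 represented by X * X. *)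
Definition corr_graph T : set (X * X) := [set z | T z.1 z.2].

(* C(O_2(T)): a function on O_2(T) is represented by any extension to X * X;
   all the notions below depend only on its values on [corr_graph T]. *)
Definition continuous_on_graph T : set (X * X -> R) :=
  [set phi | {within corr_graph T, continuous phi}].

Definition tdist n (x y : n.-tuple X) : R :=
  \big[Num.max/0]_(i < n) mdist (tnth x i) (tnth y i).

Definition eps_separated n (eps : R) (E : set (n.-tuple X)) :=
  forall x y, E x -> E y -> x <> y -> eps <= tdist x y.

Definition birkhoff_sum phi n (x : n.+1.-tuple X) : R :=
  \sum_(i < n) phi (step x i).

Definition separated_sum T phi (eps : R) n : \bar R :=
  ereal_sup [set (\esum_(x in E) (expR (birkhoff_sum phi x))%:E)%E
            | E in [set E | E `<=` orbits T (n := n) /\ eps_separated eps E]].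

Definition pressure T phi : \bar R :=
  lim (limn_esup (fun n => (n%:R^-1)%:E * lne (separated_sum T phi eps n))%E
       @[eps --> 0^'+]).

End correspondences.

Section kernels.
Context {R : realType} {X : pmetricType R}.
Implicit Types (T : X -> set X) (phi : X * X -> R).
Implicit Types (Q : R.-pker (borel X) ~> (borel X)).
Implicit Types (mu : probability (borel X) R).
Local Open Scope ereal_scope.

Definition supported_by T Q := forall x, Q x (T x) = 1.

Definition kernel_invariant Q mu :=
  forall A : set (borel X), measurable A -> \int[mu]_x Q x A = mu A.

Fixpoint kernel_iter Q n : X -> set (n.+1.-tuple (borel X)) -> \bar R :=
  match n with
  | 0%N => fun x A => \d_([tuple x] : 1.-tuple (borel X)) A
  | m.+1 => fun x A =>
      \int[kernel_iter Q (n := m) x]_t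
        Q (tnth t ord_max) [set y | A [tuple of rcons t y]]
  end.

Definition path_measure Q mu n (A : set (n.+1.-tuple (borel X))) : \bar R :=
  \int[mu]_x kernel_iter Q x A.

Definition shannon_entropy (Y : Type) (I : finType) (nu : set Y -> \bar R)
    (B : I -> set Y) : R :=
  (- \sum_(i : I) fine (nu (B i)) * ln (fine (nu (B i))))%R.

Definition cylinder k (A : 'I_k -> set X) n (f : {ffun 'I_n -> 'I_k}) :
    set (n.-tuple (borel X)) :=
  [set t | forall i : 'I_n, A (f i) (tnth t i)].

(* The n-th term is (1/(n+1)) H_(mu Q^[n]) (A^(n+1)). *)
Definition partition_entropy Q mu k (A : 'I_k -> set X) : R :=
  limn (fun n =>
    (n.+1%:R^-1 * shannon_entropy (path_measure Q mu (n := n))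
                    (cylinder A (n := n.+1)))%R).

Definition measurable_partition k (A : 'I_k -> set X) :=
  partition [set: 'I_k] A [set: X] /\
  forall i, measurable (A i : set (borel X)).

Definition metric_entropy Q mu : \bar R :=
  ereal_sup [set h | exists k (A : 'I_k -> set X),
    measurable_partition A /\ h = (partition_entropy Q mu A)%:E].

Definition potential_integral T phi Q mu : \bar R :=
  \int[mu]_x \int[Q x]_(y in T x) (phi (x, y))%:E.

Definition abstract_entropy T Q mu : \bar R :=
  ereal_inf [set potential_integral T phi Q mu | phi in
    [set phi | continuous_on_graph T phi /\
               pressure T (fun z => - phi z)%R <= 0]].

Definition free_energy T phi Q mu : \bar R :=
  abstract_entropy T Q mu + potential_integral T phi Q mu.

Definition free_energies T phi : set (\bar R) :=
  [set v | exists Q mu, supported_by T Q /\ v = free_energy T phi Q mu].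

Definition invariant_free_energies T phi : set (\bar R) :=
  [set v | exists Q mu,
    [/\ supported_by T Q, kernel_invariant Q mu & v = free_energy T phi Q mu]].

End kernels.

Definition is_maximum {R : realType} (S : set (\bar R)) (m : \bar R) :=
  S m /\ ubound S m.

(* Main.v *)
Require Import Defs.
From HB Require Import structures.
From mathcomp Require Import all_boot all_order all_algebra.
From mathcomp Require Import all_classical all_reals all_analysis.
From mathcomp Require Import measurable_realfun.
From mathcomp Require Import ring lra.

(** The pressure is a convex function of the potential, invariant under adding
    a coboundary [f x - f y] and translated by constants; the abstract entropy is
    its convex dual. Everything except the comparison with the metric entropy
    follows from the existence, for each continuous [phi] of finite pressure, of
    a linear functional [L] that is tangent to the pressure at [phi], together
    with the fact that [L] is integration against [mu] and [Q] for a kernel [Q]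
    supported by [T].

    Tangent functionals. By Jensen's inequality the Gibbs average of the Birkhoff
    sums over a finite separated family of orbits is a subgradient of the
    logarithm of the Gibbs sum ([gibbs_average]). Taking long orbits of nearly
    maximal growth, one meets any finite number of the inequalities
    [L psi <= P (phi + psi) - P phi] up to a small error, and a limit along an
    ultrafilter meets all of them ([graph_average_compactness],
    [tangent_average_exists]).

    From functionals to kernels. The compact square is a continuous image of the
    Cantor space. A positive functional gives consistent masses to the cylinders,
    and the quantile map realizes such masses by a measure, measurably in a
    parameter ([tree_kernel_exists]). This yields the representation of
    functionals ([graph_average_representation]) and also the disintegration of
    the representing measure ([metric_disintegration]): the densities of the
    cylinder masses with respect to the first marginal are chosen consistently
    down the tree. The resulting kernel is supported by [T] almost everywhere,
    and a Borel selection of [T] repairs it on a null set ([supported_version]).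

    The tangent inequality at [phi] in the direction [- chi - phi], for [chi] of
    the class that defines the abstract entropy, shows that the free energy of
    [(Q, mu)] is at least the pressure; the reverse inequality holds for all
    pairs, since [phi] minus its pressure has pressure zero. Coboundaries do not
    change the pressure, so the tangent functional and any maximizing pair
    annihilate them, which means that [mu] is invariant
    ([invariant_of_coboundaries]). When the pressure is infinite the class is
    empty, the abstract entropy is infinite, and any invariant pair will do.

    The metric entropy is bounded by coding. Let the pressure of [- phi] be at
    most zero. The elements of a partition contain disjoint compact cores of
    nearly full mass ([inner_regular]), and a maximal separated family of orbits
    follows every orbit closely ([maximal_separated]). Choosing a member of the
    family with its Gibbs weight for [- phi] and reading off its itinerary with
    a little noise defines weights on itineraries. By Gibbs' inequality the
    Shannon entropy is at most the mean of minus the logarithm of these weights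
    ([shannon_entropy_le]), which is the logarithm of the Gibbs sum, of
    subexponential growth, plus the mean of the Birkhoff sum of [phi], plus
    small errors ([code_length], [cylinder_entropy_le]). *)

Set Implicit Arguments.
Unset Strict Implicit.
Unset Printing Implicit Defensive.

Import Order.TTheory GRing.Theory Num.Theory.
Import numFieldNormedType.Exports.

Local Open Scope classical_set_scope.
Local Open Scope ring_scope.
Local Open Scope ereal_scope.

(** * Probability measures and kernels *)

Section probability_of_measure.
Context d (Y : measurableType d) (R : realType) (m : {measure set Y -> \bar R}).
Hypothesis mT : m setT = 1.

Let P : set Y -> \bar R := m.

HB.instance Definition _ := isMeasure.Build _ _ _ P
  (measure0 m) (measure_ge0 m) (@measure_semi_sigma_additive _ _ _ m).

HB.instance Definition _ := Measure_isProbability.Build _ _ _ P mT.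

Lemma probability_of_measure : exists P : probability Y R,
  (P : set Y -> \bar R) = m.
Proof. by exists P. Qed.

End probability_of_measure.

Section kernel_of_probabilities.
Context d d' (X : measurableType d) (Y : measurableType d') (R : realType).
Variable P : X -> probability Y R.
Hypothesis mP : forall U : set Y, measurable U -> 
  measurable_fun [set: X] (P ^~ U).

Definition kernel_of_probabilities (x : X) : {measure set Y -> \bar R} := P x.

HB.instance Definition _ :=
  isKernel.Build _ _ X Y R kernel_of_probabilities mP.

Let kprob x : kernel_of_probabilities x [set: Y] = 1.
Proof. exact: (@probability_setT _ _ _ (P x)). Qed.

HB.instance Definition _ :=
  Kernel_isProbability.Build _ _ X Y R kernel_of_probabilities kprob.

Lemma pkernel_of_probabilities :
  exists k : R.-pker X ~> Y, forall x, k x = P x :> {measure set Y -> \bar R}.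
Proof. by exists kernel_of_probabilities. Qed.

End kernel_of_probabilities.

Section mixtures.
Context d d' (X : measurableType d) (Z : measurableType d') (R : realType).
Variables (mu : probability X R) (k : R.-pker X ~> Z).

Let ksnd (x : unit * X) : {measure set Z -> \bar R} := k x.2.

Let mksnd U : measurable U -> measurable_fun setT (ksnd ^~ U).
Proof.
by move=> mU; apply: (measurableT_comp (measurable_kernel k U mU)).
Qed.

HB.instance Definition _ := isKernel.Build _ _ (unit * X)%type Z R ksnd mksnd.

HB.instance Definition _ := Kernel_isProbability.Build _ _ _ _ R ksnd
  (fun x => @prob_kernel _ _ _ _ _ k x.2).

Let kcst (_ : unit) : {measure set X -> \bar R} := mu.

HB.instance Definition _ := isKernel.Build _ _ unit X R kcst
  (fun U mU => measurable_cst (mu U)).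

HB.instance Definition _ := Kernel_isProbability.Build _ _ _ _ R kcst
  (fun=> @probability_setT _ _ _ mu).

Let mix : {measure set Z -> \bar R} := kcomp kcst ksnd tt.

Let mixT : mix setT = 1.
Proof.
rewrite /mix/= /kcomp /=; under eq_integral do rewrite prob_kernel.
by rewrite integral_cst// mul1e; exact: (@probability_setT _ _ _ mu).
Qed.

(** This is [kcomp] for a kernel that does not depend on its first argument,
    restated for probabilities; it gives the law of a step of the chain as well
    as the laws of its paths. *)
Lemma mixture_exists : exists nu : probability Z R,
  (forall A : set Z, nu A = \int[mu]_x k x A) /\
  (forall f : Z -> \bar R, (forall z, 0 <= f z) -> measurable_fun setT f ->
     \int[nu]_z f z = \int[mu]_x \int[k x]_z f z).
Proof.
have [P PE] := probability_of_measure mixT.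
exists P; rewrite PE; split => // f f0 mf.
exact: (@integral_kcomp _ _ _ _ _ _ _ kcst ksnd tt f f0 mf).
Qed.

End mixtures.

Section image_probability.
Context d d' (X : measurableType d) (Y : measurableType d') (R : realType).
Variables (P : probability X R) (f : X -> Y).
Hypothesis mf : measurable_fun setT f.

Lemma image_probability_exists : exists nu : probability Y R,
  (forall A : set Y, nu A = P (f @^-1` A)) /\
  (forall g : Y -> \bar R, (forall z, 0 <= g z) -> measurable_fun setT g ->
     \int[nu]_z g z = \int[P]_x g (f x)).
Proof.
pose F : {mfun X >-> Y} := mfun_Sub (mem_set mf).
exists (distribution P F); split => // g g0 mg.
by rewrite (ge0_integral_pushforward mf).
Qed.

End image_probability.

Section image_kernel.
Context d d1 d2 (X : measurableType d) (Y : measurableType d1)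
  (Z : measurableType d2) (R : realType).
Variables (K : R.-pker X ~> Y) (f : X -> Y -> Z).
Hypothesis mf : measurable_fun [set: X * Y] (fun z => f z.1 z.2).

Lemma image_kernel_exists : exists Q : R.-pker X ~> Z,
  (forall x A, Q x A = K x (f x @^-1` A)) /\
  (forall x (g : Z -> \bar R), (forall z, 0 <= g z) -> measurable_fun setT g ->
     \int[Q x]_z g z = \int[K x]_y g (f x y)).
Proof.
have mfx x : measurable_fun [set: Y] (f x).
  have mx : measurable_fun setT (fun y : Y => (x, y)) by exact: measurable_fun_pair.
  exact: (measurableT_comp mf mx).
have Pex x : exists P : probability Z R,
    (forall A : set Z, P A = K x (f x @^-1` A)) /\
    (forall g : Z -> \bar R, (forall z, 0 <= g z) ->
       measurable_fun setT g -> \int[P]_z g z = \int[K x]_y g (f x y)).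
  have [P0 P0E] := probability_of_measure (@prob_kernel _ _ _ _ _ K x).
  by have := image_probability_exists P0 (mfx x); rewrite P0E.
have [P PE] := choice Pex.
have [|Q QE] := @pkernel_of_probabilities _ _ _ _ _ P.
  move=> U mU; have mfU := mf measurableT mU; rewrite setTI in mfU.
  rewrite (_ : P ^~ U = fun x => K x (xsection ((fun z => f z.1 z.2) @^-1` U) x)).
    by apply: measurable_fun_xsection_finite_kernel; rewrite inE.
  by apply/funext => x; rewrite (proj1 (PE x)) xsectionE.
exists Q; split => [x A|x g g0 mg]; first by rewrite QE (proj1 (PE x)).
by rewrite -(proj2 (PE x))// QE.
Qed.

End image_kernel.

Section semidirect_product.
Context d d' (X : measurableType d) (Y : measurableType d') (R : realType).
Variables (mu : probability X R) (Q : R.-pker X ~> Y).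

Lemma semidirect_exists : exists nu : probability (X * Y)%type R,
  (forall A : set (X * Y), nu A = \int[mu]_x Q x (xsection A x)) /\
  (forall f : X * Y -> \bar R, (forall z, 0 <= f z) -> measurable_fun setT f ->
     \int[nu]_z f z = \int[mu]_x \int[Q x]_y f (x, y)).
Proof.
have mpair : measurable_fun [set: X * Y] (fun z => (z.1, z.2)).
  exact: measurable_fun_pair.
have [P [PA PI]] := image_kernel_exists Q mpair.
have [nu [nuA nuI]] := mixture_exists mu P.
exists nu; split => [A|f f0 mf].
  by rewrite nuA; apply: eq_integral => x _; rewrite PA xsectionE.
by rewrite nuI//; apply: eq_integral => x _; rewrite PI.
Qed.

End semidirect_product.

(** The whole space can be added to a pi-system for free, so that agreement on
    any generating pi-system suffices for probability measures. *)
Lemma probability_unique_gen d (T : measurableType d) (R : realType)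
    (G : set (set T)) (m1 m2 : probability T R) :
  @measurable _ T = <<s G >> -> setI_closed G ->
  (forall A, G A -> m1 A = m2 A) ->
  forall A, measurable A -> m1 A = m2 A.
Proof.
move=> GE GI m12 A mA.
pose G' := [set A | G A \/ A = setT].
have mGT : @measurable _ T = <<s G' >>.
  rewrite GE; apply/seteqP; split.
    apply: smallest_sub; first exact: smallest_sigma_algebra.
    by move=> B GB; apply: sub_sigma_algebra; left.
  apply: smallest_sub; first exact: smallest_sigma_algebra.
  move=> B [GB|->]; first exact: sub_sigma_algebra.
  by rewrite -GE; exact: measurableT.
have G'I : setI_closed G'.
  move=> B C [GB|->] [GC|->]; rewrite ?setTI ?setIT.
  - by left; exact: GI.
  - by left.
  - by left.
  - by right.
have G'm B : G' B -> m1 B = m2 B.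
  by case=> [/m12//|->]; rewrite (@probability_setT _ _ _ m1) (@probability_setT _ _ _ m2).
apply: (measure_unique G' (fun=> setT) mGT G'I _ _ m1 m2 G'm _ A mA).
- by move=> i; right.
- by rewrite bigcup_const.
- by move=> k; rewrite [ltLHS](@probability_setT _ _ _ m1) ltry.
Qed.

Lemma probability_setI1 d (T : measurableType d) (R : realType)
    (P : probability T R) (A B : set T) : measurable A -> measurable B ->
  P B = 1 -> P (A `&` B) = P A.
Proof.
move=> mA mB B1; have B0 : P (~` B) = 0 by rewrite probability_setC// B1 subee.
rewrite [RHS](measureDI _ mA mB) [X in _ = X + _](_ : _ = 0) ?add0e//.
apply: (subset_measure0 _ _ _ B0).
- exact: measurableD.
- exact: measurableC.
- by move=> x [].
Qed.

(** * The Cantor space and its cylinders *)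

Lemma bigcup_countType (T : Type) (I : countType) (D : set I) (F : I -> set T) :
  \bigcup_(i in D) F i = \bigcup_n
    (if unpickle n is Some i then if i \in D then F i else set0 else set0).
Proof.
apply/seteqP; split => x [i].
  by move=> Di Fx; exists (pickle i) => //; rewrite pickleK mem_set.
case: unpickle => // j _.
by case: ifPn => // /set_mem Dj Fj; exists j.
Qed.

Lemma countable_bigcup_measurable d (T : measurableType d) (I : countType)
    (D : set I) (F : I -> set T) :
  (forall i, measurable (F i)) -> measurable (\bigcup_(i in D) F i).
Proof.
move=> mF; rewrite bigcup_countType; apply: bigcupT_measurable => n.
by case: unpickle => [i|//]; case: ifP.
Qed.

Lemma countable_bigcup_null d (T : measurableType d) (R : realType)
    (P : probability T R) (I : countType) (D : set I) (F : I -> set T) :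
  (forall i, measurable (F i)) -> (forall i, D i -> P (F i) = 0) ->
  P (\bigcup_(i in D) F i) = 0.
Proof.
move=> mF F0; apply: measure_negligible.
  exact: countable_bigcup_measurable.
rewrite bigcup_countType; apply: negligible_bigcup => n.
case: unpickle => [i|]; last exact: negligible_set0.
case: ifPn => [/set_mem Di|_]; last exact: negligible_set0.
by apply/negligibleP => //; exact: F0.
Qed.

Fixpoint prefix (a : nat -> bool) n : seq bool :=
  if n is m.+1 then a m :: prefix a m else [::].

Lemma size_prefix a n : size (prefix a n) = n.
Proof. by elim: n => //= n ->. Qed.

Lemma eq_prefix a b n : prefix a n = prefix b n ->
  forall m, (m <= n)%N -> prefix a m = prefix b m.
Proof.
elim: n => [_ m|n IH /= [ab abn] m]; first by rewrite leqn0 => /eqP ->.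
by rewrite leq_eqVlt => /predU1P[->/=|]; [rewrite ab abn|exact: IH].
Qed.

(** Prefixes are listed newest digit first, so that the children of the node
    [w] are [b :: w]. *)
Definition cylinder_set (w : seq bool) : set cantor_space :=
  [set a | prefix a (size w) = w].

(** Generating the Borel sets by the cylinders reduces measurability of maps into
    the Cantor space to finitely many digits at a time. *)
Notation cantor_meas := (g_sigma_algebraType (range cylinder_set)).

Lemma measurable_cylinder w : measurable (cylinder_set w : set cantor_meas).
Proof. by apply: sub_sigma_algebra; exists w. Qed.

Lemma cylinder_nil : cylinder_set [::] = setT.
Proof. by apply/seteqP; split. Qed.

Lemma cylinder_cons w :
  cylinder_set w = cylinder_set (false :: w) `|` cylinder_set (true :: w).
Proof.
apply/seteqP; split => a; rewrite /cylinder_set /=.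
  by move=> aw; case E: (a (size w)); [right|left]; rewrite /= ?E aw.
by case=> -[].
Qed.

Lemma cylinder_disj w :
  cylinder_set (false :: w) `&` cylinder_set (true :: w) = set0.
Proof. by apply/seteqP; split => a // [[a0 _] [a1 _]]; rewrite a0 in a1. Qed.

(** A neighborhood in the product topology constrains finitely many digits only. *)
Lemma cylinder_basis (U : set cantor_space) (a : cantor_space) :
  nbhs a U -> exists n, cylinder_set (prefix a n) `<=` U.
Proof.
move=> Ua.
pose F : set_system cantor_space :=
  filter_from setT (fun n => cylinder_set (prefix a n)).
have FF : Filter F.
  apply: filter_from_filter; first by exists 0%N.
  move=> i j _ _; exists (maxn i j) => // b; rewrite /cylinder_set /=.
  rewrite !size_prefix => /eq_prefix H.
  by split; apply: H; [exact: leq_maxl|exact: leq_maxr].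
suff /(_ _ Ua) [n _ nO] : F --> a by exists n.
apply/cvg_sup => i A; rewrite nbhsE => -[_ [[C oC <-] Ca] CA].
exists i.+1 => // b; rewrite /cylinder_set/= size_prefix => -[bi _].
by apply: CA; move: Ca; rewrite /= /proj bi.
Qed.

Lemma prefix_near (a : cantor_space) n :
  \forall b \near a, prefix b n = prefix a n.
Proof.
elim: n => [|n IH]; first by near=> b.
have aC : \forall b \near a, (b : cantor_space) n = a n.
  have /(_ [set a n]) := @proj_continuous nat (fun=> bool) n a.
  by apply; exact: (@discrete_set1 bool (a n)).
by apply: filterS2 IH aC => b /= -> ->.
Unshelve. all: by end_near. Qed.

Lemma closed_cylinder w : closed (cylinder_set w).
Proof.
rewrite -openC openE => a aw; apply: filterS (prefix_near a (size w)) => b /= ba.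
by rewrite /cylinder_set/= => bw; apply: aw; rewrite /cylinder_set/= -ba.
Qed.

Lemma compact_cylinder w : compact (cylinder_set w).
Proof.
exact: (subclosed_compact (@closed_cylinder w) cantor_space_compact).
Qed.

(** There are countably many words, so that open sets are countable unions of
    cylinders. *)
Lemma continuous_measurable_cantor (Z : ptopologicalType)
    (f : cantor_space -> Z) : continuous f ->
  measurable_fun [set: cantor_meas] (f : cantor_meas -> borel Z).
Proof.
move=> /continuousP cf; apply: (measurability (@open Z : set (set (borel Z)))) => //.
move=> _ [U oU <-]; rewrite setTI.
have -> : f @^-1` U = \bigcup_(w in [set w | cylinder_set w `<=` f @^-1` U])
    cylinder_set w.
  apply/seteqP; split => [a Ua|a [w /= wO /wO//]].
  have [|n nO] := @cylinder_basis (f @^-1` U) a.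
    by apply: open_nbhs_nbhs; split => //; exact: cf.
  by exists (prefix a n) => //; rewrite /cylinder_set/= size_prefix.
by apply: countable_bigcup_measurable => w; exact: measurable_cylinder.
Qed.

Lemma measurable_fun_cantor d (T : measurableType d) (f : T -> cantor_space) :
  (forall w, measurable [set x | prefix (f x) (size w) = w]) ->
  measurable_fun [set: T] (f : T -> cantor_meas).
Proof.
move=> mf; apply: (measurability (range cylinder_set : set (set cantor_meas))) => //.
by move=> _ [_ [w _ <-] <-]; rewrite setTI; exact: mf.
Qed.

(** Two nodes of a tree are comparable or lie on different branches. *)
Lemma cylinderI v w : (size v <= size w)%N ->
  cylinder_set v `&` cylinder_set w = cylinder_set w \/
  cylinder_set v `&` cylinder_set w = set0.
Proof.
move=> vw; have [[a [av aw]]|no] :=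
  pselect (exists a, (cylinder_set v `&` cylinder_set w) a); last first.
  by right; apply/seteqP; split => // a H; apply: no; exists a.
left; apply/setIidPr => b bw; rewrite /cylinder_set/= in av aw bw *.
by rewrite -[RHS]av; apply: (eq_prefix _ vw); rewrite bw aw.
Qed.

(** * Measures on the Cantor space from their cylinder masses *)

Lemma uniform01_exists (R : realType) : exists P : probability R R,
  forall a b : R, (0 <= a)%R -> (a <= b)%R -> (b <= 1)%R ->
    P `[a, b[%classic = (b - a)%:E.
Proof.
pose m := mrestr (@lebesgue_measure R) (measurable_itv `[0%R, 1%R[).
have mT : m setT = 1.
  by rewrite /m /mrestr setTI lebesgue_measure_itv/= lte_fin ltr01 oppr0 adde0.
have [P0 P0E] := probability_of_measure mT.
have mid : measurable_fun [set: measurableTypeR R] (id : measurableTypeR R -> R).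
  by move=> _ A mA; rewrite setTI.
have [P [PE _]] := image_probability_exists P0 mid.
exists P => a b a0 ab b1; rewrite PE P0E /m /mrestr preimage_id.
transitivity (@lebesgue_measure R `[a, b[%classic).
  congr (lebesgue_measure _); apply/setIidPl => x /=; rewrite !in_itv/= => /andP[ax xb].
  by rewrite (le_trans a0 ax) (lt_le_trans xb b1).
rewrite lebesgue_measure_itv/= lte_fin; move: ab.
by rewrite le_eqVlt => /predU1P[->|->//]; rewrite ltxx subrr.
Qed.

Section quantile.
Variable R : realType.
Implicit Types (M : seq bool -> R) (w : seq bool) (u : R).

(** [M] is the family of cylinder masses of a probability measure. *)
Definition tree_mass M :=
  [/\ M [::] = 1%R, forall w, (0 <= M w)%R &
      forall w, (M w = M (false :: w) + M (true :: w))%R].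

(** The unit interval is cut into consecutive intervals of lengths [M w], for [w]
    of a given size in lexicographic order; [left_end M w] is where the interval
    of [w] begins. *)
Fixpoint left_end M w : R :=
  if w is b :: v then (left_end M v + if b then M (false :: v) else 0)%R else 0%R.

(** The node of level [n] whose interval contains [u]. *)
Fixpoint quantile_word M u n : seq bool :=
  if n is m.+1 then
    let w := quantile_word M u m in
    (left_end M w + M (false :: w) <= u)%R :: w
  else [::].

Definition quantile M u : cantor_space :=
  fun n => (left_end M (quantile_word M u n) +
            M (false :: quantile_word M u n) <= u)%R.

Lemma prefix_quantile M u n : prefix (quantile M u) n = quantile_word M u n.
Proof. by elim: n => //= n ->. Qed.

Lemma left_end_ge0 M : tree_mass M -> forall w, (0 <= left_end M w)%R.
Proof.
move=> [_ M0 _]; elim => //= -[|] w IH; last by rewrite addr0.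
by rewrite addr_ge0.
Qed.

Lemma right_end_le1 M : tree_mass M -> forall w, (left_end M w + M w <= 1)%R.
Proof.
move=> [M1 M0 MD]; elim => [|b w IH] /=; first by rewrite M1 add0r.
apply: le_trans IH; rewrite (MD w).
by case: b; [rewrite addrA|rewrite addr0 lerD2l lerDl].
Qed.

(** The two children of a node share its interval, so that an induction along
    the word identifies the points that are sent to it. *)
Lemma quantile_wordE M u w : tree_mass M -> (0 <= u < 1)%R ->
  (quantile_word M u (size w) == w) = (left_end M w <= u < left_end M w + M w)%R.
Proof.
move=> MM u01; have [M1 M0 MD] := MM.
elim: w => [|b w IH] /=; first by rewrite eqxx M1 add0r u01.
rewrite eqseq_cons; have [E|E] := eqVneq (quantile_word M u (size w)) w; last first.
  rewrite andbF; apply/esym/negP => /andP[lu ul].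
  move: IH; rewrite (negbTE E) => /esym/negP; apply; rewrite (MD w).
  case: b lu ul => lu ul.
    by rewrite addrA ul andbT (le_trans _ lu)// lerDl.
  rewrite addr0 in lu ul; rewrite lu /= (lt_le_trans ul)// lerD2l lerDl//.
move: IH; rewrite E eqxx => /esym/andP[lu ul]; rewrite andbT.
case: b; rewrite ?addr0.
  by rewrite eqb_id -addrA -(MD w) ul andbT.
by rewrite eqbF_neg -ltNge lu.
Qed.

Context d (X : measurableType d).
Variable M : X -> seq bool -> R.
Hypothesis MM : forall x, tree_mass (M x).
Hypothesis mM : forall w, measurable_fun [set: X] (M ^~ w).

Lemma measurable_left_end w : measurable_fun [set: X] (fun x => left_end (M x) w).
Proof.
elim: w => [|b w IH] /=; first exact: measurable_cst.
by apply: measurable_funD => //; case: b; [exact: mM|exact: measurable_cst].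
Qed.

Lemma measurable_quantile : measurable_fun [set: X * R]
  ((fun z => quantile (M z.1) z.2) : X * R -> cantor_meas).
Proof.
apply: measurable_fun_cantor.
suff H w : measurable [set z : X * R | quantile_word (M z.1) z.2 (size w) = w].
  by move=> w; under eq_set do rewrite prefix_quantile; exact: H.
elim: w => [|b w IH] /=.
  by rewrite (_ : [set _ | _] = setT)//; apply/seteqP; split.
have -> : [set z : X * R | (left_end (M z.1) (quantile_word (M z.1) z.2 (size w)) +
     M z.1 (false :: quantile_word (M z.1) z.2 (size w)) <= z.2)%R ::
     quantile_word (M z.1) z.2 (size w) = b :: w] =
  [set z | quantile_word (M z.1) z.2 (size w) = w] `&`
  (fun z => (left_end (M z.1) w + M z.1 (false :: w) <= z.2)%R) @^-1` [set b].
  apply/seteqP; split => z /= [].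
    by move=> <- wE; rewrite wE.
  by move=> wE <-; rewrite wE.
apply: measurableI => //; rewrite -[X in measurable X]setTI.
apply: measurable_fun_ler => //.
apply: measurable_funD.
  exact: (measurableT_comp (measurable_left_end w)).
exact: (measurableT_comp (mM (false :: w))).
Qed.

(** A measurable family of consistent cylinder masses is a kernel: its value at
    [x] is the law of the quantile map of [M x] under the uniform measure. *)
Lemma tree_kernel_exists : exists K : R.-pker X ~> cantor_meas,
  forall x w, K x (cylinder_set w) = (M x w)%:E.
Proof.
have [P Pitv] := uniform01_exists R.
have mq x : measurable_fun [set: R] (quantile (M x) : R -> cantor_meas).
  have mx : measurable_fun [set: R] (fun u : R => (x, u)).
    by apply: measurable_fun_pair.
  exact: (measurableT_comp measurable_quantile mx).
pose L x : probability cantor_meas R := projT1 (cid (image_probability_exists P (mq x))).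
have LE x (A : set cantor_meas) : L x A = P (quantile (M x) @^-1` A).
  by rewrite /L; case: cid => ? [].
have [|K KE] := @pkernel_of_probabilities _ _ _ _ _ L.
  move=> U mU.
  have mU' := measurable_quantile measurableT mU; rewrite setTI in mU'.
  rewrite (_ : L ^~ U = P \o xsection ((fun z => quantile (M z.1) z.2) @^-1` U)).
    exact: measurable_fun_xsection.
  by apply/funext => x; rewrite LE /= xsectionE.
exists K => x w; rewrite KE LE.
have Mx := MM x; have [M1 M0 MD] := Mx.
set l := left_end (M x) w.
have l0 : (0 <= l)%R by exact: left_end_ge0.
have l1 : (l + M x w <= 1)%R by exact: right_end_le1.
set U := _ @^-1` _.
have mU : measurable U.
  rewrite -[X in measurable X]setTI; apply: (mq x) => //.
  exact: measurable_cylinder.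
have P01 : P `[0%R, 1%R[%classic = 1 by rewrite Pitv ?subr0.
rewrite -(probability_setI1 mU _ P01)//.
have -> : U `&` `[0%R, 1%R[%classic = `[l, (l + M x w)%R[%classic.
  apply/seteqP; split => u /=; rewrite !in_itv/=.
    move=> [Uu u01]; rewrite -(quantile_wordE w (MM x) u01) -prefix_quantile.
    exact/eqP.
  move=> lu; have u01 : (0 <= u < 1)%R.
    case/andP: lu => lu ul; rewrite (le_trans l0 lu).
    by rewrite (lt_le_trans ul).
  split => //; move: lu; rewrite -(quantile_wordE w (MM x) u01) => /eqP.
  by rewrite -prefix_quantile.
by rewrite Pitv// ?lerDl// addrAC subrr add0r.
Qed.

End quantile.

(** * Measurable selections and conditional probabilities *)

Section selection.
Context d (Z : measurableType d) (X : ptopologicalType).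
Variables (pi : cantor_space -> X) (T : Z -> set X).
Hypotheses (hX : hausdorff_space X) (cpi : continuous pi).
Hypothesis spi : forall x, exists a, pi a = x.
Hypotheses (T0 : forall z, T z !=set0) (clT : forall z, closed (T z)).
Hypothesis mT : forall F, closed F -> measurable [set z | T z `&` F !=set0].

Let hits z w := `[< T z `&` (pi @` cylinder_set w) !=set0 >].

(* The next digit is [false] whenever some point of [T z] has a code that
   continues in this way. *)
Fixpoint lexmin_word z n : seq bool :=
  if n is m.+1 then
    let w := lexmin_word z m in ~~ hits z (false :: w) :: w
  else [::].

Let lexmin z : cantor_space := fun n => ~~ hits z (false :: lexmin_word z n).

Let prefix_lexmin z n : prefix (lexmin z) n = lexmin_word z n.
Proof. by elim: n => //= n ->. Qed.

Let hits_lexmin z n : hits z (lexmin_word z n).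
Proof.
elim: n => [|n IH] /=.
  apply/asboolP; have [x Tx] := T0 z; exists x; split => //.
  by have [a <-] := spi x; exists a.
have [//|nh] := boolP (hits z (false :: lexmin_word z n)).
move: IH => /asboolP[x [Tx [a aw ax]]]; apply/asboolP.
move: aw; rewrite cylinder_cons => -[aw|aw].
  by exfalso; move/asboolP: nh; apply; exists x; split => //; exists a.
by exists x; split => //; exists a.
Qed.

Let closed_pi w : closed (pi @` cylinder_set w).
Proof.
apply: compact_closed => //; apply: continuous_compact.
  exact: continuous_subspaceT.
exact: compact_cylinder.
Qed.

(** Among the Cantor codes of points of [T z], the lexicographically least one
    depends measurably on [z]: its digits are decided by the closed sets
    [pi @` cylinder_set w] that [T z] meets. *)
Lemma measurable_selection : exists s : Z -> cantor_space,
  measurable_fun [set: Z] (s : Z -> cantor_meas) /\ forall z, T z (pi (s z)).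
Proof.
exists lexmin; split.
  apply: measurable_fun_cantor.
  suff H w : measurable [set z : Z | lexmin_word z (size w) = w].
    by move=> w; under eq_set do rewrite prefix_lexmin; exact: H.
  elim: w => [|b w IH] /=.
    by rewrite (_ : [set _ | _] = setT)//; apply/seteqP; split.
  have -> : [set z | ~~ hits z (false :: lexmin_word z (size w)) ::
      lexmin_word z (size w) = b :: w] =
    [set z | lexmin_word z (size w) = w] `&` [set z | ~~ hits z (false :: w) = b].
    apply/seteqP; split => z /= [].
      by move=> <- wE; rewrite wE.
    by move=> wE <-; rewrite wE.
  apply: measurableI => //.
  have mh := mT (@closed_pi (false :: w)).
  case: b.
    rewrite (_ : [set _ | _] = ~` [set z | T z `&` pi @` cylinder_set (false :: w) !=set0]).
      exact: measurableC.
    by apply/seteqP; split => z /=; [move=> /asboolPn|move=> /asboolPn].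
  rewrite (_ : [set _ | _] = [set z | T z `&` pi @` cylinder_set (false :: w) !=set0])//.
  apply/seteqP; split => z /=; first by move=> /negbFE/asboolP.
  by move=> /asboolP; rewrite /hits => ->.
move=> z; apply: contrapT => nT.
have [|n nU] := @cylinder_basis (pi @^-1` ~` T z) (lexmin z).
  apply: open_nbhs_nbhs; split => //.
  by move/continuousP : cpi; apply; exact: closed_openC.
have /asboolP[x [Tx [a an ax]]] := hits_lexmin z n.
by move: an; rewrite -prefix_lexmin => /nU /=; rewrite ax.
Qed.

End selection.

Section density_below.
Context (R : realType) d (X : measurableType d).
Variables (mu : probability X R) (nu : {finite_measure set X -> \bar R}).
Variable rho : X -> R.
Hypotheses (rho0 : forall x, (0 <= rho x)%R) (mrho : measurable_fun setT rho).
Hypothesis nule : forall A, measurable A -> nu A <= \int[mu]_(x in A) (rho x)%:E.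

(** Cutting a Radon-Nikodym derivative off at a given upper density does not
    change the measure that it defines. *)
Lemma density_below : exists r : X -> R,
  [/\ forall x, (0 <= r x <= rho x)%R, measurable_fun setT r &
      forall A, measurable A -> nu A = \int[mu]_(x in A) (r x)%:E].
Proof.
have [|f [f0 ffin /integrableP[mf _] nuE]] := @radon_nikodym_sigma_finite _ _ _ mu nu.
  apply/null_content_dominatesP => A mA A0; apply/eqP; rewrite eq_le measure_ge0 andbT.
  by rewrite (le_trans (nule mA))// null_set_integral//; exact/measurable_funTS/measurable_EFinP.
have mff : measurable_fun setT (fine \o f) by exact: measurableT_comp.
exists (fun x => Num.min (fine (f x)) (rho x)); split.
- by move=> x; rewrite le_min rho0 fine_ge0//= ge_min lexx orbT.
- exact: measurable_minr.
move=> A mA.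
pose D := [set x | (fine (f x) <= rho x)%R].
have mD : measurable D.
  rewrite -[D]setTI.
  by have := measurable_fun_ler mff mrho; move=> /(_ measurableT [set true]); apply.
have mr : measurable_fun setT (fun x => (Num.min (fine (f x)) (rho x))%:E).
  by apply/measurable_EFinP; exact: measurable_minr.
have r0 x : 0 <= (Num.min (fine (f x)) (rho x))%:E.
  by rewrite lee_fin le_min rho0 fine_ge0.
have mAD := measurableI _ _ mA mD.
have mAnD := measurableD mA mD.
have -> : nu A = nu (A `&` D) + nu (A `\` D) by rewrite addeC -measureDI.
have -> : \int[mu]_(x in A) (Num.min (fine (f x)) (rho x))%:E =
  \int[mu]_(x in A `&` D) (Num.min (fine (f x)) (rho x))%:E +
  \int[mu]_(x in A `\` D) (Num.min (fine (f x)) (rho x))%:E.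
  rewrite -ge0_integral_setU//.
  - by rewrite setUIDK.
  - exact: measurable_funTS.
  - by apply/disj_set2P; apply/seteqP; split => // x [[_ Dx] [_ nDx]].
congr (_ + _).
  rewrite nuE//; apply: eq_integral => x /[!inE] -[_ Dx].
  by rewrite min_l// fineK.
have -> : \int[mu]_(x in A `\` D) (Num.min (fine (f x)) (rho x))%:E =
    \int[mu]_(x in A `\` D) (rho x)%:E.
  apply: eq_integral => x /[!inE] -[_ /negP]; rewrite -ltNge => Dx.
  by rewrite min_r// ltW.
apply/eqP; rewrite eq_le nule//= nuE//; apply: ge0_le_integral => //.
- by move=> x _; rewrite lee_fin.
- exact/measurable_funTS/measurable_EFinP.
- exact: measurable_funTS.
- move=> x [_ /negP]; rewrite -ltNge => /ltW Dx.
  by rewrite -(fineK (ffin x)) lee_fin.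
Qed.

End density_below.

Section disintegration.
Context (R : realType) d (X : measurableType d).
Variables (nu : probability (X * cantor_meas)%type R) (mu : probability X R).
Hypothesis muE : forall A, measurable A -> mu A = nu (A `*` setT).

Let nuw w (A : set X) : \bar R := nu (A `*` (cylinder_set w : set cantor_meas)).

Let nuw0 w : nuw w set0 = 0. Proof. by rewrite /nuw set0X measure0. Qed.

Let nuw_ge0 w A : 0 <= nuw w A. Proof. exact: measure_ge0. Qed.

Let nuw_sigma_additive w : semi_sigma_additive (nuw w).
Proof.
move=> F mF tF mUF; rewrite /nuw setX_bigcupl.
have mc := measurable_cylinder w.
apply: measure_semi_sigma_additive.
- by move=> n; exact: measurableX.
- apply/trivIsetP => i j _ _ ij; apply/seteqP; split => // -[x a] /= [[Fi _] [Fj _]].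
  by have : (F i `&` F j) x by []; move/trivIsetP : tF => ->.
- by rewrite -setX_bigcupl; exact: measurableX.
Qed.

HB.instance Definition _ w := isMeasure.Build _ _ _ (nuw w)
  (nuw0 w) (nuw_ge0 w) (@nuw_sigma_additive w).

Let nuw_fin w : fin_num_fun (nuw w).
Proof.
move=> A mA; apply: fin_num_measure.
by apply: measurableX => //; exact: measurable_cylinder.
Qed.

HB.instance Definition _ w := Measure_isFinite.Build _ _ _ (nuw w) (@nuw_fin w).

Let nuwD w A : measurable A -> nuw w A = nuw (false :: w) A + nuw (true :: w) A.
Proof.
move=> mA; rewrite /nuw cylinder_cons.
have -> : A `*` (cylinder_set (false :: w) `|` cylinder_set (true :: w)) =
    A `*` cylinder_set (false :: w) `|` A `*` cylinder_set (true :: w).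
  by apply/seteqP; split => -[x a] /=; tauto.
rewrite measureU//.
- by apply: measurableX => //; exact: measurable_cylinder.
- by apply: measurableX => //; exact: measurable_cylinder.
- apply/seteqP; split => // -[x a] /= [[_ af] [_ at_]].
  by have : (cylinder_set (false :: w) `&` cylinder_set (true :: w)) a by []; rewrite cylinder_disj.
Qed.

Let density w (r : X -> R) := [/\ forall x, (0 <= r x)%R,
  measurable_fun setT r &
  forall A, measurable A -> nuw w A = \int[mu]_(x in A) (r x)%:E].

Let split_density w r : exists r', density w r ->
  [/\ forall x, (0 <= r' x <= r x)%R, density (false :: w) r' &
      density (true :: w) (fun x => r x - r' x)%R].
Proof.
have [[r0 mr rE]|] := pselect (density w r); last by exists r.
have [|r' [r'r mr' r'E]] := @density_below R d X mu (nuw (false :: w)) r r0 mr.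
  by move=> A mA; rewrite -rE// nuwD// leeDl.
exists r' => _.
have r'0 x : (0 <= r' x)%R by have /andP[] := r'r x.
have rr'0 x : (0 <= r x - r' x)%R by have /andP[_] := r'r x; rewrite subr_ge0.
split => //; split => //; first exact: measurable_funB.
move=> A mA; have := rE A mA; rewrite nuwD// r'E//.
have -> : \int[mu]_(x in A) (r x)%:E =
    \int[mu]_(x in A) ((r' x)%:E + (r x - r' x)%:E).
  by apply: eq_integral => x _; rewrite -EFinD subrKC.
rewrite ge0_integralD//.
- set a := \int[mu]_(x in A) (r' x)%:E => E.
  have afin : a \is a fin_num by rewrite /a -r'E//; exact: nuw_fin.
  by rewrite -[LHS](addeK _ afin) [X in X - _]addeC E [X in X - _]addeC addeK.
- by move=> x _; rewrite lee_fin.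
- exact/measurable_funTS/measurable_EFinP.
- by move=> x _; rewrite lee_fin.
- exact/measurable_funTS/measurable_EFinP/measurable_funB.
Qed.

(** Conditional probabilities given the first coordinate: the densities of the
    measures [A |-> nu (A * cylinder)] are chosen consistently at every point,
    and not only almost everywhere, by going down the tree. *)
Lemma cantor_disintegration : exists K : R.-pker X ~> cantor_meas,
  forall A w, measurable A ->
    nu (A `*` (cylinder_set w : set cantor_meas)) =
    \int[mu]_(x in A) K x (cylinder_set w).
Proof.
have [st stP] := choice (fun wr => split_density wr.1 wr.2).
pose rho := fix rho (w : seq bool) : X -> R := if w is b :: v then
   if b then (fun x => rho v x - st (v, rho v) x)%R else st (v, rho v)
  else cst 1%R.
have rhoD w : density w (rho w).
  elim: w => [|b w IH] /=.
    split=> // A mA; rewrite (_ : (fun _ => _) = cst 1)// integral_cst// mul1e muE//.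
    by rewrite /nuw cylinder_nil.
  by have [_ ? ?] := stP (w, rho w) IH; case: b.
have [|w|K KE] := @tree_kernel_exists R d X (fun x w => rho w x).
- move=> x; split => // [w|w]; first by have [] := rhoD w.
  by rewrite /= subrKC.
- by have [] := rhoD w.
exists K => A w mA; have [_ _ rE] := rhoD w.
rewrite -[LHS]/(nuw w A) rE//.
by apply: eq_integral => x _; rewrite KE.
Qed.

End disintegration.

(** * Disintegration over a compact metric space *)

Lemma eq_probability_integral d (T : measurableType d) (R : realType)
    (m1 m2 : probability T R) (f : T -> \bar R) :
  (forall A, measurable A -> m1 A = m2 A) ->
  \int[m1]_x f x = \int[m2]_x f x.
Proof. by move=> m12; apply: eq_measure_integral => A mA _; exact: m12. Qed.

Section rectangles.
Context d (Z : measurableType d).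

(** The empty set is added to obtain a pi-system. *)
Definition cylinder_rectangles : set (set (Z * cantor_meas)) :=
  [set E | E = set0 \/ exists A w, measurable A /\
           E = A `*` (cylinder_set w : set cantor_meas)].

Lemma cylinder_rectanglesI : setI_closed cylinder_rectangles.
Proof.
have H A B v w : measurable A -> measurable B -> (size v <= size w)%N ->
    cylinder_rectangles ((A `*` cylinder_set v) `&` (B `*` cylinder_set w)).
  move=> mA mB vw; rewrite -setXI; have [->|->] := cylinderI vw.
    by right; exists (A `&` B), w; split => //; exact: measurableI.
  by left; rewrite setX0.
move=> _ _ [->|[A [v [mA ->]]]] [->|[B [w [mB ->]]]];
  rewrite ?set0I ?setI0; try by left.
by have [vw|/ltnW vw] := leqP (size v) (size w); [|rewrite setIC]; exact: H.
Qed.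

Lemma cylinder_rectanglesE :
  @measurable _ (Z * cantor_meas)%type = <<s cylinder_rectangles >>.
Proof.
apply/seteqP; split; last first.
  apply: smallest_sub; first exact: sigma_algebra_measurable.
  move=> _ [->|[A [w [mA ->]]]] //.
  by apply: measurableX => //; exact: measurable_cylinder.
pose W := g_sigma_algebraType cylinder_rectangles.
have m1 : measurable_fun [set: W] (fst : W -> Z).
  move=> _ A mA; rewrite setTI; apply: sub_sigma_algebra; right.
  exists A, [::]; rewrite cylinder_nil; split => //.
  by apply/seteqP; split => [[a b] H|[a b] [H _]].
have m2 : measurable_fun [set: W] (snd : W -> cantor_meas).
  apply: (measurability (range cylinder_set : set (set cantor_meas))) => //.
  move=> _ [_ [w _ <-] <-]; rewrite setTI; apply: sub_sigma_algebra; right.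
  exists setT, w; split; first exact: measurableT.
  by apply/seteqP; split => [[a b] H|[a b] [_ H]].
have mid : measurable_fun [set: W] (id : W -> Z * cantor_meas).
  by apply/measurable_fun_pairP; split.
by move=> A mA; have := mid measurableT A mA; rewrite setTI.
Qed.

End rectangles.

Section disintegration_metric.
Context (R : realType) d (Z : measurableType d) (X : pmetricType R).
Hypothesis cptX : compact [set: X].
Variable nu : probability (Z * borel X)%type R.

(** A joint law is disintegrated after coding its second coordinate in the
    Cantor space, where kernels are described by cylinder masses. *)
Lemma metric_disintegration :
  exists (mu : probability Z R) (Q : R.-pker Z ~> (borel X)),
  forall f : Z * borel X -> \bar R, (forall z, 0 <= f z) ->
    measurable_fun setT f ->
    \int[nu]_z f z = \int[mu]_x \int[Q x]_y f (x, y).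
Proof.
have hX : hausdorff_space X by exact: metric_hausdorff.
have [pi cpi] := cantor_surj cptX hX.
have spi x : exists a, pi a = x.
  by have [a _ <-] := @surj _ _ _ _ pi x I; exists a.
have mpi := continuous_measurable_cantor cpi.
have [|||s [ms sP]] := @measurable_selection _ (borel X) X pi (fun x => [set x]) hX cpi spi.
- by move=> x; exists x.
- by move=> x; apply: compact_closed => //; exact: compact_set1.
- move=> F cF; rewrite (_ : [set _ | _] = F).
    by rewrite -[F]setCK; apply: measurableC; apply: sub_sigma_algebra; exact: closed_openC.
  by apply/seteqP; split => [x [y [/= ->]]//|x Fx]; exists x.
have mfst : measurable_fun setT (fst : Z * borel X -> Z) by exact: measurable_fst.
have [mu [muE _]] := image_probability_exists nu mfst.
have mcode : measurable_fun setT (fun z : Z * borel X => (z.1, s z.2 : cantor_meas)).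
  by apply: measurable_fun_pair => //; exact: measurableT_comp.
have [nuK [nuKE nuKI]] := image_probability_exists nu mcode.
have [|K KE] := @cantor_disintegration _ _ _ nuK mu.
  move=> A mA; rewrite muE nuKE; congr (nu _).
  by apply/seteqP; split => -[x y] // [].
have [nu2 [nu2E nu2I]] := semidirect_exists mu K.
have nu2K A : measurable A -> nuK A = nu2 A.
  apply: (probability_unique_gen (@cylinder_rectanglesE _ Z)).
    exact: cylinder_rectanglesI.
  move=> _ [->|[B [w [mB ->]]]]; first by rewrite !measure0.
  rewrite KE// nu2E.
  rewrite integral_mkcond; apply: eq_integral => x _.
  rewrite patchE; case: ifPn => xB; first by rewrite in_xsectionX.
  by rewrite notin_xsectionX// measure0.
have mpi2 : measurable_fun [set: Z * cantor_meas] (fun z => pi z.2 : borel X).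
  exact: measurableT_comp.
have [Q [_ QI]] := @image_kernel_exists _ _ _ _ _ _ _ K
  (fun _ => pi : cantor_meas -> borel X) mpi2.
exists mu, Q => f f0 mf.
have mfpi : measurable_fun setT (fun z : Z * cantor_meas => f (z.1, pi z.2)).
  have mp : measurable_fun setT (fun z : Z * cantor_meas => (z.1, pi z.2 : borel X)).
    by apply: measurable_fun_pair => //; exact: measurable_fst.
  exact: (measurableT_comp mf mp).
transitivity (\int[nuK]_z f (z.1, pi z.2)).
  by rewrite nuKI//; apply: eq_integral => -[x y] _ /=; rewrite [in RHS]sP.
rewrite (eq_probability_integral _ nu2K) nu2I//; apply: eq_integral => x _.
rewrite QI//.
have mx : measurable_fun setT (fun y : borel X => (x, y)) by exact: measurable_fun_pair.
exact: (measurableT_comp mf mx).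
Qed.

End disintegration_metric.

(** * Positive functionals on the functions bounded on a set *)

(** Otherwise, following nodes no level below which has the property would
    trace a branch along which it never holds (Koenig's lemma). *)
Lemma tree_bar (Pr : seq bool -> Prop) :
  (forall b w, Pr w -> Pr (b :: w)) ->
  (forall a : nat -> bool, exists n, Pr (prefix a n)) ->
  exists n, forall w, size w = n -> Pr w.
Proof.
move=> Prmono Prbar.
have Prcat v w : Pr w -> Pr (v ++ w).
  by move=> Pw; elim: v => //= b v; exact: Prmono.
pose good w := exists n, forall v, size v = n -> Pr (v ++ w).
suff [n H] : good [::] by exists n => w /H; rewrite cats0.
apply: contrapT => bad0.
have next w : exists b, ~ good w -> ~ good (b :: w).
  have [g0|b0] := pselect (good (false :: w)); last by exists false.
  have [g1|b1] := pselect (good (true :: w)); last by exists true.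
  exists true => nw; exfalso; apply: nw.
  have [[n0 H0] [n1 H1]] := (g0, g1).
  exists (maxn n0 n1).+1 => v; case/lastP: v => [//|v b].
  rewrite size_rcons => -[sv]; rewrite cat_rcons.
  have drop_size n : (n <= maxn n0 n1)%N -> size (drop (size v - n) v) = n.
    by move=> le; rewrite size_drop sv subKn.
  case: b.
    rewrite -(cat_take_drop (size v - n1) v) -catA; apply/Prcat/H1/drop_size.
    exact: leq_maxr.
  rewrite -(cat_take_drop (size v - n0) v) -catA; apply/Prcat/H0/drop_size.
  exact: leq_maxl.
have [nxt nxtP] := choice next.
pose W := fix W n : seq bool := if n is m.+1 then nxt (W m) :: W m else [::].
have badW n : ~ good (W n) by elim: n => //= n /nxtP.
pose a n := nxt (W n).
have aW n : prefix a n = W n by elim: n => //= n ->.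
have [n] := Prbar a; rewrite aW => Pn; apply: (badW n).
by exists 0%N => -[].
Qed.

Section graph_average.
Context (R : realType) (W : Type).

Definition bounded_on (G : set W) (psi : W -> R) :=
  exists C, forall z, G z -> (`|psi z| <= C)%R.

(** These are the finitely additive probability measures carried by [G]: the
    last condition expresses positivity, normalization and locality at once, and
    nothing is required of monotone limits. *)
Definition graph_average (G : set W) (L : (W -> R) -> R) :=
  [/\ forall f g, bounded_on G f -> bounded_on G g ->
        L (fun z => f z + g z)%R = (L f + L g)%R,
      forall c f, bounded_on G f -> L (fun z => c * f z)%R = (c * L f)%R &
      forall c f, bounded_on G f -> (forall z, G z -> f z <= c)%R -> (L f <= c)%R].

Variables (G : set W) (L : (W -> R) -> R).
Hypothesis LG : graph_average G L.

Lemma bounded_onD f g : bounded_on G f -> bounded_on G g ->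
  bounded_on G (fun z => f z + g z)%R.
Proof.
move=> [C Cf] [D Dg]; exists (C + D)%R => z Gz.
by rewrite (le_trans (ler_normD _ _))// lerD// ?Cf ?Dg.
Qed.

Lemma bounded_onZ c f : bounded_on G f -> bounded_on G (fun z => c * f z)%R.
Proof.
move=> [C Cf]; exists (`|c| * C)%R => z Gz.
by rewrite normrM ler_wpM2l// Cf.
Qed.

Lemma bounded_on_cst c : bounded_on G (fun=> c).
Proof. by exists `|c|%R. Qed.

Lemma graph_average_ge c f : bounded_on G f ->
  (forall z, G z -> c <= f z)%R -> (c <= L f)%R.
Proof.
have [_ LZ Lle] := LG; move=> bf cf; rewrite -lerN2 -mulN1r -LZ//.
apply: Lle; first exact: bounded_onZ.
by move=> z Gz; rewrite mulN1r lerN2 cf.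
Qed.

Lemma graph_average_cst c : L (fun=> c) = c.
Proof.
have [_ LZ Lle] := LG; apply/eqP; rewrite eq_le Lle//=; last exact: bounded_on_cst.
by apply: graph_average_ge => //; exact: bounded_on_cst.
Qed.

Lemma graph_average_le f g : bounded_on G f -> bounded_on G g ->
  (forall z, G z -> f z <= g z)%R -> (L f <= L g)%R.
Proof.
have [LD LZ Lle] := LG; move=> bf bg fg.
have bNf := bounded_onZ (-1) bf.
have := @graph_average_ge 0%R _ (bounded_onD bg bNf).
rewrite LD// LZ// mulN1r subr_ge0; apply.
by move=> z Gz; rewrite mulN1r subr_ge0 fg.
Qed.

Lemma bounded_on_sum (I : Type) (s : seq I) (F : I -> W -> R) :
  (forall i, bounded_on G (F i)) -> bounded_on G (fun z => \sum_(i <- s) F i z)%R.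
Proof.
move=> bF; elim: s => [|i s IH].
  by under [X in bounded_on _ X]funext do rewrite big_nil; exact: bounded_on_cst.
under [X in bounded_on _ X]funext do rewrite big_cons.
exact: bounded_onD.
Qed.

Lemma graph_average_sum (I : Type) (s : seq I) (F : I -> W -> R) :
  (forall i, bounded_on G (F i)) ->
  L (fun z => \sum_(i <- s) F i z)%R = (\sum_(i <- s) L (F i))%R.
Proof.
have [LD LZ Lle] := LG; move=> bF; elim: s => [|i s IH].
  rewrite big_nil -[RHS](graph_average_cst 0); congr (L _).
  by apply/funext => z; rewrite big_nil.
rewrite big_cons -IH -LD//; last exact: bounded_on_sum.
by congr (L _); apply/funext => z; rewrite big_cons.
Qed.

End graph_average.

(** * Representation of functionals by measures *)

Lemma measurable_within d (Y : measurableType d) (R : realType)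
    (W : topologicalType) (h : Y -> W) (G : set W) (psi : W -> R) :
  (forall U, open U -> measurable (h @^-1` U)) -> closed G ->
  {within G, continuous psi} -> measurable_fun (h @^-1` G) (psi \o h).
Proof.
move=> mh cG cpsi.
have mG : measurable (h @^-1` G).
  by rewrite -[_ @^-1` _]setCK; apply: measurableC; apply: (mh (~` G)); exact: closed_openC.
apply: (measurability (@RGenOInfty.G R)).
  exact: RGenOInfty.measurableE.
move=> _ [_ [r ->] <-].
have /open_subspaceP[V oV VG] : open (psi @^-1` `]r, +oo[%classic : set (subspace G)).
  by move/continuousP : cpsi; apply; exact: interval_open.
rewrite (_ : _ `&` _ = h @^-1` G `&` h @^-1` V).
  by apply: measurableI => //; exact: mh.
rewrite -preimage_setI [G `&` V]setIC VG.
by apply/seteqP; split => y /= [].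
Qed.

Section representation.
Context (R : realType) (W : pseudoPMetricType R).
Hypotheses (cptW : compact [set: W]) (hW : hausdorff_space W).
Variables (G : set W) (L : (W -> R) -> R).
Hypotheses (cG : closed G) (LG : graph_average G L).

(** Along each branch the images of cylinders shrink to a point, where [psi] is
    continuous or which lies off [G]; the bar lemma makes this uniform. *)
Lemma oscillation_level (pi : cantor_space -> W) (psi : W -> R) (eta : R) :
  continuous pi -> {within G, continuous psi} -> (0 < eta)%R ->
  exists n, forall w, size w = n -> forall z z',
    (G `&` pi @` cylinder_set w) z -> (G `&` pi @` cylinder_set w) z' ->
    (`|psi z - psi z'| <= eta)%R.
Proof.
move=> cpi cpsi eta0.
apply: (@tree_bar (fun w => forall z z',
    (G `&` pi @` cylinder_set w) z -> (G `&` pi @` cylinder_set w) z' ->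
    (`|psi z - psi z'| <= eta)%R)).
  move=> b w H z z' [Gz [a aw az]] [Gz' [a' aw' az']].
  have sub c : cylinder_set (b :: w) c -> cylinder_set w c by case.
  by apply: H; split => //; [exists a => //; exact: sub|exists a' => //; exact: sub].
move=> a; have [Ga|nGa] := pselect (G (pi a)).
  move/subspace_continuousP : cpsi => /(_ _ Ga)/cvgrPdist_lt/(_ (eta / 2)%R).
  rewrite divr_gt0// => /(_ isT).
  rewrite !near_withinE => H.
  have [n nU] := @cylinder_basis (pi @^-1` [set z | G z -> (`|psi (pi a) - psi z| < eta / 2)%R]) a (cpi a _ H).
  exists n => z z' [Gz [b bn bz]] [Gz' [b' bn' bz']].
  have := nU _ bn; rewrite /= bz => /(_ Gz) H1.
  have := nU _ bn'; rewrite /= bz' => /(_ Gz') H2.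
  rewrite (_ : psi z - psi z' = (psi (pi a) - psi z') - (psi (pi a) - psi z))%R; last by ring.
  by rewrite (le_trans (ler_normB _ _))// ltW// [ltRHS](splitr eta) ltrD.
have [|n nU] := @cylinder_basis (pi @^-1` ~` G) a.
  apply: open_nbhs_nbhs; split => //.
  by move/continuousP : cpi; apply; exact: closed_openC.
exists n => z z' [Gz [b bn bz]]; exfalso.
by have := nU _ bn; rewrite /= bz.
Qed.

(** A version of the Riesz theorem. Every point has a chosen code; the value of
    the functional on the indicator of the set of points whose code starts with
    a word is taken as the mass of the cylinder of that word. Words whose image
    misses [G] get no mass, and step functions over the words of a long fixed
    length approximate continuous functions uniformly on [G]. *)
Theorem graph_average_representation :
  exists pi : cantor_space -> W, continuous pi /\
  exists P : probability cantor_meas R, P (pi @^-1` G) = 1 /\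
    forall psi : W -> R, {within G, continuous psi} -> (forall z, G z -> (0 <= psi z)%R) ->
      \int[P]_(a in pi @^-1` G) (psi (pi a))%:E = (L psi)%:E.
Proof.
have [pi cpi] := cantor_surj cptW hW.
have /choice[s sP] (x : W) : exists a, pi a = x.
  by have [a _ <-] := @surj _ _ _ _ pi x I; exists a.
exists pi; split => //.
pose ind w (z : W) : R := (prefix (s z) (size w) == w)%:R.
have bind w : bounded_on G (ind w).
  by exists 1%R => z _; rewrite /ind ger0_norm ?ler0n//; case: (_ == w); rewrite ?ler01.
pose M w := L (ind w).
have M0 w : (0 <= M w)%R.
  by apply: (graph_average_ge LG) => // z _; rewrite ler0n.
have indD w z : ind w z = (ind (false :: w) z + ind (true :: w) z)%R.
  rewrite /ind /= !eqseq_cons -natrD.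
  by case: (s z (size w)); case: (_ == w).
have Mtree : tree_mass M.
  split => //.
    rewrite -[RHS](graph_average_cst LG 1%R) /M; congr (L _).
  move=> w; have [LD _ _] := LG; rewrite /M -LD//; congr (L _).
  by apply/funext => z; exact: indD.
have [K KE] : exists K : R.-pker unit ~> cantor_meas,
    forall x w, K x (cylinder_set w) = (M w)%:E.
  by apply: (@tree_kernel_exists R _ unit (fun=> M)) => // w; exact: measurable_cst.
have [P PK] := probability_of_measure (@prob_kernel _ _ _ _ _ K tt).
have PE w : P (cylinder_set w) = (M w)%:E by rewrite PK KE.
have mpi U : open U -> measurable (pi @^-1` U : set cantor_meas).
  move=> oU; have := continuous_measurable_cantor cpi; move=> /(_ measurableT U).
  by rewrite setTI; apply; exact: sub_sigma_algebra.
have mGpi : measurable (pi @^-1` G : set cantor_meas).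
  by rewrite -[_ @^-1` _]setCK; apply: measurableC; apply: (mpi (~` G)); exact: closed_openC.
have M00 w : (forall z, G z -> ~ (pi @` cylinder_set w) z) -> M w = 0%R.
  move=> H; have [_ _ Lle] := LG; apply/eqP; rewrite eq_le M0 andbT.
  apply: Lle => // z Gz; rewrite /ind; case: eqP => // zw.
  by exfalso; apply: (H z Gz); exists (s z).
have PG : P (pi @^-1` G) = 1.
  have P0 : P (~` (pi @^-1` G)) = 0.
    have -> : ~` (pi @^-1` G) = \bigcup_(w in [set w |
        forall z, G z -> ~ (pi @` cylinder_set w) z]) cylinder_set w.
      apply/seteqP; split => [a nGa|a [w wG aw] Ga]; last first.
        by apply: (wG _ Ga); exists a.
      have [|n nU] := @cylinder_basis (pi @^-1` ~` G) a.
        apply: open_nbhs_nbhs; split => //.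
        by move/continuousP : cpi; apply; exact: closed_openC.
      exists (prefix a n); last by rewrite /cylinder_set/= size_prefix.
      by move=> z Gz [b bn bz]; have := nU _ bn; rewrite /= bz.
    apply: countable_bigcup_null => w; first exact: measurable_cylinder.
    by move=> /M00 w0; rewrite PE w0.
  by rewrite -[_ @^-1` _]setCK probability_setC ?P0 ?sube0//; exact: measurableC.
exists P; split => // psi cpsi psi0.
set D := pi @^-1` G.
have mpsi : measurable_fun (D : set cantor_meas) (fun a => (psi (pi a))%:E).
  by apply/measurable_EFinP; exact: measurable_within.
suff H eta : (0 < eta)%R ->
    \int[P]_(a in D) (psi (pi a))%:E <= (L psi + 2 * eta)%:E /\
    (L psi)%:E <= \int[P]_(a in D) (psi (pi a))%:E + (2 * eta)%:E.
  apply/eqP; rewrite eq_le; apply/andP; split; apply/lee_addgt0Pr => e e0.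
    have [|+ _] := H (e / 2)%R; first by rewrite divr_gt0.
    by rewrite -EFinD mulrC divfK.
  have [|_ +] := H (e / 2)%R; first by rewrite divr_gt0.
  by rewrite [(2 * _)%R]mulrC divfK.
move=> eta0.
have [n nP] := oscillation_level cpi cpsi eta0.
have /choice[c cP] (w : seq bool) : exists r : R, (0 <= r)%R /\
    forall z, size w = n -> (G `&` pi @` cylinder_set w) z ->
    (`|psi z - r| <= eta)%R.
  have [[z Gz]|no] := pselect (exists z, (G `&` pi @` cylinder_set w) z).
    exists (psi z); split; first by apply: psi0; case: Gz.
    by move=> z' wn Gz'; exact: (nP w wn).
  by exists 0%R; split => // z _ Gz; exfalso; apply: no; exists z.
have sumE (a : cantor_space) :
    (\sum_(w : n.-tuple bool) c w * (prefix a (size w) == w)%:R)%R = c (prefix a n).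
  pose t : n.-tuple bool := Tuple (introT eqP (size_prefix a n)).
  rewrite (bigD1 t)//= size_prefix eqxx mulr1 big1 ?addr0// => w wt.
  rewrite size_tuple; case: eqP => [E|]; last by rewrite mulr0.
  by exfalso; move/eqP : wt; apply; apply: val_inj; rewrite /= E.
have psic a : D a -> (`|psi (pi a) - c (prefix a n)| <= eta)%R.
  move=> Da; apply: (proj2 (cP (prefix a n))); first by rewrite size_prefix.
  by split => //; exists a => //; rewrite /cylinder_set/= size_prefix.
(* [S] is the common value of the functional and of the integral on the step
   function that approximates [psi] up to [eta]. *)
pose S := (\sum_(w : n.-tuple bool) c w * M w)%R.
pose g z := (\sum_(w : n.-tuple bool) c w * ind w z)%R.
have bcind (w : n.-tuple bool) : bounded_on G (fun z => c w * ind w z)%R.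
  exact: bounded_onZ.
have bg : bounded_on G g by exact: bounded_on_sum.
have Lg : L g = S.
  rewrite /g (graph_average_sum LG)//; apply: eq_bigr => w _.
  by have [_ -> ] := LG.
have psig z : G z -> (`|psi z - g z| <= eta)%R.
  move=> Gz; rewrite /g sumE -[in psi z](sP z).
  by apply: psic; rewrite /D /= sP.
have bpsi : bounded_on G psi.
  have [C Cg] := bg; exists (eta + C)%R => z Gz.
  rewrite -(subrK (g z) (psi z)) (le_trans (ler_normD _ _))// lerD//.
    exact: psig.
  exact: Cg.
have [LD LZ Lle] := LG.
have beta : bounded_on G (fun=> eta) by exact: bounded_on_cst.
have Lpsi_le : (L psi <= S + eta)%R.
  rewrite -Lg -[in leRHS](graph_average_cst LG eta) -LD//.
  apply: (graph_average_le LG) => //; first exact: bounded_onD.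
  by move=> z Gz; have := psig z Gz; rewrite ler_norml => /andP[_ h]; lra.
have Lpsi_ge : (S <= L psi + eta)%R.
  rewrite -Lg -[in leRHS](graph_average_cst LG eta) -LD//.
  apply: (graph_average_le LG) => //; first exact: bounded_onD.
  by move=> z Gz; have := psig z Gz; rewrite ler_norml => /andP[h _]; lra.
pose gK (a : cantor_meas) := (\sum_(w : n.-tuple bool) (c w)%:E * (\1_(cylinder_set w) a)%:E).
have gKE a : gK a = (c (prefix a n))%:E.
  rewrite -sumE -sumEFin; apply: eq_bigr => w _; rewrite EFinM indicE.
  by congr (_ * (nat_of_bool _)%:R%:E); apply/idP/eqP; rewrite inE.
have mind (w : n.-tuple bool) :
    measurable_fun (D : set cantor_meas) (fun a => (\1_(cylinder_set w) a : R)%:E).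
  by apply/measurable_EFinP; apply: measurable_indic; exact: measurable_cylinder.
have intg : \int[P]_(a in D) gK a = S%:E.
  rewrite ge0_integral_sum//.
  - rewrite -sumEFin; apply: eq_bigr => w _.
    rewrite ge0_integralZl_EFin//; last by have [] := cP w.
    rewrite integral_indic//; last exact: measurable_cylinder.
    by rewrite (probability_setI1 (measurable_cylinder w) mGpi PG) PE EFinM.
  - by move=> w; exact: measurable_funeM.
  - by move=> w a _; rewrite -EFinM lee_fin mulr_ge0//; have [] := cP w.
have mgK : measurable_fun (D : set cantor_meas) gK.
  by apply: emeasurable_sum => w; exact: measurable_funeM.
have inteta : \int[P]_(a in D) eta%:E = eta%:E.
  by rewrite integral_cst//= PG mule1.
have gK0 a : 0 <= gK a by rewrite gKE lee_fin; have [] := cP (prefix a n).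
have I_le : \int[P]_(a in D) (psi (pi a))%:E <= (S + eta)%:E.
  rewrite EFinD -intg -[in leRHS]inteta -ge0_integralD//; last first.
    by move=> a _; rewrite lee_fin ltW.
  apply: ge0_le_integral => //.
  - by move=> a Da; rewrite lee_fin psi0.
  - exact: emeasurable_funD.
  - move=> a Da; rewrite gKE -EFinD lee_fin.
    by have := psic a Da; rewrite ler_norml => /andP[_ h]; lra.
have I_ge : S%:E <= \int[P]_(a in D) (psi (pi a))%:E + eta%:E.
  rewrite -intg -[in leRHS]inteta -ge0_integralD//; last 2 first.
  - by move=> a Da; rewrite lee_fin psi0.
  - by move=> a _; rewrite lee_fin ltW.
  apply: ge0_le_integral => //.
  - exact: emeasurable_funD.
  - move=> a Da; rewrite gKE -EFinD lee_fin.
    have := psic a Da; rewrite ler_norml => /andP[h _]; lra.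
split.
  apply: (le_trans I_le); rewrite lee_fin mulrDl mul1r addrA lerD2r.
  exact: Lpsi_ge.
rewrite mulrDl mul1r EFinD addeA.
apply: (@le_trans _ _ (S + eta)%:E); first by rewrite lee_fin.
by rewrite EFinD leeD2r.
Qed.

End representation.

(** * The graph of a correspondence *)

Section graphs.
Context (R : realType) (X : pmetricType R).
Hypothesis cptX : compact [set: X].
Implicit Types (T : X -> set X).

Let hX : hausdorff_space X. Proof. exact: metric_hausdorff. Qed.

Lemma hausdorff_square : hausdorff_space (X * X)%type.
Proof.
move=> [p1 p2] [q1 q2] pq; congr (_, _); apply: hX => A B nA nB.
  have [||[x y] [[Ax _] [Bx _]]] := pq (A `*` setT) (B `*` setT).
  - by exists (A, setT) => //; split => //; exact: filterT.
  - by exists (B, setT) => //; split => //; exact: filterT.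
  by exists x.
have [||[x y] [[_ Ay] [_ By]]] := pq (setT `*` A) (setT `*` B).
- by exists (setT, A) => //; split => //; exact: filterT.
- by exists (setT, B) => //; split => //; exact: filterT.
by exists y.
Qed.

Lemma compact_square : compact [set: X * X].
Proof. by rewrite -setXTT; exact: compact_setX. Qed.

Lemma borel_open (U : set X) : open U -> measurable (U : set (borel X)).
Proof. exact: sub_sigma_algebra. Qed.

Lemma borel_closed (F : set X) : closed F -> measurable (F : set (borel X)).
Proof.
by move=> cF; rewrite -[F]setCK; apply: measurableC; apply: borel_open; exact: closed_openC.
Qed.

(** Second countability enters through the Cantor coding: an open subset of the
    square is a countable union of products of images of cylinders. *)
Lemma measurable_open_square (U : set (X * X)) : open U ->
  measurable (U : set (borel X * borel X)).
Proof.
move=> oU; have [pi cpi] := cantor_surj cptX hX.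
have spi x : exists a, pi a = x.
  by have [a _ <-] := @surj _ _ _ _ pi x I; exists a.
have clpi w : closed (pi @` cylinder_set w).
  apply: compact_closed => //; apply: continuous_compact.
    exact: continuous_subspaceT.
  exact: compact_cylinder.
have -> : U = \bigcup_(wv in [set wv : seq bool * seq bool |
    (pi @` cylinder_set wv.1) `*` (pi @` cylinder_set wv.2) `<=` U])
    ((pi @` cylinder_set wv.1) `*` (pi @` cylinder_set wv.2)).
  apply/seteqP; split => [[x y] Uxy|z [wv wvU /wvU//]].
  have [[a ax] [b by_]] := (spi x, spi y).
  have [[A B] /= [nA nB] AB] : nbhs (pi a, pi b) U.
    by rewrite ax by_; apply: open_nbhs_nbhs.
  have [n nU] := cylinder_basis (cpi a A nA).
  have [m mU] := cylinder_basis (cpi b B nB).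
  exists (prefix a n, prefix b m) => /=.
    move=> [x' y'] [/= [a' a'n <-] [b' b'm <-]].
    by apply: AB; split; [exact: (nU a')|exact: (mU b')].
  by split => /=; [exists a|exists b] => //; rewrite /cylinder_set/= size_prefix.
apply: countable_bigcup_measurable => wv.
by apply: measurableX; apply: borel_closed.
Qed.

Lemma measurable_closed_square (F : set (X * X)) : closed F ->
  measurable (F : set (borel X * borel X)).
Proof.
move=> cF; rewrite -[F]setCK; apply: measurableC.
by apply: measurable_open_square; exact: closed_openC.
Qed.

(** A point outside [T x] has a neighborhood with closure outside [T x], which
    upper semicontinuity keeps outside the images of the points near [x]. *)
Lemma closed_corr_graph T : correspondence T -> closed (corr_graph T).
Proof.
move=> [_ clT uscT]; rewrite -openC openE => -[x y] /= nTxy.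
have : open_nbhs y (~` T x) by split => //; exact: closed_openC.
move=> /open_nbhs_nbhs/uniform_regular[B nB BT].
have [|z Tz|V [oV Vx VT]] := uscT x (~` closure B).
- exact/closed_openC/closed_closure.
- by move=> /BT; apply.
exists (V, B) => /=; first by split => //; apply: open_nbhs_nbhs.
move=> [x' y'] [/= Vx' By'] Txy'; apply: (VT x' Vx' y' Txy').
exact: subset_closure.
Qed.

Lemma measurable_corr_graph T : correspondence T ->
  measurable (corr_graph T : set (borel X * borel X)).
Proof. by move=> corrT; apply: measurable_closed_square => //; exact: closed_corr_graph. Qed.

Lemma measurable_on_graph T phi : correspondence T -> continuous_on_graph T phi ->
  measurable_fun (corr_graph T : set (borel X * borel X))
    (phi : borel X * borel X -> R).
Proof.
move=> corrT cphi.
apply: (@measurable_within _ (borel X * borel X)%type R (X * X)%type id (corr_graph T) phi) => //.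
  by move=> U oU; exact: measurable_open_square.
exact: closed_corr_graph.
Qed.

Lemma compact_corr_graph T : correspondence T -> compact (corr_graph T).
Proof.
move=> corrT; apply: (subclosed_compact _ compact_square) => //.
exact: closed_corr_graph.
Qed.

Lemma bounded_on_graph T phi : correspondence T -> continuous_on_graph T phi ->
  bounded_on (corr_graph T) phi.
Proof.
move=> corrT cphi.
have := continuous_compact cphi (compact_corr_graph corrT).
move=> /compact_bounded[M [_ MP]]; exists (M + 1)%R => z Gz.
by apply: (MP (M + 1)%R); [rewrite ltrDl|exists z].
Qed.

End graphs.

(** * Integrals of potentials *)

Section potential.
Context (R : realType) (X : pmetricType R) (T : X -> set X).
Hypotheses (cptX : compact [set: X]) (corrT : correspondence T).
Local Notation G := (corr_graph T).
Local Notation BB := (borel X * borel X)%type.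

Let mG : measurable (G : set BB).
Proof. exact: measurable_corr_graph. Qed.

Let mphi (phi : X * X -> R) : continuous_on_graph T phi ->
  measurable_fun (G : set BB) (phi : BB -> R).
Proof. by move=> cphi; exact: measurable_on_graph. Qed.

Let xsectionG (x : X) : xsection G x = T x.
Proof. by rewrite xsectionE. Qed.

Let mT x : measurable (T x : set (borel X)).
Proof.
rewrite -xsectionG.
exact: (@measurable_xsection _ _ (borel X) (borel X) (G : set BB) x mG).
Qed.

Let mphix (phi : X * X -> R) x : continuous_on_graph T phi ->
  measurable_fun (T x : set (borel X)) (fun y => phi (x, y)).
Proof.
move=> cphi; have mpair : measurable_fun setT (fun y : borel X => (x : borel X, y)).
  exact: measurable_fun_pair.
apply: (measurable_comp mG _ (mphi cphi)).
  by move=> _ [y Ty <-].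
exact: measurable_funTS.
Qed.

Lemma continuous_on_graphD phi psi :
  continuous_on_graph T phi -> continuous_on_graph T psi ->
  continuous_on_graph T (fun z => phi z + psi z)%R.
Proof. by move=> cphi cpsi z; apply: cvgD; [exact: cphi|exact: cpsi]. Qed.

Lemma continuous_on_graph_cst c : continuous_on_graph T (fun=> c : R).
Proof. by move=> z; exact: cvg_cst. Qed.

Lemma continuous_on_graphZ c phi : continuous_on_graph T phi ->
  continuous_on_graph T (fun z => c * phi z)%R.
Proof. by move=> cphi z; apply: cvgM; [exact: cvg_cst|exact: cphi]. Qed.

Section joint.
Variables (Q : R.-pker (borel X) ~> (borel X)) (mu : probability (borel X) R).
Hypothesis QT : supported_by T Q.

Let Cint (phi : X * X -> R) x : continuous_on_graph T phi ->
  (Q x).-integrable (T x) (fun y => (phi (x, y))%:E).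
Proof.
move=> cphi; apply: measurable_bounded_integrable => //.
- by rewrite QT ltry.
- exact: mphix.
have [C CP] := bounded_on_graph cptX corrT cphi.
exists C; split; first exact: num_real.
move=> D CD y Ty /=; rewrite (le_trans (CP (x, y) Ty))//.
exact: ltW.
Qed.

(** The joint law of a step of the chain: it charges the graph only, since [Q] is
    supported by [T], and continuous potentials are bounded there, so that
    Fubini's theorem for nonnegative functions extends to them by adding a
    constant. *)
Lemma potential_integral_joint : exists nu : probability BB R,
  [/\ nu G = 1,
      forall f : BB -> \bar R, (forall z, 0 <= f z) -> measurable_fun setT f ->
        \int[nu]_z f z = \int[mu]_x \int[Q x]_y f (x, y) &
      forall phi, continuous_on_graph T phi ->
        potential_integral T phi Q mu = \int[nu]_(z in G) (phi z)%:E].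
Proof.
have [nu [nuA nuI]] := semidirect_exists mu Q.
have nuG : nu G = 1.
  rewrite nuA; under eq_integral do rewrite xsectionG QT.
  by rewrite integral_cst//= mul1e probability_setT.
exists nu; split => // phi cphi.
have ge0E psi : continuous_on_graph T psi -> (forall z, G z -> (0 <= psi z)%R) ->
    potential_integral T psi Q mu = \int[nu]_(z in G) (psi z)%:E.
  move=> cpsi psi0; rewrite [RHS]integral_mkcond nuI//.
  - apply: eq_integral => x _; rewrite [LHS]integral_mkcond.
    by apply: eq_integral => y _; rewrite !patchE.
  - by move=> z; rewrite patchE; case: ifPn => // /set_mem Gz; rewrite lee_fin psi0.
  - by apply/(measurable_restrictT _ mG)/measurable_EFinP; exact: mphi.
have [C CP] := bounded_on_graph cptX corrT cphi.
have C0 z : G z -> (0 <= phi z + C)%R.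
  by move=> /CP; rewrite ler_norml => /andP[h _]; lra.
have cpsi : continuous_on_graph T (fun z => phi z + C)%R.
  by apply: continuous_on_graphD => //; exact: continuous_on_graph_cst.
have inuphi : nu.-integrable G (fun z => (phi z)%:E).
  apply: measurable_bounded_integrable => //.
  - by rewrite nuG ltry.
  - exact: mphi.
  exists C; split; first exact: num_real.
  by move=> D CD z Gz /=; rewrite (le_trans (CP z Gz))// ltW.
have nuC : \int[nu]_(z in G) C%:E = C%:E by rewrite integral_cst//= nuG mule1.
have inuC : nu.-integrable G (cst C%:E) by exact: finite_measure_integrable_cst.
have nuphiC : \int[nu]_(z in G) (phi z + C)%:E = \int[nu]_(z in G) (phi z)%:E + C%:E.
  by rewrite -[in RHS]nuC -integralD.
pose h x := \int[Q x]_(y in T x) (phi (x, y) + C)%:E.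
have hE x : \int[Q x]_(y in T x) (phi (x, y))%:E = h x - C%:E.
  have QC : \int[Q x]_(y in T x) C%:E = C%:E.
    by rewrite integral_cst//= QT mule1.
  have -> : h x = \int[Q x]_(y in T x) (phi (x, y))%:E + C%:E.
    rewrite -[in RHS]QC -integralD//; first exact: Cint.
    exact: (@Cint (fun=> C) x (@continuous_on_graph_cst C)).
  by rewrite addeK.
have h0 x : 0 <= h x.
  by apply: integral_ge0 => y Ty; rewrite lee_fin; exact: (C0 (x, y)).
have mh : measurable_fun setT h.
  pose k : BB -> \bar R := (fun z => (phi z + C)%:E) \_ G.
  rewrite (_ : h = fun x => \int[Q x]_y k (x, y)).
    apply: measurable_fun_integral_finite_kernel.
      by move=> z; rewrite /k patchE; case: ifPn => // /set_mem Gz; rewrite lee_fin C0.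
    by apply/(measurable_restrictT _ mG)/measurable_EFinP; exact: mphi.
  apply/funext => x; rewrite /h integral_mkcond.
  by apply: eq_integral => y _; rewrite /k !patchE.
have hC x : h x <= (C + C)%:E.
  have <- : \int[Q x]_(y in T x) (C + C)%:E = (C + C)%:E.
    by rewrite integral_cst//= QT mule1.
  apply: ge0_le_integral => //.
  - by move=> y Ty; rewrite lee_fin (C0 (x, y)).
  - by apply/measurable_EFinP; have := @mphix _ x cpsi.
  - move=> y Ty; rewrite lee_fin lerD2r (le_trans (ler_norm _))//.
    exact: (CP (x, y)).
have ih : mu.-integrable setT h.
  apply/integrableP; split => //.
  apply: (@le_lt_trans _ _ (\int[mu]_x (C + C)%:E)).
    apply: ge0_le_integral => //.
    - exact: measurableT_comp.
    - by move=> x _; rewrite gee0_abs// hC.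
  by rewrite integral_cst//= probability_setT mule1 ltry.
have muC : \int[mu]_x C%:E = C%:E by rewrite integral_cst//= probability_setT mule1.
rewrite /potential_integral; under eq_integral do rewrite hE.
rewrite integralB//; last by have := finite_measure_integrable_cst mu C measurableT.
by rewrite muC -/(potential_integral T (fun z => phi z + C)%R Q mu) (ge0E _ cpsi C0) nuphiC addeK.
Qed.

End joint.
End potential.

(** * Kernels that realize a functional *)

Section potential_mean.
Context (R : realType) (X : pmetricType R) (T : X -> set X).
Hypotheses (cptX : compact [set: X]) (corrT : correspondence T).
Local Notation G := (corr_graph T).
Local Notation BB := (borel X * borel X)%type.

Let mG : measurable (G : set BB).
Proof. exact: measurable_corr_graph. Qed.

Let mphi (phi : X * X -> R) : continuous_on_graph T phi ->
  measurable_fun (G : set BB) (phi : BB -> R).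
Proof. by move=> cphi; exact: measurable_on_graph. Qed.

(** The integrals of potentials as a real functional, so that their linearity
    can be used without finiteness conditions. *)
Lemma potential_mean_exists (Q : R.-pker (borel X) ~> (borel X))
    (mu : probability (borel X) R) : supported_by T Q ->
  exists I : (X * X -> R) -> R,
  [/\ forall phi, continuous_on_graph T phi ->
        potential_integral T phi Q mu = (I phi)%:E,
      forall phi psi, continuous_on_graph T phi -> continuous_on_graph T psi ->
        I (fun z => phi z + psi z)%R = (I phi + I psi)%R,
      forall c phi, continuous_on_graph T phi ->
        I (fun z => c * phi z)%R = (c * I phi)%R &
      forall c phi, continuous_on_graph T phi -> (forall z, G z -> phi z <= c)%R ->
        (I phi <= c)%R].
Proof.
move=> QT; have [nu [nuG _ nuE]] := potential_integral_joint cptX corrT mu QT.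
have iphi phi : continuous_on_graph T phi -> nu.-integrable G (fun z => (phi z)%:E).
  move=> cphi; apply: measurable_bounded_integrable => //.
  - by rewrite nuG ltry.
  - exact: mphi.
  have [C CP] := bounded_on_graph cptX corrT cphi.
  exists C; split; first exact: num_real.
  by move=> D CD z Gz /=; rewrite (le_trans (CP z Gz))// ltW.
have fphi phi : continuous_on_graph T phi -> \int[nu]_(z in G) (phi z)%:E \is a fin_num.
  by move=> /iphi; exact: integrable_fin_num.
exists (fun phi => fine (\int[nu]_(z in G) (phi z)%:E)); split.
- by move=> phi cphi; rewrite nuE// fineK// fphi.
- move=> phi psi cphi cpsi; rewrite -fineD ?fphi// -integralD//; exact: iphi.
- move=> c phi cphi; under eq_integral do rewrite EFinM.
  by rewrite integralZl// ?fineM ?fphi//; exact: iphi.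
- move=> c phi cphi phic; rewrite -lee_fin fineK ?fphi//.
  have -> : c%:E = \int[nu]_(z in G) c%:E by rewrite integral_cst//= nuG mule1.
  apply: le_integral => //; first exact: iphi.
  + by have := finite_measure_integrable_cst nu c mG.
  + by move=> z /set_mem Gz; rewrite lee_fin phic.
Qed.

End potential_mean.

Section square.
Context (R : realType) (X : pmetricType R).

(** The representation theorem asks for one space that is pointed and
    pseudometric, which the product is in two separate ways. *)
Definition square : Type := (X * X)%type.

HB.instance Definition _ := PseudoMetric.on square.
HB.instance Definition _ := Pointed.on square.

End square.

Section kernel_of_average.
Context (R : realType) (X : pmetricType R) (T : X -> set X).
Hypotheses (cptX : compact [set: X]) (corrT : correspondence T).
Local Notation G := (corr_graph T).
Local Notation BB := (borel X * borel X)%type.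

(** By upper semicontinuity the points whose image misses a closed set form an
    open set, as the selection theorem requires. *)
Lemma borel_selection : exists s : X -> X,
  measurable_fun [set: borel X] (s : borel X -> borel X) /\ forall x, T x (s x).
Proof.
have hX : hausdorff_space X by exact: metric_hausdorff.
have [pi cpi] := cantor_surj cptX hX.
have spi x : exists a, pi a = x.
  by have [a _ <-] := @surj _ _ _ _ pi x I; exists a.
have [T0 clT uscT] := corrT.
have [|s [ms sT]] := @measurable_selection _ (borel X) X pi T hX cpi spi T0 clT.
  move=> F cF; rewrite -[X in measurable X]setCK; apply: measurableC.
  apply: borel_open; rewrite openE => x /= nTF.
  have [|y Ty Fy|V [oV Vx VT]] := uscT x (~` F); first exact: closed_openC.
    by apply: nTF; exists y.
  apply: filterS (open_nbhs_nbhs (conj oV Vx)) => x' Vx' [y [Ty Fy]].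
  exact: (VT x' Vx' y).
exists (pi \o s); split => //.
exact: (measurableT_comp (continuous_measurable_cantor cpi) ms).
Qed.

(** A kernel that is supported by [T] at almost every point is modified on a null
    set, where it becomes the Dirac kernel of a Borel selection of [T]. *)
Lemma supported_version (mu : probability (borel X) R)
    (Q' : R.-pker (borel X) ~> (borel X)) :
  \int[mu]_x Q' x (T x) = 1 ->
  exists Q : R.-pker (borel X) ~> (borel X), supported_by T Q /\
    forall f : BB -> \bar R, (forall z, 0 <= f z) -> measurable_fun setT f ->
    \int[mu]_x \int[Q x]_y f (x, y) = \int[mu]_x \int[Q' x]_y f (x, y).
Proof.
move=> Q'T.
have mG : measurable (G : set BB) by exact: measurable_corr_graph.
have mT x : measurable (T x : set (borel X)).
  rewrite -(_ : xsection G x = T x); last by rewrite xsectionE.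
  exact: (@measurable_xsection _ _ (borel X) (borel X) (G : set BB) x mG).
have [s [ms sT]] := borel_selection.
pose u (x : borel X) := Q' x (T x).
have mu_ : measurable_fun setT u.
  rewrite (_ : u = fun x => Q' x (xsection G x)).
    by apply: measurable_fun_xsection_finite_kernel; rewrite inE.
  by apply/funext => x; rewrite xsectionE.
have mb : measurable_fun setT (fun x => u x == 1).
  by apply: measurable_fun_eqe => //.
pose P x : probability (borel X) R := if u x == 1 then
  projT1 (cid (probability_of_measure (@prob_kernel _ _ _ _ _ Q' x)))
  else \d_(s x : borel X).
have PE x (A : set (borel X)) : P x A = if u x == 1 then Q' x A else (\1_A (s x))%:E.
  rewrite /P; case: ifP => // _.
  by case: cid => ? /= ->.
have [|Q QE] := @pkernel_of_probabilities _ _ _ _ _ P.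
  move=> U mU; rewrite (_ : P ^~ U = fun x => if u x == 1 then Q' x U else (\1_U (s x))%:E).
    apply: measurable_fun_ifT => //; first exact: measurable_kernel.
    have mi : measurable_fun setT (\1_U : borel X -> R) by exact: measurable_indic.
    by apply/measurable_EFinP; exact: (measurableT_comp mi ms).
  by apply/funext => x; rewrite PE.
exists Q; split.
  move=> x; rewrite QE PE; case: eqP => // _; rewrite indicE mem_set//; exact: sT.
move=> f f0 mf; apply: ge0_ae_eq_integral => //.
- exact: measurable_fun_integral_finite_kernel.
- exact: measurable_fun_integral_finite_kernel.
- by move=> x _; apply: integral_ge0.
- by move=> x _; apply: integral_ge0.
have u0 x : 0 <= u x by exact: measure_ge0.
have u1 x : u x <= 1.
  have <- : Q' x setT = 1 by exact: prob_kernel.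
  by apply: le_measure; rewrite ?inE; [exact: mT|exact: measurableT|].
have ufin x : u x \is a fin_num by rewrite ge0_fin_numE// (le_lt_trans (u1 x))// ltry.
have v0 x : 0 <= 1 - u x by rewrite sube_ge0 ?u1// ufin.
have mv : measurable_fun setT (fun x => 1 - u x) by exact: emeasurable_funB.
have : ae_eq mu setT (fun x => 1 - u x) (cst 0).
  apply/ae_eq_integral_abs => //.
  under eq_integral do rewrite gee0_abs//.
  rewrite -[LHS](@addeK _ 1)//.
  have -> : \int[mu]_x (1 - u x) + 1 = \int[mu]_x (1 - u x) + \int[mu]_x u x by rewrite Q'T.
  rewrite -ge0_integralD//.
  under eq_integral do rewrite subeK//.
  by rewrite integral_cst//= probability_setT mule1 subee.
apply: filterS => x /(_ I)/= ux0 _.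
apply: eq_measure_integral => A mA _; rewrite QE PE.
suff -> : u x = 1 by rewrite eqxx.
by have := subeK 1 (ufin x); rewrite ux0 add0e.
Qed.

(** The functional is integration against a probability measure on the graph;
    its conditional probabilities give the kernel, once they are corrected on
    a null set. *)
Theorem kernel_of_average (L : (X * X -> R) -> R) : graph_average G L ->
  exists (Q : R.-pker (borel X) ~> (borel X)) (mu : probability (borel X) R),
    supported_by T Q /\
    forall phi, continuous_on_graph T phi ->
      potential_integral T phi Q mu = (L phi)%:E.
Proof.
move=> LG; have clG := closed_corr_graph corrT.
have mG : measurable (G : set BB) by exact: measurable_corr_graph.
have [pi [cpi [P [PG PL]]]] := @graph_average_representation R (square X)
  (compact_square cptX) (@hausdorff_square R X) G L clG LG.
have mpi : measurable_fun [set: cantor_meas]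
    (fun a => ((pi a).1, (pi a).2) : BB).
  apply: measurable_fun_pair.
    apply: (@continuous_measurable_cantor X (fun a => (pi a).1)) => a.
    exact: (cvg_comp _ _ (cpi a) cvg_fst).
  apply: (@continuous_measurable_cantor X (fun a => (pi a).2)) => a.
  exact: (cvg_comp _ _ (cpi a) cvg_snd).
have [nu [nuE nuI]] := image_probability_exists P mpi.
have [mu [Q' Q'I]] := metric_disintegration cptX nu.
have nuG : nu G = 1.
  by rewrite nuE -PG; congr (P _); apply/seteqP; split => a /=; case: (pi a).
have [|Q [QT QQ']] := @supported_version mu Q'.
  transitivity (\int[mu]_x \int[Q' x]_y (\1_G (x, y) : R)%:E).
    apply: eq_integral => x _.
    have mTx : measurable (T x : set (borel X)).
      rewrite -(_ : xsection G x = T x); last by rewrite xsectionE.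
      exact: (@measurable_xsection _ _ (borel X) (borel X) (G : set BB) x mG).
    transitivity (\int[Q' x]_y (\1_(T x : set (borel X)) y : R)%:E).
      by rewrite integral_indic// setIT.
    apply: eq_integral => y _; rewrite !indicE.
    by congr (nat_of_bool _)%:R%:E; apply/idP/idP; rewrite !inE.
  rewrite -(Q'I (fun z => (\1_(G : set BB) z : R)%:E)).
  - by rewrite integral_indic// setIT.
  - by move=> z; rewrite lee_fin.
  - by apply/measurable_EFinP; exact: measurable_indic.
exists Q, mu; split => //.
have ge0E psi : continuous_on_graph T psi -> (forall z, G z -> (0 <= psi z)%R) ->
    potential_integral T psi Q mu = (L psi)%:E.
  move=> cpsi psi0.
  have [nu2 [nu2G nu2I ->//]] := potential_integral_joint cptX corrT mu QT.
  pose f : BB -> \bar R := (fun z => (psi z)%:E) \_ G.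
  have f0 z : 0 <= f z.
    by rewrite /f patchE; case: ifPn => // /set_mem Gz; rewrite lee_fin psi0.
  have mf : measurable_fun setT f.
    by apply/(measurable_restrictT _ mG)/measurable_EFinP; exact: measurable_on_graph.
  rewrite integral_mkcond nu2I// QQ'// -Q'I// nuI// -PL//.
  rewrite [RHS]integral_mkcond; apply: eq_integral => a _.
  rewrite patchE /f patchE -surjective_pairing.
  by congr (if _ then _ else _); apply/idP/idP; rewrite !inE.
move=> phi cphi.
have [C CP] := bounded_on_graph cptX corrT cphi.
have [I [IE ID _ _]] := potential_mean_exists cptX corrT mu QT.
have cC : continuous_on_graph T (fun=> C) by exact: continuous_on_graph_cst.
have cphiC := continuous_on_graphD cphi cC.
have C0 z : G z -> (0 <= phi z + C)%R.
  by move=> /CP; rewrite ler_norml => /andP[h _]; lra.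
have := ge0E _ cphiC C0.
rewrite IE// ID// IE// => -[].
have [LD _ _] := LG.
rewrite LD//; last 2 first.
- by exists C.
- exact: bounded_on_cst.
rewrite (graph_average_cst LG) => H; congr EFin.
have IC : I (fun=> C) = C.
  have C0' : (0 <= C)%R.
    have [T0 _ _] := corrT; have [y Ty] := T0 point.
    by rewrite (le_trans _ (CP (point, y) Ty)).
  by have := ge0E _ cC (fun _ _ => C0'); rewrite IE// => -[->]; rewrite (graph_average_cst LG).
by move: H; rewrite IC => /addIr.
Qed.

End kernel_of_average.

(** * Pressure as a growth rate *)

Section limsup.
Context (R : realType).
Implicit Types (u : (\bar R)^nat) (r : \bar R).

Lemma limn_esup_lt u r : limn_esup u < r -> \forall n \near \oo, u n < r.
Proof.
move=> /ereal_inf_lt[_ [A nA <-] Ar]; apply: filterS nA => n An.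
by apply: le_lt_trans Ar; apply: ereal_sup_ubound; exists n.
Qed.

Lemma limn_esup_le u r : (\forall n \near \oo, u n <= r) -> limn_esup u <= r.
Proof.
move=> ur; apply: (@le_trans _ _ (ereal_sup (u @` [set n | u n <= r]))).
  by apply: ereal_inf_lbound; exists [set n | u n <= r].
by apply: ge_ereal_sup => _ [n /= + <-].
Qed.

End limsup.

Section pressure.
Context (R : realType) (X : pmetricType R) (T : X -> set X).
Implicit Types (phi psi : X * X -> R) (eps r : R).

Definition separated_orbits eps n (s : seq (n.+1.-tuple X)) :=
  [/\ uniq s, forall x, x \in s -> orbits T x &
      forall x y, x \in s -> y \in s -> x <> y -> (eps <= tdist x y)%R].

Definition gibbs_sum phi n (s : seq (n.+1.-tuple X)) : R :=
  (\sum_(x <- s) expR (birkhoff_sum phi x))%R.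

(** A sum over an arbitrary family is the supremum of its finite subsums, and
    subfamilies of separated families are separated. *)
Lemma separated_sum_leP phi eps n (t : R) :
  separated_sum T phi eps n <= t%:E <->
  forall s, separated_orbits eps (n := n) s -> (gibbs_sum phi s <= t)%R.
Proof.
split=> [H s [us so ss]|H].
  rewrite -lee_fin; apply: le_trans H.
  apply: (@le_trans _ _ (\esum_(x in [set` s]) (expR (birkhoff_sum phi x))%:E)).
    apply: esum_ge; exists [set` s].
      by split => //; exact: finite_seq.
    rewrite -fsbig_seq// sumEFin//.
  by apply: ereal_sup_ubound; exists [set` s].
apply: ge_ereal_sup => _ [E [Eo Es] <-].
apply: ge_ereal_sup => _ [A [fA AE] <-].
rewrite fsbig_finite//= sumEFin lee_fin; apply: H; split.
- exact: finmap.fset_uniq.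
- by move=> x; rewrite in_fset_set// inE => /AE/Eo.
- move=> x y; rewrite !in_fset_set// !inE => /AE Ex /AE Ey; exact: Es.
Qed.

Lemma rate_leP phi eps n r : (0 < n)%N ->
  (n%:R^-1)%:E * lne (separated_sum T phi eps n) <= r%:E <->
  forall s, separated_orbits eps (n := n) s -> (gibbs_sum phi s <= expR (n%:R * r))%R.
Proof.
move=> n0; rewrite -separated_sum_leP.
have n0' : (0 < n%:R :> R)%R by rewrite ltr0n.
have -> : ((n%:R^-1)%:E * lne (separated_sum T phi eps n) <= r%:E) =
    (lne (separated_sum T phi eps n) <= (n%:R * r)%:E).
  by rewrite muleC lee_pdivrMr// muleC EFinM.
case: (separated_sum T phi eps n) => [t| |] /=; last 2 first.
- by split; rewrite leye_eq.
- by rewrite !leNye.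
case: ifPn => [t0|]; rewrite ?leNye.
  by split=> // _; rewrite lee_fin (le_trans t0)// expR_ge0.
rewrite -ltNge => t0; rewrite !lee_fin -[X in _ <-> (X <= _)%R](lnK t0).
by rewrite ler_expR.
Qed.

Definition growth_rate_le phi eps r := exists N, forall n, (N <= n)%N ->
  forall s, separated_orbits eps (n := n) s -> (gibbs_sum phi s <= expR (n%:R * r))%R.

Let rate phi eps := limn_esup
  (fun n => (n%:R^-1)%:E * lne (separated_sum T phi eps n)).

(** The rates increase as the scale decreases, so that their limit is a
    supremum. *)
Lemma pressureE phi : pressure T phi = ereal_sup [set rate phi eps | eps in `]0%R, +oo[%classic].
Proof.
apply/cvg_lim => //; apply: (@nonincreasing_at_right_cvge _ _ _ +oo%O) => //.
move=> e e'; rewrite !in_itv/= !andbT => e0 e'0 ee'.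
apply: le_ereal_inf_tmp => _ [A nA <-].
apply: (@le_trans _ _ (ereal_sup ((fun n => (n%:R^-1)%:E *
    lne (separated_sum T phi e' n)) @` A))).
  by apply: ereal_inf_lbound; exists A.
apply: ge_ereal_sup => _ [n An <-].
apply: (@le_trans _ _ ((n%:R^-1)%:E * lne (separated_sum T phi e n))); last first.
  by apply: ereal_sup_ubound; exists n.
apply: lee_wpmul2l; first by rewrite lee_fin invr_ge0.
have ssle : separated_sum T phi e' n <= separated_sum T phi e n.
  apply: ge_ereal_sup => _ [E [Eo Es] <-]; apply: ereal_sup_ubound; exists E => //.
  by split => // x y Ex Ey xy; rewrite (le_trans ee')//; exact: Es.
have s0 eta : 0 <= separated_sum T phi eta n.
  apply: ereal_sup_ubound; exists set0; first by split.
  by rewrite esum_set0.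
by rewrite lee_lne// in_itv/= s0 leey.
Qed.

Lemma pressure_le phi r : (forall eps, (0 < eps)%R -> growth_rate_le phi eps r) ->
  pressure T phi <= r%:E.
Proof.
move=> H; rewrite pressureE; apply: ge_ereal_sup => _ [eps + <-].
rewrite /= in_itv/= andbT => eps0; have [N HN] := H _ eps0.
apply: limn_esup_le; exists N.+1 => // n /= Nn.
apply/rate_leP; first exact: leq_trans Nn.
by apply: HN; exact: ltnW.
Qed.

Lemma growth_rate_of_pressure phi r : pressure T phi < r%:E ->
  forall eps, (0 < eps)%R -> growth_rate_le phi eps r.
Proof.
move=> Pr eps eps0.
have /limn_esup_lt[N _ HN] : rate phi eps < r%:E.
  apply: le_lt_trans Pr; rewrite pressureE; apply: ereal_sup_ubound.
  by exists eps => //=; rewrite in_itv/= eps0.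
exists N.+1 => n Nn; apply/rate_leP; first exact: leq_trans Nn.
by apply/ltW/HN; exact: ltnW.
Qed.

End pressure.

(** * Comparison of pressures *)

Section pressure_comparison.
Context (R : realType) (X : pmetricType R) (T : X -> set X).
Implicit Types (phi psi : X * X -> R) (eps r : R).

Lemma birkhoff_sum_le phi n (x : n.+1.-tuple X) (c : R) : orbits T x ->
  (forall z, corr_graph T z -> phi z <= c)%R -> (birkhoff_sum phi x <= n%:R * c)%R.
Proof.
move=> ox phic; rewrite /birkhoff_sum (le_trans (ler_sum _ (fun i _ => phic _ (ox i))))//.
by rewrite sumr_const card_ord mulr_natl.
Qed.

Lemma birkhoff_sum_ge phi n (x : n.+1.-tuple X) (c : R) : orbits T x ->
  (forall z, corr_graph T z -> c <= phi z)%R -> (n%:R * c <= birkhoff_sum phi x)%R.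
Proof.
move=> ox phic; rewrite /birkhoff_sum (le_trans _ (ler_sum _ (fun i _ => phic _ (ox i))))//.
by rewrite sumr_const card_ord mulr_natl.
Qed.

Lemma orbit_exists : correspondence T -> forall n,
  exists x : n.+1.-tuple X, orbits T x.
Proof.
move=> [T0 _ _] n; have /choice[s sT] := T0.
exists [tuple iter i s point | i < n.+1] => i.
by rewrite /step /= !tnth_mktuple /= /bump.
Qed.

Lemma growth_rate_shift phi psi (c C : R) eps r delta :
  (forall n (x : n.+1.-tuple X), orbits T x ->
    (birkhoff_sum psi x <= birkhoff_sum phi x + n%:R * c + C)%R) ->
  (0 < delta)%R -> growth_rate_le T phi eps r ->
  growth_rate_le T psi eps (r + c + delta)%R.
Proof.
move=> H d0 [N HN].
exists (maxn N (Num.truncn (`|C| / delta)).+1) => n; rewrite geq_max => /andP[Nn Cn] s ss.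
have Cnd : (C <= n%:R * delta)%R.
  rewrite (le_trans (ler_norm C))// -ler_pdivrMr// ltW//.
  by rewrite (lt_le_trans (truncnS_gt _))// ler_nat.
apply: (@le_trans _ _ (gibbs_sum phi s * expR (n%:R * c + C))%R).
  rewrite /gibbs_sum mulr_suml !big_seq; apply: ler_sum => x xs.
  by rewrite -expRD ler_expR addrA; apply: H; have [_ + _] := ss; apply.
rewrite (le_trans (ler_wpM2r (expR_ge0 _) (HN n Nn s ss)))//.
by rewrite -expRD ler_expR !mulrDr addrA !lerD2l.
Qed.

Lemma pressure_gtNy phi : correspondence T -> bounded_on (corr_graph T) phi ->
  -oo < pressure T phi.
Proof.
move=> corrT [C CP]; rewrite ltNye; apply/eqP => P0.
have /growth_rate_of_pressure/(_ 1%R ltr01)[N HN] : pressure T phi < (- C - 1)%:E.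
  by rewrite P0 ltNyr.
have [x ox] := orbit_exists corrT N.+1.
have := HN N.+1 (leqnSn N) [:: x].
rewrite /gibbs_sum big_seq1 ler_expR leNgt => H.
suff : (N.+1%:R * (- C - 1) < birkhoff_sum phi x)%R.
  apply/negP; apply: H; split => // [y|y z]; first by rewrite inE => /eqP->.
  by rewrite !inE => /eqP-> /eqP->.
apply: (@lt_le_trans _ _ (N.+1%:R * - C)%R).
  by rewrite ltr_pM2l ?ltr0n// gtrBl.
apply: birkhoff_sum_ge => // z /CP; rewrite ler_norml => /andP[h _]; lra.
Qed.

(** A bounded error in the Birkhoff sums is not visible in the growth rate. *)
Lemma pressure_shift phi psi (c C : R) :
  correspondence T -> bounded_on (corr_graph T) phi ->
  (forall n (x : n.+1.-tuple X), orbits T x ->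
    (birkhoff_sum psi x <= birkhoff_sum phi x + n%:R * c + C)%R) ->
  pressure T psi <= pressure T phi + c%:E.
Proof.
move=> corrT bphi H; have := pressure_gtNy corrT bphi.
case E : (pressure T phi) => [p| |]// _; last by rewrite leey.
apply/lee_addgt0Pr => e e0; rewrite -!EFinD.
apply: pressure_le => eps eps0.
rewrite (_ : p + c + e = (p + e / 2) + c + e / 2)%R; last first.
  by rewrite [in LHS](splitr e); ring.
apply: growth_rate_shift H _ _; first by rewrite divr_gt0.
by apply: growth_rate_of_pressure => //; rewrite E lte_fin ltrDl divr_gt0.
Qed.

Lemma pressure_addr phi (c : R) :
  correspondence T -> bounded_on (corr_graph T) phi ->
  pressure T (fun z => phi z + c)%R = pressure T phi + c%:E.
Proof.
move=> corrT bphi.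
have Sc n (x : n.+1.-tuple X) :
    birkhoff_sum (fun z => phi z + c)%R x = (birkhoff_sum phi x + n%:R * c)%R.
  by rewrite /birkhoff_sum big_split/= sumr_const card_ord mulr_natl.
apply/eqP; rewrite eq_le; apply/andP; split.
  by apply: (@pressure_shift _ _ _ 0%R) => // n x _; rewrite Sc addr0.
rewrite -leeBrDr//; apply: (@pressure_shift _ _ (- c)%R 0%R) => //.
  exact: bounded_onD bphi (bounded_on_cst _ _).
by move=> n x _; rewrite Sc addr0 mulrN addrK.
Qed.

Lemma birkhoff_sumB (f : X -> R) n (x : n.+1.-tuple X) :
  birkhoff_sum (fun z => f z.1 - f z.2)%R x =
  (f (tnth x ord0) - f (tnth x ord_max))%R.
Proof.
pose g i := f (nth point x i).
have -> : birkhoff_sum (fun z => f z.1 - f z.2)%R x = (\sum_(i < n) (g i - g i.+1))%R.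
  apply: eq_bigr => i _; rewrite /step /= /g !(tnth_nth point) /=.
  by rewrite /bump leq0n add1n.
rewrite -(big_mkord xpredT (fun i => g i - g i.+1)%R).
have -> : (\sum_(0 <= i < n) (g i - g i.+1) = - \sum_(0 <= i < n) (g i.+1 - g i))%R.
  by rewrite -sumrN; apply: eq_bigr => i _; rewrite opprB.
by rewrite telescope_sumr// opprB /g !(tnth_nth point).
Qed.

(** The Birkhoff sums of a coboundary telescope. *)
Lemma pressure_coboundary phi (f : X -> R) (C : R) :
  correspondence T -> bounded_on (corr_graph T) phi -> (forall x, `|f x| <= C)%R ->
  pressure T (fun z => phi z + (f z.1 - f z.2))%R = pressure T phi.
Proof.
move=> corrT bphi fC.
have fC2 x y : (`|f x - f y| <= C + C)%R.
  by rewrite (le_trans (ler_normB _ _))// lerD.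
have Sf n (x : n.+1.-tuple X) : birkhoff_sum (fun z => phi z + (f z.1 - f z.2))%R x =
    (birkhoff_sum phi x + (f (tnth x ord0) - f (tnth x ord_max)))%R.
  by rewrite -birkhoff_sumB /birkhoff_sum big_split.
have bf : bounded_on (corr_graph T) (fun z => f z.1 - f z.2)%R.
  by exists (C + C)%R => z _.
apply/eqP; rewrite eq_le; apply/andP; split; rewrite -[leRHS]adde0.
  apply: (@pressure_shift _ _ 0%R (C + C)%R) => // n x _.
  by rewrite Sf mulr0 addr0 lerD2l (le_trans (ler_norm _)).
apply: (@pressure_shift _ _ 0%R (C + C)%R) => //.
  exact: (bounded_onD bphi bf).
move=> n x _; rewrite Sf mulr0 addr0 -addrA lerDl.
by have := fC2 (tnth x ord0) (tnth x ord_max); rewrite ler_norml => /andP[h _]; lra.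
Qed.

Lemma pressure_lty phi psi : correspondence T ->
  bounded_on (corr_graph T) phi -> bounded_on (corr_graph T) psi ->
  pressure T phi < +oo -> pressure T psi < +oo.
Proof.
move=> corrT bphi [D DP] Pphi; have [C CP] := bphi.
apply: (@le_lt_trans _ _ (pressure T phi + (C + D)%:E)); last by rewrite lte_add_pinfty// ltry.
apply: (@pressure_shift _ _ _ 0%R) => // n x ox; rewrite addr0.
have h1 : (birkhoff_sum psi x <= n%:R * D)%R.
  by apply: birkhoff_sum_le => // z /DP; rewrite ler_norml => /andP[].
have h2 : (n%:R * - C <= birkhoff_sum phi x)%R.
  by apply: birkhoff_sum_ge => // z /CP; rewrite ler_norml => /andP[].
lra.
Qed.

End pressure_comparison.

(** * Averages along orbits *)

Section orbit_averages.
Context (R : realType) (X : pmetricType R) (T : X -> set X).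
Implicit Types (phi psi : X * X -> R).

Lemma birkhoff_sumD phi psi n (x : n.+1.-tuple X) :
  birkhoff_sum (fun z => phi z + psi z)%R x = (birkhoff_sum phi x + birkhoff_sum psi x)%R.
Proof. by rewrite /birkhoff_sum big_split. Qed.

Lemma birkhoff_sumZ (c : R) phi n (x : n.+1.-tuple X) :
  birkhoff_sum (fun z => c * phi z)%R x = (c * birkhoff_sum phi x)%R.
Proof. by rewrite /birkhoff_sum mulr_sumr. Qed.

Definition orbit_average n (s : seq (n.+1.-tuple X)) (w : n.+1.-tuple X -> R)
    (f : X * X -> R) : R :=
  (n%:R^-1 * \sum_(x <- s) w x * birkhoff_sum f x)%R.

Lemma orbit_average_graph n (s : seq (n.+1.-tuple X)) (w : n.+1.-tuple X -> R) :
  (0 < n)%N -> (forall x, x \in s -> orbits T x) -> (forall x, 0 <= w x)%R ->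
  (\sum_(x <- s) w x = 1)%R -> graph_average (corr_graph T) (orbit_average s w).
Proof.
move=> n0 so w0 w1; have n0' : (0 < n%:R :> R)%R by rewrite ltr0n.
split=> [f g _ _|c f _|c f _ fc]; rewrite /orbit_average.
- rewrite -mulrDr -big_split; congr (_ * _)%R.
  by apply: eq_bigr => x _; rewrite birkhoff_sumD mulrDr.
- rewrite mulrCA; congr (_ * _)%R; rewrite mulr_sumr; apply: eq_bigr => x _.
  by rewrite birkhoff_sumZ mulrCA.
- rewrite mulrC ler_pdivrMr// mulrC.
  have -> : (n%:R * c = \sum_(x <- s) w x * (n%:R * c))%R by rewrite -mulr_suml w1 mul1r.
  rewrite !big_seq.
  apply: ler_sum => x xs; rewrite ler_wpM2l//.
  exact: (birkhoff_sum_le (so x xs)).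
Qed.

(** The Gibbs average of a family of orbits is a subgradient of the logarithm of
    its Gibbs sum; this is Jensen's inequality for the exponential. *)
Lemma gibbs_average phi n (s : seq (n.+1.-tuple X)) :
  (0 < n)%N -> (forall x, x \in s -> orbits T x) -> (0 < gibbs_sum phi s)%R ->
  exists L, graph_average (corr_graph T) L /\ forall psi,
    (gibbs_sum phi s * expR (n%:R * L psi) <=
     gibbs_sum (fun z => phi z + psi z) s)%R.
Proof.
move=> n0 so Z0.
pose w (x : n.+1.-tuple X) := (expR (birkhoff_sum phi x) / gibbs_sum phi s)%R.
have w1 : (\sum_(x <- s) w x = 1)%R by rewrite -mulr_suml divff// gt_eqF.
exists (orbit_average s w); split.
  by apply: orbit_average_graph => // x; rewrite divr_ge0 ?expR_ge0// ltW.
move=> psi; set a := (n%:R * _)%R.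
have aE : (gibbs_sum phi s * a =
    \sum_(x <- s) expR (birkhoff_sum phi x) * birkhoff_sum psi x)%R.
  rewrite /a /orbit_average mulVKf ?pnatr_eq0 -?lt0n// mulr_sumr.
  apply: eq_bigr => x _; rewrite mulrA; congr (_ * _)%R.
  by rewrite /w mulrC divfK// gt_eqF.
have -> : (gibbs_sum phi s * expR a = \sum_(x <- s) expR a *
    (expR (birkhoff_sum phi x) * (1 + (birkhoff_sum psi x - a))))%R.
  rewrite -mulr_sumr mulrC; congr (_ * _)%R.
  under eq_bigr do rewrite mulrDr mulr1 mulrBr.
  by rewrite big_split/= sumrB -aE -mulr_suml subrr addr0.
apply: ler_sum => x _; rewrite mulrCA birkhoff_sumD expRD ler_wpM2l ?expR_ge0//.
rewrite -[in leRHS](subrKC a (birkhoff_sum psi x)) expRD.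
by rewrite ler_wpM2l ?expR_ge0// expR_ge1Dx.
Qed.

End orbit_averages.

(** Compact intervals make ultrafilters converge. *)
Lemma ultra_bounded_cvg (R : realType) (I : Type) (U : set_system I) (g : I -> R) (C : R) :
  UltraFilter U -> U [set i | (`|g i| <= C)%R] -> cvg (g i @[i --> U]).
Proof.
move=> UU UC.
have UgC : (g @ U) `[(- C)%R, C]%classic.
  change (U (g @^-1` `[(- C)%R, C]%classic)); apply: filterS UC => i gi.
  by rewrite /= in_itv/= -ler_norml.
have [p [_ clp]] := @segment_compact R (- C)%R C (g @ U) (fmap_proper_filter g _) UgC.
apply/cvg_ex; exists p => B nB.
have [//|UnB] := in_ultra_setVsetC (g @^-1` B) UU.
have : (g @ U) (~` B) by [].
by move=> /clp/(_ nB)[y []].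
Qed.

(** Averages form a compact set for pointwise convergence, so that infinitely
    many upper bounds can be met at once as soon as any finite number of them
    can be met up to an arbitrarily small error. *)
Lemma graph_average_compactness (R : realType) (W : Type) (G : set W)
    (D : set ((W -> R) * R)) :
  (forall p, D p -> bounded_on G p.1) ->
  (forall (s : seq ((W -> R) * R)) (delta : R), (0 < delta)%R ->
    (forall p, p \in s -> D p) -> exists L, graph_average G L /\
      forall p, p \in s -> (L p.1 <= p.2 + delta)%R) ->
  exists L, graph_average G L /\ forall p, D p -> (L p.1 <= p.2)%R.
Proof.
move=> bD HD.
pose B (s : seq ((W -> R) * R)) (delta : R) := [set L | graph_average G L /\
  forall p, p \in s -> (L p.1 <= p.2 + delta)%R].
pose F := filter_from [set sd : seq ((W -> R) * R) * R | (0 < sd.2)%R /\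
  forall p, p \in sd.1 -> D p] (fun sd => B sd.1 sd.2).
have FF : ProperFilter F.
  apply: filter_from_proper; last first.
    by move=> [s e] [/= e0 sD]; have [L [LG LB]] := HD s e e0 sD; exists L.
  apply: filter_from_filter; first by exists ([::], 1%R).
  move=> [s e] [s' e'] [/= e0 sD] [/= e'0 s'D].
  exists (s ++ s', Num.min e e').
    split=> [|p]/=; first by rewrite lt_min e0.
    by rewrite mem_cat => /orP[/sD|/s'D].
  move=> L [/= LG H]; split; split => // p ps.
    by rewrite (le_trans (H p _)) ?mem_cat ?ps// lerD2l ge_min lexx.
  by rewrite (le_trans (H p _)) ?mem_cat ?ps ?orbT// lerD2l ge_min lexx orbT.
have [U [UU FU]] := ultraFilterLemma FF.
have UG : U (graph_average G).
  by apply: FU; exists ([::], 1%R) => // L [].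
pose L f := lim ((l : (W -> R) -> R) f @[l --> U]).
have cvgL f : bounded_on G f -> (l : (W -> R) -> R) f @[l --> U] --> L f.
  move=> bf; have [C CP] := bf.
  apply: (@ultra_bounded_cvg _ _ _ _ C); apply: filterS UG => l lG /=.
  have [_ _ lle] := lG; rewrite ler_norml; apply/andP; split.
    by apply: (graph_average_ge lG) => // z /CP; rewrite ler_norml => /andP[].
  by apply: lle => // z /CP; rewrite ler_norml => /andP[].
exists L; split.
  split=> [f g bf bg|c f bf|c f bf fc].
  - apply/cvg_lim => //.
    apply: cvg_trans (cvgD (cvgL f bf) (cvgL g bg)).
    by apply: near_eq_cvg; apply: filterS UG => l [lD _ _]; rewrite lD.
  - apply/cvg_lim => //.
    apply: cvg_trans (cvgM (cvg_cst c) (cvgL f bf)).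
    by apply: near_eq_cvg; apply: filterS UG => l [_ lZ _]; rewrite lZ.
  - apply: (cvgr_to_le (cvgL f bf)); apply: filterS UG => l [_ _ lle].
    exact: lle.
move=> p Dp; apply/ler_addgt0Pr => e e0.
apply: (cvgr_to_le (cvgL _ (bD p Dp))).
apply: FU; exists ([:: p], e).
  by split=> // q; rewrite inE => /eqP ->.
by move=> l [_ /(_ p)]; apply; rewrite inE.
Qed.

(** * Invariance *)

Section distance.
Context (R : realType) (X : pmetricType R).
Implicit Types (A : set X) (x y : X).

Definition dist_to A x : R := inf [set mdist x a | a in A].

Let lb0 A x : lbound [set mdist x a | a in A] 0%R.
Proof. by move=> _ [a _ <-]; exact: mdist_ge0. Qed.

Let inf_le A x a : A a -> (dist_to A x <= mdist x a)%R.
Proof. by move=> Aa; apply: ge_inf; [exists 0%R; exact: (@lb0 A x)|exists a]. Qed.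

Lemma dist_to_ge0 A x : (0 <= dist_to A x)%R.
Proof.
have [[a Aa]|A0] := pselect (A !=set0).
  by apply: lb_le_inf; [exists (mdist x a); exists a|exact: lb0].
rewrite /dist_to (_ : [set _ | _ in A] = set0) ?inf0//.
by apply/seteqP; split => // t [a Aa _]; exfalso; apply: A0; exists a.
Qed.

Lemma dist_to_triangle A x y : (dist_to A x <= mdist x y + dist_to A y)%R.
Proof.
have [[a Aa]|A0] := pselect (A !=set0); last first.
  have d0 z : dist_to A z = 0%R.
    rewrite /dist_to (_ : [set _ | _ in A] = set0) ?inf0//.
    by apply/seteqP; split => // t [a Aa _]; exfalso; apply: A0; exists a.
  by rewrite !d0 addr0 mdist_ge0.
rewrite -lerBlDl; apply: lb_le_inf; first by exists (mdist y a); exists a.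
move=> _ [b Ab <-]; rewrite lerBlDl.
by apply: le_trans (inf_le _ Ab) _; exact: metric_triangle.
Qed.

Lemma continuous_dist_to A : continuous (dist_to A).
Proof.
move=> x; apply/cvgrPdist_lt => e e0.
have : \forall y \near x, (mdist x y < e)%R.
  by have := nbhsx_ballx x _ e0; rewrite ballEmdist.
apply: filterS => y xy; rewrite (le_lt_trans _ xy)// ler_norml.
have h1 := dist_to_triangle A x y; have h2 := dist_to_triangle A y x.
rewrite (metric_sym y x) in h2; apply/andP; split; lra.
Qed.

Lemma dist_to_gt0 A x : A !=set0 -> closed A -> ~ A x -> (0 < dist_to A x)%R.
Proof.
move=> [a Aa] cA nAx.
have [e /= e0 eA] : nbhs_ball x (~` A).
  by apply/nbhs_ballP; apply: open_nbhs_nbhs; split => //; exact: closed_openC.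
apply: lt_le_trans e0 _; apply: lb_le_inf; first by exists (mdist x a); exists a.
move=> _ [b Ab <-]; rewrite leNgt; apply/negP => xb.
by apply: (eA b) => //; rewrite ballEmdist.
Qed.

Lemma dist_to_eq0 A x : A x -> dist_to A x = 0%R.
Proof.
move=> Ax; apply/eqP; rewrite eq_le dist_to_ge0 andbT -(mdistxx x).
exact: inf_le.
Qed.

End distance.

Section unicity.
Context (R : realType) (X : pmetricType R).

Lemma measurable_continuous (f : X -> R) : continuous f ->
  measurable_fun [set: borel X] (f : borel X -> R).
Proof.
move=> /continuousP cf; apply: (measurability (@RGenOInfty.G R)).
  exact: RGenOInfty.measurableE.
move=> _ [_ [r ->] <-]; rewrite setTI; apply: borel_open.
by apply: cf; exact: interval_open.
Qed.

(** The indicator of an open set is the increasing limit of the truncated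
    multiples of the distance to its complement. *)
Lemma borel_probability_unique (m1 m2 : probability (borel X) R) :
  (forall f : X -> R, continuous f -> (forall x, 0 <= f x <= 1)%R ->
     \int[m1]_x (f x)%:E = \int[m2]_x (f x)%:E) ->
  forall A, measurable A -> m1 A = m2 A.
Proof.
move=> m12; apply: (@probability_unique_gen _ (borel X) R (@open X)) => //.
  by move=> A B; exact: openI.
move=> U oU; have [U0|nU0] := pselect ((~` U) !=set0); last first.
  have -> : U = setT.
    by apply/seteqP; split => // x _; apply: contrapT => nUx; apply: nU0; exists x.
  by rewrite (@probability_setT _ _ _ m1) (@probability_setT _ _ _ m2).
have cU : closed (~` U) by exact: open_closedC.
have mU : measurable (U : set (borel X)) by exact: borel_open.
pose f n x := Num.min 1%R (n%:R * dist_to (~` U) x)%R.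
have cf n : continuous (f n).
  move=> x; apply: (@continuous_min _ _ (cst 1%R) (fun x => n%:R * dist_to (~` U) x)%R).
    exact: cvg_cst.
  by apply: cvgM; [exact: cvg_cst|exact: continuous_dist_to].
have f01 n x : (0 <= f n x <= 1)%R.
  by rewrite /f le_min ler01 mulr_ge0 ?dist_to_ge0// ge_min lexx.
have fU (m : probability (borel X) R) : \int[m]_x (f n x)%:E @[n --> \oo] --> m U.
  have -> : m U = \int[m]_x (\1_(U : set (borel X)) x : R)%:E by rewrite integral_indic// setIT.
  have -> : (fun x => (\1_(U : set (borel X)) x : R)%:E) = (fun x => limn (fun n => (f n x)%:E)).
    apply/funext => x; apply/esym/cvg_lim => //.
    rewrite indicE; have [Ux|nUx] := pselect (U x).
      have d0 : (0 < dist_to (~` U) x)%R by apply: dist_to_gt0 => //; exact.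
      rewrite mem_set//; apply: cvg_near_cst; near=> n; congr EFin; rewrite /f min_l//.
      rewrite -ler_pdivrMr// mul1r ltW//.
      by near: n; exact: nbhs_infty_gtr.
    rewrite memNset//; apply: cvg_near_cst; near=> n.
    by rewrite /f dist_to_eq0// mulr0 min_r.
  apply: cvg_monotone_convergence => //.
  - by move=> n; apply/measurable_EFinP; exact: measurable_continuous.
  - by move=> n x _; rewrite lee_fin; have /andP[] := f01 n x.
  - move=> x _ a b ab; rewrite lee_fin /f le_min ge_min lexx/= ge_min.
    by rewrite ler_wpM2r ?dist_to_ge0 ?ler_nat// orbT.
have E : (fun n => \int[m1]_x (f n x)%:E) = (fun n => \int[m2]_x (f n x)%:E).
  by apply/funext => n; exact: (m12 _ (cf n) (f01 n)).
by apply: cvg_unique (fU m1) _ => //; rewrite E; exact: fU.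
Unshelve. all: by end_near. Qed.

End unicity.

Section invariance.
Context (R : realType) (X : pmetricType R) (T : X -> set X).
Hypotheses (cptX : compact [set: X]) (corrT : correspondence T).
Local Notation BB := (borel X * borel X)%type.

Lemma continuous_coboundary (f : X -> R) : continuous f ->
  continuous_on_graph T (fun z => f z.1 - f z.2)%R.
Proof.
move=> cf; apply: continuous_subspaceT => z.
have c1 : {for z, continuous (f \o fst : X * X -> R)}.
  by apply: continuous_comp; [exact: cvg_fst|exact: cf].
have c2 : {for z, continuous (f \o snd : X * X -> R)}.
  by apply: continuous_comp; [exact: cvg_snd|exact: cf].
exact: cvgB c1 c2.
Qed.

Lemma bounded_continuous (f : X -> R) : continuous f ->
  exists C, forall x, (`|f x| <= C)%R.
Proof.
move=> cf; have := continuous_compact (continuous_subspaceT cf) cptX.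
move=> /compact_bounded[M [_ MP]]; exists (M + 1)%R => x.
by apply: (MP (M + 1)%R); [rewrite ltrDl|exists x].
Qed.

(** The mean of the coboundary [f x - f y] is the difference of the means of [f]
    under [mu] and [mu Q], and continuous functions determine a Borel measure. *)
Lemma invariant_of_coboundaries (Q : R.-pker (borel X) ~> (borel X))
    (mu : probability (borel X) R) : supported_by T Q ->
  (forall f : X -> R, continuous f ->
     potential_integral T (fun z => f z.1 - f z.2)%R Q mu = 0) ->
  kernel_invariant Q mu.
Proof.
move=> QT H A mA; have [mu' [mu'A mu'I]] := mixture_exists mu Q.
rewrite -mu'A; apply: borel_probability_unique mA => f cf f01.
have mf := measurable_continuous cf.
have mfE : measurable_fun [set: borel X] (fun x => (f x)%:E) by exact/measurable_EFinP.
have f0 x : 0 <= (f x)%:E by rewrite lee_fin; have /andP[] := f01 x.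
have [nu [nuG nuI nuE]] := potential_integral_joint cptX corrT mu QT.
have mG : measurable (corr_graph T : set BB) by exact: measurable_corr_graph.
have m1 : measurable_fun setT (fun z : BB => (f z.1)%:E).
  exact: (measurableT_comp mfE measurable_fst).
have m2 : measurable_fun setT (fun z : BB => (f z.2)%:E).
  exact: (measurableT_comp mfE measurable_snd).
have int1 (g : BB -> R) : measurable_fun setT (fun z => (g z)%:E) ->
    (forall z, 0 <= g z <= 1)%R -> nu.-integrable (corr_graph T) (fun z => (g z)%:E).
  move=> mg g01; apply: measurable_bounded_integrable => //.
  - by rewrite nuG ltry.
  - by apply: measurable_funTS; exact/measurable_EFinP.
  exists 1%R; split; first exact: num_real.
  move=> D D1 z _ /=; have /andP[g0 g1] := g01 z.
  by rewrite ger0_norm// (le_trans g1)// ltW.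
have full (g : BB -> \bar R) : measurable_fun setT g -> (forall z, 0 <= g z) ->
    \int[nu]_(z in corr_graph T) g z = \int[nu]_z g z.
  move=> mg g0; have G0 : nu (~` (corr_graph T : set BB)) = 0.
    by rewrite probability_setC// nuG subee.
  rewrite [RHS](ge0_negligible_integral _ _ _ _ G0)//; last exact: measurableC.
  by rewrite setTD setCK.
have := H f cf; rewrite nuE; last exact: continuous_coboundary.
under eq_integral do rewrite EFinB.
rewrite integralB//; [|exact: int1|exact: int1].
rewrite !full// nuI// nuI// => H0.
have E1 : \int[mu]_x \int[Q x]_y (f x)%:E = \int[mu]_x (f x)%:E.
  by apply: eq_integral => x _; rewrite integral_cst//= prob_kernel mule1.
rewrite mu'I//; move: H0; rewrite E1 /=.
case: (\int[mu]_x (f x)%:E) => [a| |]; case: (\int[mu]_x _) => [b| |] // [] /eqP.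
by rewrite subr_eq0 => /eqP ->.
Qed.

End invariance.

(** * Pairs that are tangent to the pressure *)

Section equilibrium.
Context (R : realType) (X : pmetricType R) (T : X -> set X).
Hypotheses (cptX : compact [set: X]) (corrT : correspondence T).
Local Notation G := (corr_graph T).

Let coboundary (f : X -> R) (z : X * X) : R := (f z.1 - f z.2)%R.

Let coboundary_pressure phi (f : X -> R) : continuous_on_graph T phi -> continuous f ->
  pressure T (fun z => phi z + coboundary f z)%R = pressure T phi.
Proof.
move=> cphi cf; have [C fC] := bounded_continuous cptX cf.
by apply: pressure_coboundary => //; exact: bounded_on_graph.
Qed.

(** The average along one long orbit nearly annihilates coboundaries. This
    average serves when the pressure is infinite, where any invariant pair will
    do. *)
Lemma invariant_average_exists : exists L, graph_average G L /\
  forall f : X -> R, continuous f -> (L (coboundary f) <= 0)%R.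
Proof.
pose D := [set p : (X * X -> R) * R | p.2 = 0%R /\
  exists f : X -> R, continuous f /\ p.1 = coboundary f].
have [||L [LG LD]] := @graph_average_compactness R _ G D.
- move=> _ [_ [f [cf ->]]]; apply: bounded_on_graph => //.
  exact: continuous_coboundary.
- move=> s delta d0 sD.
  have [N [N0 HN]] : exists N, (0 < N)%N /\ forall p, p \in s ->
      forall n (x : n.+1.-tuple X), (N <= n)%N ->
      (n%:R^-1 * birkhoff_sum p.1 x <= delta)%R.
    elim: s sD => [_|p s IH sD]; first by exists 1%N.
    have [|N [N0 HN]] := IH.
      by move=> q qs; apply: sD; rewrite inE qs orbT.
    have [_ [f [cf pf]]] : D p by apply: sD; rewrite inE eqxx.
    have [C fC] := bounded_continuous cptX cf.
    exists (maxn N (Num.truncn ((C + C) / delta)).+1); split; first by rewrite leq_max N0.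
    move=> q; rewrite inE => /predU1P[->|qs] n x; rewrite geq_max => /andP[Nn Mn]; last exact: HN.
    have n0 : (0 < n%:R :> R)%R by rewrite ltr0n (leq_trans N0).
    rewrite mulrC ler_pdivrMr// pf birkhoff_sumB.
    apply: (@le_trans _ _ (C + C)%R).
      by rewrite (le_trans (ler_norm _))// (le_trans (ler_normB _ _))// lerD.
    rewrite mulrC -ler_pdivrMr// ltW//.
    by rewrite (lt_le_trans (truncnS_gt _))// ler_nat.
  have [x ox] := orbit_exists corrT N.
  exists (orbit_average [:: x] (fun=> 1%R)); split.
    apply: orbit_average_graph => //; last by rewrite big_seq1.
    by move=> y; rewrite inE => /eqP ->.
  move=> p ps; have [-> _] := sD p ps.
  by rewrite /orbit_average big_seq1 mul1r add0r; exact: HN.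
by exists L; split => // f cf; apply: (LD (coboundary f, 0%R)); split => //; exists f.
Qed.

(** A supporting functional of the pressure at [phi] is a limit of Gibbs averages
    over separated families of long orbits. *)
Lemma tangent_average_exists phi : continuous_on_graph T phi ->
  pressure T phi < +oo -> exists L, graph_average G L /\
    forall psi, continuous_on_graph T psi ->
      pressure T phi + (L psi)%:E <= pressure T (fun z => phi z + psi z)%R.
Proof.
move=> cphi Plty; have bphi := bounded_on_graph cptX corrT cphi.
have [p pE] : exists p : R, pressure T phi = p%:E.
  exists (fine (pressure T phi)); rewrite fineK// fin_numElt Plty andbT.
  exact: pressure_gtNy.
pose D := [set q : (X * X -> R) * R | continuous_on_graph T q.1 /\
  pressure T (fun z => phi z + q.1 z)%R = (p + q.2)%:E].
have [||L [LG LD]] := @graph_average_compactness R _ G D.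
- by move=> q [cq _]; exact: bounded_on_graph.
- move=> s delta d0 sD; pose e := (delta / 2)%R.
  have e0 : (0 < e)%R by rewrite divr_gt0.
  have [eps [eps0 ngrowth]] : exists eps, (0 < eps)%R /\
      ~ growth_rate_le T phi eps (p - e)%R.
    apply: contrapT => H; have : pressure T phi <= (p - e)%:E.
      apply: pressure_le => eps eps0; apply: contrapT => ng; apply: H.
      by exists eps.
    by rewrite pE lee_fin leNgt gtrBl e0.
  have [N HN] : exists N, forall q, q \in s -> forall n, (N <= n)%N ->
      forall t, separated_orbits T eps (n := n) t ->
      (gibbs_sum (fun z => phi z + q.1 z) t <= expR (n%:R * (p + q.2 + e)))%R.
    elim: s sD => [_|q s IH sD]; first by exists 0%N.
    have [|N HN] := IH.
      by move=> q' qs; apply: sD; rewrite inE qs orbT.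
    have [cq qE] : D q by apply: sD; rewrite inE eqxx.
    have [|M HM] := @growth_rate_of_pressure R X T
        (fun z => phi z + q.1 z)%R (p + q.2 + e)%R _ eps eps0.
      by rewrite qE lte_fin ltrDl.
    exists (maxn N M) => q'; rewrite inE => /predU1P[->|qs] n; rewrite geq_max => /andP[Nn Mn].
      exact: HM.
    exact: HN.
  (* The pressure is not less than [p], so that at some scale the growth rate
     exceeds [p - e] for arbitrarily long orbits. *)
  have [n [Nn [t [st Zt]]]] : exists n, (maxn N 1 <= n)%N /\ exists t,
      separated_orbits T eps (n := n) t /\ (expR (n%:R * (p - e)) < gibbs_sum phi t)%R.
    apply: contrapT => H; apply: ngrowth; exists (maxn N 1) => n Nn t st.
    by rewrite leNgt; apply/negP => Zt; apply: H; exists n; split => //; exists t.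
  have n0 : (0 < n)%N by rewrite (leq_trans _ Nn)// leq_max orbT.
  have Nn' : (N <= n)%N by rewrite (leq_trans _ Nn)// leq_max leqnn.
  have [_ ot _] := st.
  have Z0 : (0 < gibbs_sum phi t)%R by rewrite (lt_trans _ Zt)// expR_gt0.
  have [L [LG HL]] := @gibbs_average R X T phi n t n0 ot Z0.
  exists L; split => // q qs.
  have le1 := le_trans (HL q.1) (HN q qs n Nn' t st).
  have : (expR (n%:R * (p - e)) * expR (n%:R * L q.1) < expR (n%:R * (p + q.2 + e)))%R.
    by apply: lt_le_trans le1; rewrite ltr_pM2r ?expR_gt0.
  rewrite -expRD ltr_expR -mulrDr ltr_pM2l ?ltr0n// => h.
  by rewrite (splitr delta) -/e; lra.
exists L; split => // psi cpsi.
have bpsi := bounded_on_graph cptX corrT cpsi.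
have bsum := bounded_onD bphi bpsi.
have [r rE] : exists r : R, pressure T (fun z => phi z + psi z)%R = r%:E.
  exists (fine (pressure T (fun z => phi z + psi z)%R)); rewrite fineK// fin_numElt.
  apply/andP; split; first exact: (pressure_gtNy corrT bsum).
  exact: (pressure_lty corrT bphi bsum Plty).
rewrite pE rE -EFinD lee_fin -lerBrDl.
apply: (LD (psi, r - p)%R); split => //=.
by rewrite rE subrKC.
Qed.

Lemma average_measure_invariant L (Q : R.-pker (borel X) ~> (borel X))
    (mu : probability (borel X) R) :
  graph_average G L -> supported_by T Q ->
  (forall phi, continuous_on_graph T phi ->
      potential_integral T phi Q mu = (L phi)%:E) ->
  (forall f : X -> R, continuous f -> (L (coboundary f) <= 0)%R) ->
  kernel_invariant Q mu.
Proof.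
move=> LG QT QE Lf; apply: (invariant_of_coboundaries cptX corrT QT) => f cf.
rewrite QE; last exact: continuous_coboundary.
congr EFin; apply/eqP; rewrite eq_le (Lf f cf)/=.
have cNf : continuous (fun x => - f x)%R by move=> x; apply: cvgN; exact: cf.
have := Lf _ cNf; have [_ LZ _] := LG.
have -> : coboundary (fun x => - f x)%R = (fun z => -1 * coboundary f z)%R.
  by apply/funext => z; rewrite /coboundary; ring.
rewrite LZ; first by rewrite mulN1r oppr_le0.
by apply: bounded_on_graph => //; exact: continuous_coboundary.
Qed.

(** A functional below the increments of the pressure is realized by a kernel
    and a measure. Coboundaries leave the pressure unchanged, so that the
    functional is nonpositive on them, which forces invariance. *)
Lemma equilibrium_exists phi : continuous_on_graph T phi ->
  exists (Q : R.-pker (borel X) ~> (borel X)) (mu : probability (borel X) R),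
  [/\ supported_by T Q, kernel_invariant Q mu &
      pressure T phi < +oo -> forall psi, continuous_on_graph T psi ->
        pressure T phi + potential_integral T psi Q mu <=
        pressure T (fun z => phi z + psi z)%R].
Proof.
move=> cphi; have [Plty|Poo] := boolP (pressure T phi < +oo); last first.
  have [L [LG Lf]] := invariant_average_exists.
  have [Q [mu [QT QE]]] := kernel_of_average cptX corrT LG.
  exists Q, mu; split => //; exact: (average_measure_invariant LG QT QE Lf).
have [L [LG LP]] := tangent_average_exists cphi Plty.
have [Q [mu [QT QE]]] := kernel_of_average cptX corrT LG.
exists Q, mu; split => //; last by move=> _ psi cpsi; rewrite QE//; exact: LP.
apply: (average_measure_invariant LG QT QE) => f cf.
have := LP (coboundary f) (@continuous_coboundary _ _ T f cf).
rewrite coboundary_pressure//.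
have := pressure_gtNy corrT (bounded_on_graph cptX corrT cphi).
move: Plty; case: (pressure T phi) => // p _ _.
by rewrite -EFinD lee_fin gerDl.
Qed.

End equilibrium.

(** * Regularity of Borel measures *)

Section regularity.
Context (R : realType) (X : pmetricType R) (mu : probability (borel X) R).

Let regular (A : set X) := measurable (A : set (borel X)) /\
  forall e : R, (0 < e)%R -> exists K U : set X,
    [/\ closed K, open U, K `<=` A, A `<=` U & mu (U `\` K) <= e%:E].

(* An open set is the increasing union of the sets of points at distance at
   least [1 / n] from its complement. *)
Let regular_open (U : set X) : open U -> regular U.
Proof.
move=> oU; split=> [|e e0]; first exact: borel_open.
have [U0|nU0] := pselect ((~` U) !=set0); last first.
  have -> : U = setT.
    by apply/seteqP; split => // x _; apply: contrapT => nUx; apply: nU0; exists x.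
  exists setT, setT; split; [exact: closedT| |by []|by []|].
    exact: openT.
  by rewrite setDv measure0 lee_fin ltW.
have cU : closed (~` U) by exact: open_closedC.
pose F n := [set x : X | n.+1%:R^-1 <= dist_to (~` U) x]%R.
have cF n : closed (F n).
  rewrite (_ : F n = dist_to (~` U) @^-1` [set y | n.+1%:R^-1 <= y]%R)//.
  by apply: closed_comp; [move=> x _; exact: continuous_dist_to|exact: closed_ge].
have FU n : F n `<=` U.
  move=> x Fx; apply: contrapT => nUx; move: Fx.
  by rewrite /F /= dist_to_eq0// leNgt invr_gt0 ltr0n.
have mF n : measurable (F n : set (borel X)) by exact: borel_closed.
have FE : \bigcup_n F n = U.
  apply/seteqP; split => [x [n _ /FU//]|x Ux].
  have d0 : (0 < dist_to (~` U) x)%R by apply: dist_to_gt0 => //; exact.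
  exists (Num.truncn (dist_to (~` U) x)^-1) => //; rewrite /F /=.
  rewrite -[leRHS]invrK lef_pV2 ?posrE ?invr_gt0// ?ltr0n//.
  by rewrite ltW// truncnS_gt.
have muF : mu (F n) @[n --> \oo] --> mu U.
  rewrite -FE; apply: nondecreasing_cvg_mu => //.
    by apply: bigcupT_measurable.
  move=> n m nm; apply/subsetPset => x; rewrite /F /= => /(le_trans _); apply.
  by rewrite lef_pV2 ?posrE ?ltr0n// ler_nat.
have [n Hn] : exists n, mu U - e%:E <= mu (F n).
  apply: contrapT => H; have : mu U <= mu U - e%:E.
    apply: (cvge_le _ muF); near=> n; rewrite leNgt; apply/negP => h; apply: H.
    by exists n; exact: ltW.
  have mUfin : mu U \is a fin_num by exact: fin_num_measure (borel_open oU).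
  by rewrite -(fineK mUfin) -EFinB lee_fin leNgt gtrBl e0.
exists (F n), U; split => //.
rewrite measureD//; [|exact: borel_open|by rewrite (le_lt_trans (probability_le1 _ (borel_open oU)))// ltry].
have -> : (U `&` F n = F n)%classic by apply: setIidr; exact: FU.
by rewrite leeBlDr ?fin_num_measure// addeC -leeBlDr.
Unshelve. all: by end_near. Qed.

Let regular_setC A : regular A -> regular (~` A).
Proof.
move=> [mA rA]; split=> [|e e0]; first exact: measurableC.
have [K [U [cK oU KA AU KU]]] := rA e e0.
exists (~` U), (~` K); split.
- exact: open_closedC.
- exact: closed_openC.
- exact: subsetC.
- exact: subsetC.
- by rewrite setDE setCK setIC -setDE.
Qed.

(* Errors that sum up to [e / 2], and a finite union of the closed sets that
   misses at most [e / 2] of their union. *)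
Let regular_bigcup (F : (set X)^nat) : (forall n, regular (F n)) ->
  regular (\bigcup_n F n).
Proof.
move=> rF; split=> [|e e0]; first by apply: bigcupT_measurable => n; have [] := rF n.
pose ee n := (e / 2 / (2 ^ n.+1)%:R)%R.
have ee0 n : (0 < ee n)%R by rewrite !divr_gt0// ltr0n expn_gt0.
have /choice[KU KUP] n : exists KU : set X * set X, [/\ closed KU.1, open KU.2,
    KU.1 `<=` F n, F n `<=` KU.2 & mu (KU.2 `\` KU.1) <= (ee n)%:E].
  by have [_ /(_ _ (ee0 n))[K [U H]]] := rF n; exists (K, U).
pose K n := (KU n).1; pose U n := (KU n).2.
have mK n : measurable (K n : set (borel X)) by have [+ _ _ _ _] := KUP n; exact: borel_closed.
have mU n : measurable (U n : set (borel X)) by have [_ + _ _ _] := KUP n; exact: borel_open.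
have mKb : measurable (\bigcup_n K n : set (borel X)) by exact: bigcupT_measurable.
have mUb : measurable (\bigcup_n U n : set (borel X)) by exact: bigcupT_measurable.
pose KN N := \big[setU/set0]_(i < N.+1) K i.
have mKN N : measurable (KN N : set (borel X)) by apply: bigsetU_measurable.
have muK : mu (KN N) @[N --> \oo] --> mu (\bigcup_n K n).
  have KNE : \bigcup_N KN N = \bigcup_n K n := bigcup_bigsetU_bigcup K.
  rewrite -KNE; apply: nondecreasing_cvg_mu => //.
    by rewrite KNE.
  move=> n m nm; apply/subsetPset; rewrite /KN -!bigcup_mkord => x [i /= ni Kx].
  by exists i => //=; exact: leq_trans ni _.
have Kfin : mu (\bigcup_n K n) \is a fin_num by exact: fin_num_measure mKb.
have [N HN] : exists N, mu (\bigcup_n K n) - (e / 2)%:E <= mu (KN N).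
  apply: contrapT => H; have : mu (\bigcup_n K n) <= mu (\bigcup_n K n) - (e / 2)%:E.
    apply: (cvge_le _ muK); near=> n; rewrite leNgt; apply/negP => h; apply: H.
    by exists n; exact: ltW.
  by rewrite -(fineK Kfin) -EFinB lee_fin leNgt gtrBl divr_gt0.
have KNK : KN N `<=` \bigcup_n K n.
  by rewrite /KN -bigcup_mkord => x [i _ Kx]; exists i.
exists (KN N), (\bigcup_n U n); split.
- apply: closed_bigsetU => i _; by have [] := KUP i.
- by apply: bigcup_open => n _; have [] := KUP n.
- by move=> x /KNK[n _ Kx]; exists n => //; have [_ _ + _ _] := KUP n; apply.
- by move=> x [n _ Fx]; exists n => //; have [_ _ _ + _] := KUP n; apply.
have sub : \bigcup_n U n `\` KN N `<=`
    (\bigcup_n (U n `\` K n)) `|` (\bigcup_n K n `\` KN N).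
  move=> x [[n _ Ux] nK]; have [Kx|nKx] := pselect ((\bigcup_n K n) x); first by right.
  by left; exists n => //; split => // Kx; apply: nKx; exists n.
have m1 n : measurable (U n `\` K n : set (borel X)) by exact: measurableD.
have m2 : measurable (\bigcup_n (U n `\` K n) : set (borel X)).
  exact: bigcupT_measurable.
have m3 : measurable (\bigcup_n K n `\` KN N : set (borel X)) by exact: measurableD.
apply: (@le_trans _ _ (mu ((\bigcup_n (U n `\` K n)) `|` (\bigcup_n K n `\` KN N)))).
  by apply: le_measure; rewrite ?inE//; [exact: measurableD|exact: measurableU].
apply: (le_trans (measureU2 _ m2 m3)).
rewrite [e in e%:E](splitr e) EFinD; apply: leeD.
  apply: (le_trans (measure_sigma_subadditive _ m1 m2 (@subset_refl _ _))).
  apply: le_trans (epsilon_trick0 _ _); last by rewrite divr_ge0// ltW.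
  by apply: lee_nneseries => // n _; have [_ _ _ _] := KUP n.
rewrite measureD//; last by rewrite (le_lt_trans (probability_le1 _ mKb))// ltry.
have -> : ((\bigcup_n K n) `&` KN N = KN N)%classic by exact: setIidr.
rewrite leeBlDr ?fin_num_measure// addeC -leeBlDr//.
Unshelve. all: by end_near. Qed.

(** The sets squeezed between a closed and an open set of nearly the same mass
    form a sigma-algebra that contains the open sets. *)
Lemma inner_regular (A : set X) (e : R) : measurable (A : set (borel X)) -> (0 < e)%R ->
  exists K, [/\ closed K, K `<=` A & mu (A `\` K) <= e%:E].
Proof.
move=> mA e0.
have /(_ A mA)[_ /(_ e e0)[K [U [cK oU KA AU KU]]]] :
    @measurable _ (borel X) `<=` regular.
  apply: smallest_sub; last exact: regular_open.
  split.
  - exact/regular_open/open0.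
  - by move=> B rB; rewrite setTD; exact: regular_setC.
  - exact: regular_bigcup.
exists K; split => //; apply: le_trans KU; apply: le_measure; rewrite ?inE.
- by apply: measurableD => //; exact: borel_closed.
- by apply: measurableD; [exact: borel_open|exact: borel_closed].
- by move=> x [Ax nKx]; split => //; exact: AU.
Qed.

End regularity.

(** * Uniformity on compact sets and maximal separated families *)

(** A Lebesgue number, found by letting the scale tend to zero in the near
    covering property of compact sets. *)
Lemma compact_close_pairs (R : realType) (W : pseudoMetricType R) (A : set W)
    (P : W -> W -> Prop) : compact A ->
    (forall w, A w -> exists2 e : R, (0 < e)%R & forall u v, ball w e u -> ball w e v ->
       A u -> A v -> P u v) ->
  exists2 e : R, (0 < e)%R & forall u v, A u -> A v -> ball u e v -> P u v.
Proof.
move=> /compact_near_coveringP cA loc.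
have : \forall e \near (0 : R)^'+, A `<=` (fun u => forall v, A u -> A v -> ball u e v -> P u v).
  apply: cA => w Aw; have [e e0 H] := loc w Aw; have e20 : (0 < e / 2)%R by rewrite divr_gt0.
  exists (ball w (e / 2), [set d | d <= e / 2]%R); first split => /=.
  - exact: nbhsx_ballx.
  - exact: nbhs_right_le.
  move=> [u d] /= [wu de] v Au Av uv; apply: H => //; apply: ball_split wu _.
    exact: ballxx.
  exact: le_ball uv.
move=> near_e; near (0 : R)^'+ => e.
exists e => // u v Au Av; have : A `<=` (fun u => forall v, A u -> A v -> ball u e v -> P u v).
  by near: e.
by move=> /(_ u Au v Au Av).
Unshelve. all: by end_near. Qed.

Section separation.
Context (R : realType) (X : pmetricType R).
Hypothesis cptX : compact [set: X].
Implicit Types (T : X -> set X).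

(** Disjoint compact sets lie at a positive distance, so that an approximation
    of a point tells in which of them it lies. *)
Lemma separation_index k (K : 'I_k.+1 -> set X) : (forall i, closed (K i)) ->
    (forall i i' x, K i x -> K i' x -> i = i') ->
  exists e (j : X -> 'I_k.+1), (0 < e)%R /\
    forall i x z, K i x -> (mdist x z < e)%R -> j z = i.
Proof.
move=> cK dK.
have [w _|e e0 H] := @compact_close_pairs R X setT
    (fun u v => forall i i', K i u -> K i' v -> i = i') cptX.
  have : \forall u \near w, forall i, ~ K i w -> ~ K i u.
    apply: filter_forall => i; have [Kw|nKw] := pselect (K i w).
      by near=> u.
    have : \forall u \near w, ~ K i u.
      by apply: open_nbhs_nbhs; split => //; exact: closed_openC.
    by apply: filterS => u nKu _.
  move=> /nbhs_ballP[e /= e0 He]; exists e => // u v wu wv _ _ i i' Ku Kv.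
  apply: (dK _ _ w); apply: contrapT => nK; first exact: (He u wu i nK Ku).
  exact: (He v wv i' nK Kv).
have e20 : (0 < e / 2)%R by rewrite divr_gt0.
have /choice[j jP] (z : X) : exists i, forall i' x, K i' x -> (mdist x z < e / 2)%R -> i = i'.
  have [[i [x [Kx xz]]]|no] := pselect (exists i x, K i x /\ (mdist x z < e / 2)%R).
    exists i => i' x' Kx' xz'; apply: (H x x' _ _ _ _ _ Kx Kx') => //.
    apply: (@ball_splitr _ _ z); rewrite ballEmdist/= metric_sym//.
  by exists ord0 => i' x' Kx' xz'; exfalso; apply: no; exists i', x'.
by exists (e / 2)%R, j; split => // i x z Kx xz; exact: jP Kx xz.
Unshelve. all: by end_near. Qed.

Lemma uniformly_continuous_on_graph T phi eta : correspondence T ->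
    continuous_on_graph T phi -> (0 < eta)%R ->
  exists2 e : R, (0 < e)%R & forall z z', corr_graph T z -> corr_graph T z' ->
    (mdist z.1 z'.1 < e)%R -> (mdist z.2 z'.2 < e)%R -> (`|phi z - phi z'| < eta)%R.
Proof.
move=> corrT cphi eta0; have eta20 : (0 < eta / 2)%R by rewrite divr_gt0.
have [w Gw|e e0 H] := @compact_close_pairs R (X * X)%type (corr_graph T)
    (fun z z' => (`|phi z - phi z'| < eta)%R) (compact_corr_graph cptX corrT).
  have : \forall z \near w, corr_graph T z -> (`|phi w - phi z| < eta / 2)%R.
    move/subspace_continuousP: cphi => /(_ w Gw)/cvgrPdist_lt/(_ _ eta20).
    exact.
  move=> /nbhs_ballP[e /= e0 He]; exists e => // u v wu wv Gu Gv.
  rewrite (_ : phi u - phi v = (phi w - phi v) - (phi w - phi u))%R; last by ring.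
  by rewrite (le_lt_trans (ler_normB _ _))// [ltRHS](splitr eta) ltrD// ?He.
exists e => // z z' Gz Gz' z1 z2; apply: H => //.
by split; rewrite ballEmdist.
Qed.

Lemma tdist_lt n (e : R) (x y : n.-tuple X) : (0 < e)%R ->
  (tdist x y < e)%R <-> forall i, (mdist (tnth x i) (tnth y i) < e)%R.
Proof.
move=> e0; rewrite /tdist; split=> [h i|h].
  by apply: le_lt_trans h; exact: (le_bigmax_cond _ (fun i => mdist (tnth x i) (tnth y i))).
by apply/bigmax_ltP; split.
Qed.

Lemma tdist_sym n (x y : n.-tuple X) : tdist x y = tdist y x.
Proof. by apply: eq_bigr => i _; rewrite metric_sym. Qed.

(** A separated family of largest size is a net; the size is bounded because
    the itineraries of its members through a finite cover by small balls
    are distinct. *)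
Lemma maximal_separated T n (e : R) : (0 < e)%R ->
  exists s : seq (n.+1.-tuple X), separated_orbits T e s /\
    forall x, orbits T x -> exists2 y, y \in s & (tdist x y < e)%R.
Proof.
move=> e0; have e20 : (0 < e / 2)%R by rewrite divr_gt0.
have [c cP] : exists c : seq X, forall x, exists i : 'I_(size c), (mdist (tnth (in_tuple c) i) x < e / 2)%R.
  have := cptX; rewrite compact_cover => /(_ X setT (fun x => (ball x (e / 2))^°)%R).
  case=> [i _|x _|D _ DP]; first exact: open_interior.
    by exists x => //; apply: nbhsx_ballx.
  exists (finmap.enum_fset D) => x; have [y /= yD /interior_subset] := DP x I.
  rewrite ballEmdist/= => yx.
  have yi : (index y (finmap.enum_fset D) < size (finmap.enum_fset D))%N by rewrite index_mem.
  by exists (Ordinal yi); rewrite (tnth_nth x)/= nth_index.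
pose Pn m := `[< exists s : seq (n.+1.-tuple X), separated_orbits T e s /\ size s = m >].
have exP : exists m, Pn m by exists 0%N; apply/asboolP; exists [::]; split.
have [code codeP] := choice cP.
pose itin (x : n.+1.-tuple X) : {ffun 'I_n.+1 -> 'I_(size c)} := [ffun i => code (tnth x i)].
have bound m : Pn m -> (m <= #|{ffun 'I_n.+1 -> 'I_(size c)}|)%N.
  move=> /asboolP[s [[us _ ss] <-]]; rewrite -(size_map itin); rewrite -(card_uniqP _) ?max_card//.
  rewrite map_inj_in_uniq// => x y xs ys xy; apply: contrapT => nxy.
  have := ss _ _ xs ys nxy; rewrite leNgt => /negP; apply; apply/tdist_lt => // i.
  have := congr1 (fun f : {ffun _} => f i) xy; rewrite !ffunE => cxy.
  have := ball_splitr; move=> /(_ R X (tnth (in_tuple c) (code (tnth x i))) (tnth x i) (tnth y i) e).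
  rewrite !ballEmdist/=; apply; first exact: codeP.
  by rewrite cxy; exact: codeP.
have [m /asboolP[s [ss sm]] mmax] := ex_maxnP exP bound.
exists s; split => // x Ox; apply: contrapT => far.
have far' y : y \in s -> (e <= tdist x y)%R.
  by move=> ys; rewrite leNgt; apply/negP => xy; apply: far; exists y.
have : (m.+1 <= m)%N; last by rewrite ltnn.
apply: mmax; apply/asboolP; exists (x :: s); split; last by rewrite /= sm.
case: ss => us so sd; split.
- rewrite /= us andbT; apply/negP => /far'; rewrite leNgt => /negP; apply.
  by apply/tdist_lt => // i; rewrite mdistxx.
- by move=> y; rewrite inE => /orP[/eqP->//|/so].
- move=> y z; rewrite !inE => /orP[/eqP->|ys] /orP[/eqP->|zs] yz //.
  + exact: far'.
  + by rewrite tdist_sym; exact: far'.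
  + exact: sd.
Qed.

End separation.

(** * Orbits of a Markov chain *)

Lemma composite_kernel_exists d d1 d2 (X : measurableType d) (Y : measurableType d1)
    (Z : measurableType d2) (R : realType) (K : R.-pker X ~> Y) (S : R.-pker Y ~> Z) :
  exists KS : R.-pker X ~> Z,
  (forall x A, KS x A = \int[K x]_t S t A) /\
  (forall x (g : Z -> \bar R), (forall z, 0 <= g z) -> measurable_fun setT g ->
     \int[KS x]_z g z = \int[K x]_t \int[S t]_z g z).
Proof.
have /choice[P PP] x : exists P : probability Z R,
    (forall A : set Z, P A = \int[K x]_t S t A) /\
    (forall g : Z -> \bar R, (forall z, 0 <= g z) -> measurable_fun setT g ->
       \int[P]_z g z = \int[K x]_t \int[S t]_z g z).
  have [Kx KxE] := probability_of_measure (@prob_kernel _ _ _ _ _ K x).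
  by have := mixture_exists Kx S; rewrite KxE.
have [|KS KSE] := @pkernel_of_probabilities _ _ X Z R P.
  move=> U mU; rewrite (_ : P ^~ U = fun x => \int[K x]_t S t U).
    apply: measurable_fun_integral_kernel; last exact: measurable_kernel.
      by move=> V mV; exact: measurable_kernel.
    by move=> t; exact: measure_ge0.
  by apply/funext => x; have [->] := PP x.
by exists KS; split => [x A|x g g0 mg]; rewrite KSE; have [PA PI] := PP x; [exact: PA|exact: PI].
Qed.

Section paths.
Context (R : realType) (X : pmetricType R).
Variables (Q : R.-pker (borel X) ~> (borel X)) (mu : probability (borel X) R).
Notation BX := (borel X).

Let extend n (t : n.+1.-tuple BX) (y : BX) : n.+2.-tuple BX := [tuple of rcons t y].

Let tnth_extend_max n (t : n.+1.-tuple BX) y : tnth (extend t y) ord_max = y.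
Proof. by rewrite (tnth_nth y) /= nth_rcons size_tuple ltnn eqxx. Qed.

Let tnth_extend n (t : n.+1.-tuple BX) y (i : 'I_n.+1) :
  tnth (extend t y) (widen_ord (leqnSn n.+1) i) = tnth t i.
Proof. by rewrite !(tnth_nth y) /= nth_rcons size_tuple ltn_ord. Qed.

Let measurable_extend n :
  measurable_fun [set: n.+1.-tuple BX * BX] (fun z => extend z.1 z.2).
Proof.
apply/measurable_fun_tnthP => i; have [j ->|->] := unliftP ord_max i.
  apply: (eq_measurable_fun (fun z => tnth z.1 j)) => [z _|].
    rewrite /= -(tnth_extend z.1 z.2); congr tnth; apply/val_inj => /=.
    by rewrite /bump leqNgt ltn_ord.
  exact: measurableT_comp (measurable_tnth j) measurable_fst.
apply: (eq_measurable_fun (fun z => z.2)) => [z _|]; last exact: measurable_snd.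
by rewrite /= tnth_extend_max.
Qed.

Let extension_kernel_exists n : exists S : R.-pker (n.+1.-tuple BX) ~> (n.+2.-tuple BX),
  (forall t A, S t A = Q (tnth t ord_max) [set y | A (extend t y)]) /\
  (forall t (g : n.+2.-tuple BX -> \bar R), (forall z, 0 <= g z) -> measurable_fun setT g ->
     \int[S t]_z g z = \int[Q (tnth t ord_max)]_y g (extend t y)).
Proof.
have /choice[P PE] (t : n.+1.-tuple BX) :=
  probability_of_measure (@prob_kernel _ _ _ _ _ Q (tnth t ord_max)).
have [|K KE] := @pkernel_of_probabilities _ _ (n.+1.-tuple BX) BX R P.
  move=> U mU; rewrite (_ : P ^~ U = Q ^~ U \o (fun t => tnth t ord_max)).
    exact: measurableT_comp (measurable_kernel Q U mU) (measurable_tnth ord_max).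
  by apply/funext => t; rewrite PE.
have [S [SA SI]] := image_kernel_exists K (@measurable_extend n).
by exists S; split => [t A|t g g0 mg]; rewrite ?SA ?SI// KE PE.
Qed.

(** The recursive formula defines the values of the iterated kernels at all sets,
    measurable or not, and the kernels built here agree with it at all of them. *)
Lemma path_kernel_exists n : exists K : R.-pker BX ~> (n.+1.-tuple BX),
  forall x, K x = @kernel_iter R X Q n x :> (set _ -> \bar R).
Proof.
elim: n => [|n [K KE]].
  have m1 : measurable_fun [set: BX] (fun x => [tuple x] : 1.-tuple BX).
    apply/measurable_fun_tnthP => i.
    by apply: (eq_measurable_fun id) => // x _; rewrite /= (tnth_nth x) ord1.
  by exists (kdirac m1).
have [S [SA SI]] := extension_kernel_exists n.
have [KS [KSA _]] := composite_kernel_exists K S.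
exists KS => x; apply/funext => A.
by rewrite KSA /= -KE; apply: eq_integral => t _; rewrite SA.
Qed.

Let kernel_iter_integral n (K : R.-pker BX ~> (n.+1.-tuple BX))
    (K' : R.-pker BX ~> (n.+2.-tuple BX)) :
  (forall x, K x = @kernel_iter R X Q n x :> (set _ -> \bar R)) ->
  (forall x, K' x = @kernel_iter R X Q n.+1 x :> (set _ -> \bar R)) ->
  forall x (g : n.+2.-tuple BX -> \bar R), (forall z, 0 <= g z) -> measurable_fun setT g ->
  \int[K' x]_z g z = \int[K x]_t \int[Q (tnth t ord_max)]_y g (extend t y).
Proof.
move=> KE KE' x g g0 mg; have [S [SA SI]] := extension_kernel_exists n.
have [KS [KSA KSI]] := composite_kernel_exists K S.
have -> : (K' x : set _ -> \bar R) = KS x.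
  apply/funext => A; rewrite KE' KSA /= -KE.
  by apply: eq_integral => t _; rewrite SA.
by rewrite KSI//; apply: eq_integral => t _; rewrite SI.
Qed.

Let measurable_extension n (g : n.+2.-tuple BX -> \bar R) :
  (forall z, 0 <= g z) -> measurable_fun setT g ->
  measurable_fun setT (fun t : n.+1.-tuple BX => \int[Q (tnth t ord_max)]_y g (extend t y)).
Proof.
move=> g0 mg; have [S [SA SI]] := extension_kernel_exists n.
rewrite (_ : (fun t => _) = fun t => \int[S t]_z g z); last by apply/funext => t; rewrite SI.
by apply: measurable_fun_integral_kernel => // U mU; exact: measurable_kernel.
Qed.

Let path_measure_mixture n (K : R.-pker BX ~> (n.+1.-tuple BX)) :
  (forall x, K x = @kernel_iter R X Q n x :> (set _ -> \bar R)) ->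
  exists nu : probability (n.+1.-tuple BX) R,
    (nu = @path_measure R X Q mu n :> (set _ -> \bar R)) /\
    (forall f : n.+1.-tuple BX -> \bar R, (forall z, 0 <= f z) -> measurable_fun setT f ->
     \int[nu]_z f z = \int[mu]_x \int[K x]_z f z).
Proof.
move=> KE; have [nu [nuA nuI]] := mixture_exists mu K.
exists nu; split => //; apply/funext => A; rewrite nuA.
by apply: eq_integral => x _; rewrite KE.
Qed.

Hypothesis invQ : kernel_invariant Q mu.

Let integral_invariant (g : BX -> \bar R) : (forall x, 0 <= g x) ->
  measurable_fun setT g -> \int[mu]_x \int[Q x]_y g y = \int[mu]_x g x.
Proof.
move=> g0 mg; have [nu [nuA nuI]] := mixture_exists mu Q.
rewrite -nuI//; apply: eq_measure_integral => A mA _.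
by rewrite nuA; exact: invQ.
Qed.

(** By invariance the last coordinate has law [mu] whatever the length of the
    path; the other coordinates and steps are inherited from shorter paths. *)
Lemma path_probability_exists n : exists nu : probability (n.+1.-tuple BX) R,
  [/\ nu = @path_measure R X Q mu n :> (set _ -> \bar R),
      forall (i : 'I_n.+1) (g : BX -> \bar R), (forall x, 0 <= g x) ->
        measurable_fun setT g -> \int[nu]_t g (tnth t i) = \int[mu]_x g x &
      forall (i : 'I_n) (h : BX * BX -> \bar R), (forall z, 0 <= h z) ->
        measurable_fun setT h ->
        \int[nu]_t h (step t i) = \int[mu]_x \int[Q x]_y h (x, y)].
Proof.
elim: n => [|n [nu [nuE nu1 nu2]]].
  have [K KE] := path_kernel_exists 0; have [nu [nuE nuI]] := path_measure_mixture KE.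
  exists nu; split => // [i g g0 mg|[]//].
  have mgi : measurable_fun setT (fun t : 1.-tuple BX => g (tnth t i)).
    exact: measurableT_comp mg (measurable_tnth i).
  rewrite nuI//; apply: eq_integral => x _; rewrite KE /= integral_dirac// diracT mul1e.
  by rewrite (tnth_nth x) ord1.
have [K KE] := path_kernel_exists n; have [K' KE'] := path_kernel_exists n.+1.
have [nu0 [nu0E nu0I]] := path_measure_mixture KE.
have [nu' [nuE' nuI']] := path_measure_mixture KE'.
have rec (f : n.+2.-tuple BX -> \bar R) : (forall z, 0 <= f z) -> measurable_fun setT f ->
    \int[nu']_z f z = \int[nu]_t \int[Q (tnth t ord_max)]_y f (extend t y).
  move=> f0 mf; rewrite nuI'// nuE -nu0E nu0I//; last exact: measurable_extension.
    by apply: eq_integral => x _; rewrite (kernel_iter_integral KE KE').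
  by move=> t; exact: integral_ge0.
have mint (g : BX -> \bar R) : (forall x, 0 <= g x) -> measurable_fun setT g ->
    measurable_fun setT (fun x => \int[Q x]_y g y).
  by move=> g0 mg; apply: measurable_fun_integral_kernel => // U mU; exact: measurable_kernel.
exists nu'; split => // [i g g0 mg|i h h0 mh].
  rewrite rec//; last exact: measurableT_comp mg (measurable_tnth i).
  have [j ->|->] := unliftP ord_max i.
    have -> : lift ord_max j = widen_ord (leqnSn n.+1) j.
      by apply/val_inj; rewrite /= /bump leqNgt ltn_ord.
    rewrite -(nu1 j g)//; apply: eq_integral => t _.
    transitivity (\int[Q (tnth t ord_max)]_y g (tnth t j)).
      by apply: eq_integral => y _; rewrite tnth_extend.
    by rewrite integral_cst// prob_kernel mule1.
  transitivity (\int[nu]_t \int[Q (tnth t ord_max)]_y g y).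
    by apply: eq_integral => t _; apply: eq_integral => y _; rewrite tnth_extend_max.
  rewrite (nu1 ord_max (fun x => \int[Q x]_y g y)) ?integral_invariant//; last exact: mint.
  by move=> x; exact: integral_ge0.
have mstep m (j : 'I_m) : measurable_fun setT (fun t : m.+1.-tuple BX => step t j : BX * BX).
  by apply: measurable_fun_pair; exact: measurable_tnth.
rewrite rec//; last exact: measurableT_comp mh (mstep _ i).
have [j ->|->] := unliftP ord_max i.
  rewrite -(nu2 j h)//; apply: eq_integral => t _.
  transitivity (\int[Q (tnth t ord_max)]_y h (step t j)).
    apply: eq_integral => y _; congr (h (_, _)).
      rewrite -(tnth_extend t y); congr tnth; apply/val_inj.
      by rewrite /= /bump leqNgt ltn_ord.
    rewrite -(tnth_extend t y); congr tnth; apply/val_inj.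
    by rewrite /= /bump /= add1n [(n <= j)%N]leqNgt ltn_ord.
  by rewrite integral_cst// prob_kernel mule1.
rewrite -(nu1 ord_max (fun x => \int[Q x]_y h (x, y))).
- apply: eq_integral => t _; apply: eq_integral => y _; congr (h (_, _)).
    by rewrite -(tnth_extend t y); congr tnth; exact/val_inj.
  by rewrite -[RHS](tnth_extend_max t y); congr tnth; exact/val_inj.
- by move=> x; exact: integral_ge0.
- exact: measurable_fun_integral_finite_kernel.
Qed.

End paths.

(** * Shannon entropy *)

Section shannon.
Context (R : realType).

(** Gibbs' inequality, from [1 + x <= expR x]. *)
Lemma gibbs_inequality (I : finType) (p q : I -> R) :
    (forall i, 0 <= p i)%R -> (forall i, 0 < q i)%R ->
    (\sum_i q i <= \sum_i p i)%R ->
  (- \sum_i p i * ln (p i) <= \sum_i p i * - ln (q i))%R.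
Proof.
move=> p0 q0 qp; rewrite -sumrN -subr_ge0 -sumrB.
apply: (@le_trans _ _ (\sum_i (p i - q i))%R); first by rewrite sumrB subr_ge0.
apply: ler_sum => i _; have := p0 i; rewrite le_eqVlt => /orP[/eqP <-|pi].
  by rewrite !mul0r oppr0 subr0 sub0r oppr_le0 ltW.
have : (1 + (ln (q i) - ln (p i)) <= q i / p i)%R.
  apply: (le_trans (expR_ge1Dx _)).
  by rewrite expRB !lnK ?posrE.
rewrite ler_pdivlMr// mulrDl mul1r; set a := ln (q i); set b := ln (p i) => H.
by lra.
Qed.

Lemma shannon_entropy_ge0 d (Y : measurableType d) (nu : probability Y R)
    (I : finType) (B : I -> set Y) : (forall i, measurable (B i)) ->
  (0 <= shannon_entropy nu B)%R.
Proof.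
move=> mB; rewrite /shannon_entropy oppr_ge0 sumr_le0// => i _.
rewrite mulr_ge0_le0 ?fine_ge0// ln_le0//.
by rewrite -lee_fin fineK ?fin_num_measure// probability_le1.
Qed.

(** An upper bound on the entropy from code lengths [- ln (q i)] that are at
    most [kappa] plus a nonnegative observable. *)
Lemma shannon_entropy_le d (Y : measurableType d) (nu : probability Y R)
    (I : finType) (B : I -> set Y) (O : set Y) (q : I -> R) (V : Y -> R) (kappa M : R) :
    (forall i, measurable (B i)) -> trivIset setT B -> \bigcup_i B i = setT ->
    measurable O -> nu O = 1 -> (forall i, 0 < q i)%R -> (\sum_i q i <= 1)%R ->
    measurable_fun setT V -> (forall t, 0 <= V t)%R -> \int[nu]_t (V t)%:E <= M%:E ->
    (forall i t, O t -> B i t -> - ln (q i) <= kappa + V t)%R ->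
  (shannon_entropy nu B <= kappa + M)%R.
Proof.
move=> mB tB cB mO O1 q0 q1 mV V0 VM qV.
pose p i := fine (nu (B i)).
have pE i : nu (B i) = (p i)%:E by rewrite fineK ?fin_num_measure.
have p0 i : (0 <= p i)%R by rewrite fine_ge0.
have total (f : Y -> \bar R) : (forall t, 0 <= f t) -> measurable_fun setT f ->
    \sum_i \int[nu]_(t in B i) f t = \int[nu]_t f t.
  move=> f0 mf; under eq_bigr do rewrite integral_mkcond.
  rewrite -ge0_integral_sum//; first last.
  - by move=> i t _; exact: erestrict_ge0.
  - move=> i; apply/(measurable_restrictT _ (mB i)); exact: measurable_funS mf.
  apply: eq_integral => t _; have [i _ Bt] : (\bigcup_i B i) t by rewrite cB.
  rewrite (bigD1 i)//= big1 => [|j ji].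
    by rewrite adde0 patchE mem_set.
  rewrite patchE memNset// => Bjt; move/eqP: ji; apply.
  by apply: tB => //; exists t.
have sp : (\sum_i p i = 1)%R.
  apply: EFin_inj; rewrite -sumEFin -(probability_setT nu) -[RHS]mul1e -integral_cst//.
  rewrite -total//; apply: eq_bigr => i _.
  by rewrite integral_cst// mul1e -pE.
have mVE : measurable_fun setT (EFin \o V) by exact/measurable_EFinP.
have step i : (p i * (- ln (q i) - kappa))%:E <= \int[nu]_(t in B i) (V t)%:E.
  have [nc|pc] := leP (- ln (q i) - kappa)%R 0%R.
    apply: (@le_trans _ _ 0); first by rewrite lee_fin mulr_ge0_le0.
    by apply: integral_ge0 => t _; rewrite lee_fin.
  have mBO : measurable (B i `&` O) by exact: measurableI.
  apply: (@le_trans _ _ (\int[nu]_(t in B i `&` O) (V t)%:E)); last first.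
    apply: ge0_subset_integral => //; first exact: measurable_funS mVE.
    by move=> t _; rewrite lee_fin.
  rewrite mulrC EFinM -pE -(probability_setI1 (mB i) mO O1) -integral_cst//.
  apply: ge0_le_integral => //.
  - by move=> t _; rewrite lee_fin ltW.
  - exact: measurable_funS mVE.
  - by move=> t [Bt Ot]; rewrite lee_fin lerBlDl; exact: qV.
apply: (le_trans (gibbs_inequality p0 q0 _)); first by rewrite sp.
have -> : (\sum_i p i * - ln (q i) = kappa + \sum_i p i * (- ln (q i) - kappa))%R.
  under [in RHS]eq_bigr do rewrite mulrBr.
  by rewrite sumrB -mulr_suml sp mul1r addrC subrK.
rewrite lerD2l -lee_fin -sumEFin; apply: le_trans VM; rewrite -total//.
exact: lee_sum.
Qed.

End shannon.

(** * The entropy of a kernel is at most its abstract entropy *)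

(** The probability weights on itineraries used below as a code: follow the
    given index with probability [1 - delta], or else draw a uniform one. *)
Section smoothing.
Context (R : realType) (k : nat) (delta : R).
Hypotheses (delta0 : (0 < delta)%R) (delta1 : (delta < 1)%R).

Definition smoothing (i j : 'I_k.+1) : R :=
  ((1 - delta) * (i == j)%:R + delta / k.+1%:R)%R.

Lemma smoothing_gt0 i j : (0 < smoothing i j)%R.
Proof.
by rewrite /smoothing ltr_wpDl ?divr_gt0// mulr_ge0// subr_ge0 ltW.
Qed.

Lemma smoothing_ge_diag i : (1 - delta <= smoothing i i)%R.
Proof. by rewrite /smoothing eqxx mulr1 lerDl divr_ge0// ltW. Qed.

Lemma smoothing_ge i j : (delta / k.+1%:R <= smoothing i j)%R.
Proof. by rewrite /smoothing lerDr mulr_ge0// subr_ge0 ltW. Qed.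

Lemma smoothing_sum j : (\sum_i smoothing i j = 1)%R.
Proof.
rewrite big_split/= -mulr_sumr (bigD1 j)//= eqxx big1 ?addr0 => [|i /negPf->//].
rewrite sumr_const card_ord -[X in (_ + X)%R]mulr_natr divfK ?pnatr_eq0// mulr1.
by rewrite subrK.
Qed.

Definition itinerary_weight (J : eqType) (w : J -> R) m (index : J -> 'I_m -> 'I_k.+1)
    (s : seq J) (f : {ffun 'I_m -> 'I_k.+1}) : R :=
  (\sum_(y <- s) w y * \prod_i smoothing (f i) (index y i))%R.

Lemma itinerary_weight_sum (J : eqType) (w : J -> R) m (index : J -> 'I_m -> 'I_k.+1) s :
  (\sum_f itinerary_weight w index s f = \sum_(y <- s) w y)%R.
Proof.
rewrite exchange_big/=; apply: eq_bigr => y _; rewrite -mulr_sumr.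
rewrite -(bigA_distr_bigA (fun i c => smoothing c (index y i))) big1 ?mulr1// => i _.
exact: smoothing_sum.
Qed.

Lemma itinerary_weight_ge (J : eqType) (w : J -> R) m (index : J -> 'I_m -> 'I_k.+1) s (f : {ffun 'I_m -> 'I_k.+1}) y :
    (forall y, 0 < w y)%R -> y \in s ->
  (w y * \prod_i smoothing (f i) (index y i) <= itinerary_weight w index s f)%R.
Proof.
move=> w0 ys; rewrite /itinerary_weight (big_rem y)//= lerDl sumr_ge0// => z _.
by rewrite mulr_ge0 ?ltW// prodr_gt0// => i _; exact: smoothing_gt0.
Qed.

End smoothing.

Section core.
Context (R : realType) (X : pmetricType R) (mu : probability (borel X) R).

(** Inner regularity of the finitely many pieces. *)
Lemma partition_core k (A : 'I_k -> set X) (c : R) : measurable_partition A -> (0 < c)%R ->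
  exists K : 'I_k -> set X, [/\ forall i, closed (K i), forall i, K i `<=` A i &
    mu (~` \bigcup_i K i) <= c%:E].
Proof.
move=> [[cA tA nA] mA] c0; case: k A cA tA nA mA => [|k] A cA tA nA mA.
  have : [set: X] point by []; rewrite -cA => -[[]//].
have ck0 : (0 < c / k.+1%:R)%R by rewrite divr_gt0.
have /choice[K KP] i := inner_regular mu (mA i) ck0.
have mK i : measurable (K i : set (borel X)) by have [/borel_closed] := KP i.
exists K; split => [i|i|]; [by have [] := KP i|by have [] := KP i|].
have -> : c%:E = \sum_(i < k.+1) (c / k.+1%:R)%:E.
  rewrite sumEFin; congr EFin; rewrite sumr_const card_ord -[RHS]mulr_natr.
  by rewrite divfK ?pnatr_eq0.
pose B n := A (inord n) `\` K (inord n).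
have mB i : measurable (B i : set (borel X)) by exact: measurableD.
apply: (@le_trans _ _ (mu (\big[setU/set0]_(i < k.+1) B i))).
  apply: le_measure; rewrite ?inE.
  - by apply: measurableC; exact: fin_bigcup_measurable.
  - exact: bigsetU_measurable.
  move=> x nKx; have [i _ Ax] : cover setT A x by rewrite cA.
  rewrite -bigcup_mkord; exists i; first exact: ltn_ord.
  by rewrite /B inord_val; split => // Kx; apply: nKx; exists i.
apply: (le_trans (@Boole_inequality _ _ _ mu B k.+1 (fun i _ => mB i))).
by apply: lee_sum => i _; have [] := KP (inord i).
Qed.

End core.

Section code_length.
Context (R : realType) (X : pmetricType R) (phi : X * X -> R).
Variables (k : nat) (a : R).
Hypothesis a0 : (0 < a)%R.
Let delta : R := (1 - expR (- a))%R.
Let b : R := (- ln (delta / k.+1%:R))%R.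

Let delta0 : (0 < delta)%R.
Proof. by rewrite subr_gt0 expR_lt1 oppr_lt0. Qed.

Let delta1 : (delta < 1)%R.
Proof. by rewrite ltrBlDr ltrDl expR_gt0. Qed.

(** The weight of [y] in the Gibbs sum costs the Birkhoff sum along [y], hence
    along the path [t] that stays close to it; a correct digit of the itinerary
    costs [a], and [b] pays for a digit that cannot be read off from [y]. *)
Lemma code_length n (s : seq (n.+1.-tuple X)) (index : n.+1.-tuple X -> 'I_n.+1 -> 'I_k.+1)
    (f : {ffun 'I_n.+1 -> 'I_k.+1}) (t y : n.+1.-tuple X) (bad : set X) (eta Z : R) :
    (0 < Z)%R -> y \in s ->
    (forall i : 'I_n, (`|phi (step t i) - phi (step y i)| <= eta)%R) ->
    (forall i, ~ bad (tnth t i) -> index y i = f i) ->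
  (- ln (itinerary_weight delta (fun y => expR (- birkhoff_sum phi y) / Z)%R index s f) <=
   ln Z + birkhoff_sum phi t + n%:R * eta + n.+1%:R * a
   + \sum_(i < n.+1) b * \1_bad (tnth t i))%R.
Proof.
move=> Z0 ys close idx; set w := fun y => _.
have b0 : (0 <= b)%R.
  rewrite oppr_ge0 ln_le0// ler_pdivrMr// mul1r (le_trans (ltW delta1))// ler1n//.
have w0 z : (0 < w z)%R by rewrite divr_gt0 ?expR_gt0.
pose c i := (a + b * \1_bad (tnth t i))%R.
have cP i : (expR (- c i) <= smoothing delta (f i) (index y i))%R.
  rewrite /c indicE; have [B|nB] := pselect (bad (tnth t i)).
    rewrite mem_set// mulr1; apply: le_trans (smoothing_ge delta1 _ _).
    have -> : (delta / k.+1%:R = expR (- b))%R by rewrite opprK lnK// posrE divr_gt0.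
    by rewrite ler_expR lerN2 lerDr ltW.
  rewrite memNset// mulr0 addr0 idx//; apply: le_trans (smoothing_ge_diag delta0 _).
  by rewrite opprB addrC subrK.
have S_le : (birkhoff_sum phi y <= birkhoff_sum phi t + n%:R * eta)%R.
  rewrite -lerBlDl /birkhoff_sum -sumrB.
  have -> : (n%:R * eta = \sum_(i < n) eta)%R by rewrite sumr_const card_ord mulr_natl.
  by apply: ler_sum => i _; apply: le_trans (close i); rewrite distrC ler_norm.
set x := (ln Z + _ + _ + _ + _)%R.
have xE : x = (ln Z + birkhoff_sum phi t + n%:R * eta + \sum_i c i)%R.
  rewrite /c big_split/= sumr_const card_ord /x; rewrite -[X in (_ + (X + _))%R]mulr_natl.
  by rewrite !addrA.
have wx : (expR (- x) <= itinerary_weight delta w index s f)%R.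
  apply: le_trans (itinerary_weight_ge delta0 delta1 index f w0 ys).
  rewrite xE opprD expRD -sumrN expR_sum ler_pM ?expR_ge0//.
  - by apply: prodr_ge0 => i _; exact: expR_ge0.
  - rewrite /w -[X in (_ / X)%R]lnK ?posrE// -expRN -expRD ler_expR; lra.
  - by apply: ler_prod => i _; rewrite expR_ge0 cP.
rewrite lerNl -[leLHS]expRK ler_ln ?posrE ?expR_gt0//.
exact: lt_le_trans (expR_gt0 _) wx.
Qed.

End code_length.

Section orbit_statistics.
Context (R : realType) (X : pmetricType R) (T : X -> set X).
Hypotheses (cptX : compact [set: X]) (corrT : correspondence T).
Variables (Q : R.-pker (borel X) ~> (borel X)) (mu : probability (borel X) R).
Hypothesis QT : supported_by T Q.
Local Notation G := (corr_graph T).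
Local Notation BB := (borel X * borel X)%type.

Let mG : measurable (G : set BB).
Proof. exact: measurable_corr_graph. Qed.

(** Adding a constant makes a continuous potential nonnegative on the graph;
    extended by zero it becomes a measurable function on the square. *)
Lemma nonnegative_extension phi : continuous_on_graph T phi ->
  exists (C : R) (psi : BB -> R), [/\ forall z, (0 <= psi z)%R, measurable_fun setT psi,
    forall z, G z -> psi z = (phi z + C)%R &
    \int[mu]_x \int[Q x]_y (psi (x, y))%:E = potential_integral T phi Q mu + C%:E].
Proof.
move=> cphi; have [C CP] := bounded_on_graph cptX corrT cphi.
have cpsi : continuous_on_graph T (fun z => phi z + C)%R.
  by apply: continuous_on_graphD => //; exact: continuous_on_graph_cst.
have [nu [nuG nuF nuE]] := potential_integral_joint cptX corrT mu QT.
have C0 z : G z -> (0 <= phi z + C)%R.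
  by move=> /CP; rewrite ler_norml => /andP[h _]; lra.
pose psi : BB -> R := (fun z => phi z + C)%R \_ G.
have psi0 z : (0 <= psi z)%R by rewrite /psi patchE; case: ifPn => // /set_mem /C0.
have mpsi : measurable_fun setT psi.
  by apply/(measurable_restrictT _ mG); exact: (measurable_on_graph cptX corrT cpsi).
exists C, psi; split => //.
  by move=> z Gz; rewrite /psi patchE mem_set.
rewrite -(nuF (EFin \o psi)); last exact/measurable_EFinP.
  have [I [IE ID _ _]] := potential_mean_exists cptX corrT mu QT.
  transitivity (potential_integral T (fun z => phi z + C)%R Q mu).
    rewrite nuE// [RHS]integral_mkcond; apply: eq_integral => z _.
    by rewrite /psi/= !patchE; case: ifPn.
  have ccst := @continuous_on_graph_cst R X T C.
  rewrite (IE _ cpsi) (IE _ cphi) (ID _ (fun=> C))// EFinD -(IE (fun=> C))//.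
  by rewrite nuE// integral_cst// nuG mule1.
by move=> z; rewrite lee_fin.
Qed.

Lemma orbits_almost_sure n (nu : probability (n.+1.-tuple (borel X)) R) :
    (forall (i : 'I_n) (h : BB -> \bar R), (forall z, 0 <= h z) -> measurable_fun setT h ->
       \int[nu]_t h (step t i) = \int[mu]_x \int[Q x]_y h (x, y)) ->
  exists O : set (n.+1.-tuple (borel X)), [/\ measurable O, nu O = 1 & O `<=` orbits T (n := n)].
Proof.
move=> nustep; pose F (i : 'I_n) := [set t : n.+1.-tuple (borel X) | G (step t i)].
have mstep (i : 'I_n) : measurable_fun setT (fun t : n.+1.-tuple (borel X) => step t i : BB).
  by apply: measurable_fun_pair; exact: measurable_tnth.
have mF i : measurable (F i) by rewrite -[F i]setTI; exact: mstep.
have F1 i : nu (F i) = 1.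
  have mG1 : measurable_fun setT (fun z : BB => (\1_G z)%:E : \bar R).
    by apply/measurable_EFinP; exact: measurable_indic.
  rewrite -(setIT (F i)) -integral_indic// (nustep i (fun z => (\1_G z)%:E))//.
  - have Q1 x : \int[Q x]_y (\1_G (x, y))%:E = 1.
      have xG : xsection G x = T x by rewrite xsectionE.
      rewrite -[RHS](QT x) -xG -[xsection G x]setIT -integral_indic//.
        by apply: eq_integral => y _; rewrite !indicE mem_xsection.
      exact: (@measurable_xsection _ _ (borel X) (borel X) (G : set BB) x mG).
    by under eq_integral do rewrite Q1; rewrite integral_cst//= mul1e probability_setT.
exists (\big[setI/setT]_(i < n) F i).
suff [mO O1] : measurable (\big[setI/setT]_(i < n) F i) /\ nu (\big[setI/setT]_(i < n) F i) = 1.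
  split => // t; rewrite -bigcap_seq => Ft i; apply: (Ft i) => /=.
  by rewrite mem_index_enum.
apply: (big_ind (fun S => measurable S /\ nu S = 1)) => [|A B [mA A1] [mB B1]|i _].
- by split => //; exact: probability_setT.
- by split; [exact: measurableI|rewrite probability_setI1].
- by split; [exact: mF|exact: F1].
Qed.

End orbit_statistics.

Section entropy_bound.
Context (R : realType) (X : pmetricType R) (T : X -> set X).
Hypotheses (cptX : compact [set: X]) (corrT : correspondence T).
Variables (Q : R.-pker (borel X) ~> (borel X)) (mu : probability (borel X) R).
Hypotheses (QT : supported_by T Q) (invQ : kernel_invariant Q mu).
Let H k (A : 'I_k -> set X) n :=
  shannon_entropy (path_measure Q mu (n := n)) (cylinder A (n := n.+1)).

Let measurable_cylinder k (A : 'I_k -> set X) n (f : {ffun 'I_n -> 'I_k}) :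
  (forall i, measurable (A i : set (borel X))) -> measurable (cylinder A f).
Proof.
move=> mA; rewrite (_ : cylinder A f =
    \big[setI/setT]_(i < n) [set t : n.-tuple (borel X) | A (f i) (tnth t i)]).
  apply: bigsetI_measurable => i _; rewrite -[X in measurable X]setTI.
  exact: (measurable_tnth i measurableT (mA (f i))).
apply/seteqP; split=> t; rewrite -bigcap_seq => ft i; first by move=> _; exact: ft.
by apply: (ft i) => /=; rewrite mem_index_enum.
Qed.

Let entropy_ge0 k (A : 'I_k -> set X) n : measurable_partition A -> (0 <= H A n)%R.
Proof.
move=> [_ mA]; have [nu [nuE _ _]] := path_probability_exists invQ n.
rewrite /H -nuE; apply: shannon_entropy_ge0 => f; exact: measurable_cylinder.
Qed.

Lemma partition_entropy_ge0 k (A : 'I_k -> set X) : measurable_partition A ->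
  (0 <= partition_entropy Q mu A)%R.
Proof.
move=> pA; pose h n := (n.+1%:R^-1 * H A n)%R.
rewrite /partition_entropy -/(h _); have [ch|nch] := pselect (cvgn h).
  by apply: limr_ge => //; near=> n; rewrite mulr_ge0// entropy_ge0.
by rewrite dvgP// lexx.
Unshelve. all: by end_near. Qed.

Variables (phi : X * X -> R) (m : R).
Hypotheses (cphi : continuous_on_graph T phi) (Pphi : pressure T (fun z => - phi z)%R <= 0).
Hypothesis mE : potential_integral T phi Q mu = m%:E.

(** Itineraries are coded by following, with some noise, the itinerary of a
    randomly chosen member [y] of a maximal separated family, weighted as in the
    Gibbs sum of [- phi]; this sum grows subexponentially. *)
Lemma cylinder_entropy_le k (A : 'I_k -> set X) (e : R) : measurable_partition A ->
  (0 < e)%R -> exists N, forall n, (N <= n)%N -> (H A n <= n%:R * m + n.+1%:R * e)%R.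
Proof.
case: k A => [|k] A pA e0.
  by have [[cA _ _] _] := pA; have : [set: X] point by []; rewrite -cA => -[[]].
have [[cA tA _] mA] := pA.
(* The four contributions to the error are the growth of the Gibbs sum, the
   variation of [phi] along nearby orbits, the noise, and the points outside the
   compact cores, which have mass at most [a / b]. *)
pose a := (e / 4)%R; have a0 : (0 < a)%R by rewrite divr_gt0.
pose delta := (1 - expR (- a))%R; pose b := (- ln (delta / k.+1%:R))%R.
have delta0 : (0 < delta)%R by rewrite subr_gt0 expR_lt1 oppr_lt0.
have delta1 : (delta < 1)%R by rewrite ltrBlDr ltrDl expR_gt0.
have b0 : (0 < b)%R.
  rewrite oppr_gt0 ln_lt0// divr_gt0//= ltr_pdivrMr// mul1r (lt_le_trans delta1)// ler1n//.
have [K [cK KA muK]] := @partition_core R X mu _ A (a / b)%R pA (divr_gt0 a0 b0).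
pose bad : set (borel X) := ~` \bigcup_i K i.
have mbad : measurable bad.
  by apply: measurableC; apply: fin_bigcup_measurable => // i _; exact: borel_closed.
have dA i i' x : A i x -> A i' x -> i = i' by move=> Ai Ai'; apply: tA => //; exists x.
have [e1 [j [e10 jP]]] := @separation_index R X cptX k K cK
  (fun i i' x Ki Ki' => dA i i' x (KA i x Ki) (KA i' x Ki')).
have [e2 e20 unif] := uniformly_continuous_on_graph cptX corrT cphi a0.
pose d := Num.min e1 e2; have d0 : (0 < d)%R by rewrite lt_min e10.
have [N NP] := @growth_rate_of_pressure R X T _ a (le_lt_trans Pphi (a0 : 0 < a%:E)) d d0.
exists N => n Nn.
have [C [psi [psi0 mpsi psiE psiI]]] := nonnegative_extension cptX corrT mu QT cphi.
have [nu [nuE nu1 nu2]] := path_probability_exists invQ n.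
have [S [mS S1 ST]] := orbits_almost_sure cptX corrT QT nu2.
have [s [ss sP]] := maximal_separated cptX T n d0.
pose Z := gibbs_sum (fun z => - phi z)%R s.
have birkN (y : n.+1.-tuple X) : birkhoff_sum (fun z => - phi z)%R y = (- birkhoff_sum phi y)%R :> R.
  by rewrite /birkhoff_sum sumrN.
have [y0 ys0] : exists y, y \in s.
  have [x Ox] := orbit_exists corrT n.
  by have [y ys _] := sP x Ox; exists y.
have Z0 : (0 < Z)%R.
  rewrite /Z /gibbs_sum (big_rem y0)//= ltr_pwDl ?expR_gt0// sumr_ge0//.
have lnZ : (ln Z <= n%:R * a)%R.
  rewrite -[leRHS]expRK ler_ln ?posrE ?expR_gt0//. exact: (NP n Nn s ss).
pose w (y : n.+1.-tuple X) := (expR (- birkhoff_sum phi y) / Z)%R.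
have w0 y : (0 < w y)%R by rewrite divr_gt0 ?expR_gt0.
pose index (y : n.+1.-tuple X) i := j (tnth y i).
pose q := itinerary_weight delta w index s.
pose V (t : n.+1.-tuple (borel X)) : R :=
  (\sum_(i < n) psi (step t i) + \sum_(i < n.+1) b * \1_bad (tnth t i))%R.
have mstep (i : 'I_n) : measurable_fun setT
    (fun t : n.+1.-tuple (borel X) => step t i : borel X * borel X).
  by apply: measurable_fun_pair; exact: measurable_tnth.
have mpsii i : measurable_fun setT (fun t : n.+1.-tuple (borel X) => psi (step t i)).
  exact: measurableT_comp mpsi (mstep i).
have mb : measurable_fun setT (fun x : borel X => b * \1_bad x : R)%R.
  by apply: measurable_funM => //; exact: measurable_indic.
have mbadi i : measurable_fun setT (fun t : n.+1.-tuple (borel X) => b * \1_bad (tnth t i) : R)%R.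
  exact: measurableT_comp mb (measurable_tnth i).
have bad_ge0 (x : X) : (0 <= b * (\1_bad x : R))%R by rewrite mulr_ge0// ltW.
have mcyl f : measurable (cylinder A (n := n.+1) f) by exact: measurable_cylinder.
rewrite /H -nuE.
apply: le_trans (@shannon_entropy_le R _ _ nu _ (cylinder A (n := n.+1)) S q V
  (ln Z + n%:R * a + n.+1%:R * a - n%:R * C) (n%:R * (m + C) + n.+1%:R * a) _ _ _ _ _ _ _ _ _ _ _) _ => //.
- move=> f g _ _ [t [ft gt]]; apply/ffunP => i; exact: dA (ft i) (gt i).
- apply/seteqP; split => // t _.
  have /choice[f fP] (i : 'I_n.+1) : exists c, A c (tnth t i).
    have [c _ Ac] : cover setT A (tnth t i) by rewrite cA.
    by exists c.
  by exists [ffun i => f i] => // i; rewrite ffunE.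
- move=> f; apply: lt_le_trans (itinerary_weight_ge delta0 delta1 index f w0 ys0).
  by rewrite mulr_gt0// prodr_gt0// => i _; exact: smoothing_gt0.
- rewrite itinerary_weight_sum /w -mulr_suml.
  under eq_bigr do rewrite -birkN.
  by rewrite -/Z divff// gt_eqF.
- apply: measurable_funD; exact: measurable_sum.
- by move=> t; rewrite addr_ge0// sumr_ge0//.
- under eq_integral do rewrite EFinD -!sumEFin.
  rewrite ge0_integralD//; first last.
  - by apply: emeasurable_sum => i; exact/measurable_EFinP.
  - by move=> t _; apply: sume_ge0 => i _; rewrite lee_fin.
  - by apply: emeasurable_sum => i; exact/measurable_EFinP.
  - by move=> t _; apply: sume_ge0 => i _; rewrite lee_fin.
  rewrite !ge0_integral_sum//; first last.
  - by move=> i t _; rewrite lee_fin.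
  - by move=> i; exact/measurable_EFinP.
  - by move=> i t _; rewrite lee_fin.
  - by move=> i; exact/measurable_EFinP.
  rewrite EFinD; apply: leeD.
    under eq_bigr => i _.
      rewrite (nu2 i (EFin \o psi)); last exact/measurable_EFinP.
        by rewrite psiI mE -EFinD; over.
      by move=> z; rewrite lee_fin.
    by rewrite sumEFin sumr_const card_ord mulr_natl.
  have -> : (n.+1%:R * a)%:E = \sum_(i < n.+1) a%:E.
    by rewrite sumEFin sumr_const card_ord mulr_natl.
  apply: lee_sum => i _; rewrite (nu1 i (fun x => (b * \1_bad x)%:E)).
  - under eq_integral do rewrite EFinM.
    rewrite ge0_integralZl_EFin//.
    + rewrite integral_indic// setIT -lee_pdivlMl//.
      by apply: (le_trans muK); rewrite lee_fin mulrC.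
    + by apply/measurable_EFinP; exact: measurable_indic.
    + exact: ltW.
  - by move=> x; rewrite lee_fin.
  - exact/measurable_EFinP.
- move=> f t St ft; have Tt := ST t St; have [y ys ty] := sP t Tt.
  have ty' := (tdist_lt t y d0).1 ty.
  have ysT : orbits T y by case: ss => _ + _; exact.
  apply: (le_trans (@code_length R X phi k a a0 n s index f t y bad a Z Z0 ys _ _)).
  + move=> i; apply: ltW; apply: unif; [exact: Tt|exact: ysT| |].
      by apply: lt_le_trans (ty' _) _; rewrite ge_min lexx orbT.
    by apply: lt_le_trans (ty' _) _; rewrite ge_min lexx orbT.
  + move=> i /contrapT[c _ Kc]; rewrite (dA _ c _ (ft i) (KA _ _ Kc)).
    by apply: (jP c _ _ Kc); apply: lt_le_trans (ty' i) _; rewrite ge_min lexx.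
  rewrite /V; have -> : (\sum_(i < n) psi (step t i) = birkhoff_sum phi t + n%:R * C)%R.
    have -> : (n%:R * C = \sum_(i < n) C)%R by rewrite sumr_const card_ord mulr_natl.
    rewrite -big_split/=.
    by apply: eq_bigr => i _; apply: psiE; exact: Tt.
  rewrite -/delta -/b; lra.
have -> : e = (a * 4)%R by rewrite /a divfK.
rewrite -natr1; lra.
Qed.

(** A divergent sequence of rates has the default value zero as its limit, so
    that the bound needs [0 <= m], which holds as no rate is negative. *)
Lemma partition_entropy_le k (A : 'I_k -> set X) : measurable_partition A ->
  (partition_entropy Q mu A <= m)%R.
Proof.
move=> pA; pose h n := (n.+1%:R^-1 * H A n)%R.
have h0 n : (0 <= h n)%R by rewrite mulr_ge0// entropy_ge0.
have hm e : (0 < e)%R -> \forall n \near \oo, (h n <= m + e)%R.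
  move=> e0; have e20 : (0 < e / 2)%R by rewrite divr_gt0.
  have [N HN] := cylinder_entropy_le pA e20.
  near=> n; have Nn : (N <= n)%N by near: n; exists N.
  have mn : (`|m| / (e / 2) <= n.+1%:R)%R.
    near: n; exists (Num.truncn (`|m| / (e / 2))) => // p /= Np.
    rewrite ltW// (lt_le_trans (truncnS_gt _))// ler_nat//.
  rewrite /h mulrC ler_pdivrMr// (le_trans (HN n Nn))//.
  have : (- m <= n.+1%:R * (e / 2))%R.
    by rewrite (le_trans (ler_norm _))// normrN -ler_pdivrMr.
  rewrite -natr1; lra.
have m0 : (0 <= m)%R.
  apply/ler_addgt0Pr => e e0; have [N _ HN] := hm e e0.
  exact: le_trans (h0 N) (HN N (leqnn N)).
rewrite /partition_entropy -/(h _); have [ch|nch] := pselect (cvgn h).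
  by apply/ler_addgt0Pr => e e0; apply: limr_le => //; exact: hm.
by rewrite dvgP.
Unshelve. all: by end_near. Qed.

End entropy_bound.

(** * The variational principle *)

Section variational_principle.
Context (R : realType) (X : pmetricType R) (T : X -> set X).
Hypotheses (cptX : compact [set: X]) (corrT : correspondence T).
Implicit Types (Q : R.-pker (borel X) ~> (borel X)) (mu : probability (borel X) R).
Implicit Types (phi psi chi : X * X -> R).
Local Notation CG := (continuous_on_graph T).

Let bounded phi : CG phi -> bounded_on (corr_graph T) phi.
Proof. by move=> cphi; exact: bounded_on_graph. Qed.

Let CGN phi : CG phi -> CG (fun z => - phi z)%R.
Proof.
move=> cphi; rewrite (_ : (fun z => _) = fun z => -1 * phi z)%R.
  exact: continuous_on_graphZ.
by apply/funext => z; rewrite mulN1r.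
Qed.

Let CGcst c : CG (fun=> c).
Proof. exact: (@continuous_on_graph_cst R X T c). Qed.

Let mean_exists Q mu : supported_by T Q -> exists I : (X * X -> R) -> R,
  [/\ forall phi, CG phi -> potential_integral T phi Q mu = (I phi)%:E,
      forall phi psi, CG phi -> CG psi -> I (fun z => phi z + psi z)%R = (I phi + I psi)%R,
      forall phi, CG phi -> I (fun z => - phi z)%R = (- I phi)%R &
      forall c, I (fun=> c) = c].
Proof.
move=> QT; have [I [IE ID IZ Ic]] := potential_mean_exists cptX corrT mu QT.
have IN phi : CG phi -> I (fun z => - phi z)%R = (- I phi)%R.
  move=> cphi; rewrite -mulN1r -IZ//; congr I; apply/funext => z.
  by rewrite mulN1r.
exists I; split => // c; apply/eqP; rewrite eq_le (Ic c _ (@CGcst c))//=.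
by rewrite -lerN2 -IN; [apply: Ic => //; exact: CGN|exact: (@CGcst c)].
Qed.

Let pressure_fin phi : CG phi -> pressure T phi < +oo ->
  exists p, pressure T phi = p%:E.
Proof.
move=> cphi Plty; exists (fine (pressure T phi)); rewrite fineK// fin_real//.
by rewrite pressure_gtNy//=; exact: bounded.
Qed.

(** Lowering a potential by its pressure normalizes the pressure to zero, and
    makes its opposite one of the functions that define the abstract entropy. *)
Let abstract_entropy_le_of_pressure Q mu phi p : CG phi -> pressure T phi = p%:E ->
  abstract_entropy T Q mu <= potential_integral T (fun z => p - phi z)%R Q mu.
Proof.
move=> cphi Pp; apply: ereal_inf_lbound; exists (fun z => p - phi z)%R => //; split.
  by apply: continuous_on_graphD => //; exact: CGN.
rewrite (_ : (fun z => _) = fun z => phi z + - p)%R; last first.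
  by apply/funext => z; rewrite opprB.
by rewrite pressure_addr ?Pp ?subee//; exact: bounded.
Qed.

Let abstract_entropy_le Q mu phi : supported_by T Q -> CG phi ->
  abstract_entropy T Q mu <= pressure T phi - potential_integral T phi Q mu.
Proof.
move=> QT cphi; have [I [IE ID IN Ic]] := mean_exists mu QT.
have [Plty|] := boolP (pressure T phi < +oo); last first.
  by rewrite ltey negbK => /eqP ->; rewrite IE// leey.
have [p Pp] := pressure_fin cphi Plty.
have cN := CGN cphi; have cc := @CGcst p.
apply: le_trans (abstract_entropy_le_of_pressure _ _ cphi Pp) _.
rewrite IE; last exact: continuous_on_graphD.
by rewrite (ID (fun=> p))// Ic IN// Pp IE.
Qed.

(** A tangent to the pressure at [phi] bounds the integral of every admissible
    [chi] from below: move from [phi] to [- chi], where the pressure is at most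
    zero. *)
Let abstract_entropy_ge Q mu phi : supported_by T Q -> CG phi ->
    (pressure T phi < +oo -> forall psi, CG psi ->
      pressure T phi + potential_integral T psi Q mu <= pressure T (fun z => phi z + psi z)%R) ->
  pressure T phi - potential_integral T phi Q mu <= abstract_entropy T Q mu.
Proof.
move=> QT cphi tangent; have [I [IE ID IN Ic]] := mean_exists mu QT.
apply: le_ereal_inf_tmp => _ [chi [cchi Pchi] <-].
have cN := CGN cphi; have cNchi := CGN cchi.
have Plty : pressure T phi < +oo.
  apply: pressure_lty (le_lt_trans Pchi (ltry 0)) => //; exact: bounded.
have cpsi := continuous_on_graphD cNchi cN.
have := tangent Plty _ cpsi; have [p ->] := pressure_fin cphi Plty.
rewrite (_ : (fun z => phi z + (- chi z + - phi z)) = fun z => - chi z)%R; last first.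
  by apply/funext => z; ring.
move=> /le_trans/(_ Pchi); rewrite !IE// ID// !IN// !lee_fin; lra.
Qed.

Let free_energy_le Q mu phi : supported_by T Q -> CG phi ->
  free_energy T phi Q mu <= pressure T phi.
Proof.
move=> QT cphi; have [I [IE _ _ _]] := mean_exists mu QT.
rewrite /free_energy (IE phi)// -leeBrDr// -(IE phi)//.
exact: abstract_entropy_le.
Qed.

Lemma free_energy_maximum phi : CG phi ->
  is_maximum (free_energies T phi) (pressure T phi) /\
  is_maximum (invariant_free_energies T phi) (pressure T phi).
Proof.
move=> cphi; have [Q [mu [QT invQ tangent]]] := equilibrium_exists cptX corrT cphi.
have E : pressure T phi = free_energy T phi Q mu.
  apply/eqP; rewrite eq_le free_energy_le// andbT.
  have [I [IE _ _ _]] := mean_exists mu QT.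
  rewrite /free_energy (IE phi)// -leeBlDr// -(IE phi)//.
  exact: abstract_entropy_ge.
split; split.
- by exists Q, mu.
- by move=> _ [Q' [mu' [QT' ->]]]; exact: free_energy_le.
- by exists Q, mu.
- by move=> _ [Q' [mu' [QT' _ ->]]]; exact: free_energy_le.
Qed.

(** Coboundaries leave the pressure unchanged, so that their integrals cannot
    improve the free energy of a maximizing pair: they vanish. *)
Lemma invariant_of_maximum phi Q mu : CG phi -> pressure T phi < +oo ->
    supported_by T Q -> free_energy T phi Q mu = pressure T phi ->
  kernel_invariant Q mu.
Proof.
move=> cphi Plty QT E; have [I [IE ID IN Ic]] := mean_exists mu QT.
have [p Pp] := pressure_fin cphi Plty.
have hE : abstract_entropy T Q mu = (p - I phi)%:E.
  move: E; rewrite /free_energy Pp (IE phi)//.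
  by case: (abstract_entropy T Q mu) => // h; rewrite -EFinD => -[<-]; rewrite addrK.
have cob_le f : continuous f -> (I (fun z => f z.1 - f z.2) <= 0)%R.
  move=> cf; have ccf := @continuous_coboundary R X T f cf.
  have [C fC] := bounded_continuous cptX cf.
  have cs := continuous_on_graphD cphi ccf; have cN := CGN cs; have cc := @CGcst p.
  have := @abstract_entropy_le_of_pressure Q mu _ p cs.
  rewrite (pressure_coboundary corrT (bounded cphi) fC) => /(_ Pp).
  rewrite hE IE; last exact: continuous_on_graphD.
  by rewrite (ID (fun=> p))// IN// Ic ID// lee_fin; lra.
apply: (invariant_of_coboundaries cptX corrT QT) => f cf.
have ccf := @continuous_coboundary R X T f cf.
rewrite IE//; congr EFin; apply/eqP; rewrite eq_le cob_le//= -oppr_le0 -IN//.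
have cNf : continuous (fun x => - f x)%R by move=> x; apply: cvgN; exact: cf.
apply: le_trans (cob_le _ cNf); rewrite le_eqVlt; apply/orP; left; apply/eqP; congr I.
by apply/funext => z; ring.
Qed.

Lemma abstract_entropy_dual Q mu : supported_by T Q ->
  abstract_entropy T Q mu =
  ereal_inf [set pressure T phi - potential_integral T phi Q mu | phi in CG].
Proof.
move=> QT; have [I [IE ID IN Ic]] := mean_exists mu QT.
apply/eqP; rewrite eq_le; apply/andP; split.
  by apply: le_ereal_inf_tmp => _ [phi cphi <-]; exact: abstract_entropy_le.
apply: le_ereal_inf_tmp => _ [chi [cchi Pchi] <-].
have cN := CGN cchi.
apply: (@le_trans _ _ (pressure T (fun z => - chi z)%R - potential_integral T (fun z => - chi z)%R Q mu)).
  by apply: ereal_inf_lbound; exists (fun z => - chi z)%R.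
by rewrite !IE// IN// EFinN oppeK -[leRHS]add0e leeD2r.
Qed.

Lemma metric_entropy_le Q mu : supported_by T Q -> kernel_invariant Q mu ->
  0 <= metric_entropy Q mu <= abstract_entropy T Q mu.
Proof.
move=> QT invQ; have [I [IE ID IN Ic]] := mean_exists mu QT.
apply/andP; split; last first.
  apply: ge_ereal_sup => _ [k [A [pA ->]]].
  apply: le_ereal_inf_tmp => _ [chi [cchi Pchi] <-]; rewrite IE// lee_fin.
  exact: (partition_entropy_le cptX corrT QT invQ cchi Pchi (IE _ cchi) pA).
pose A := fun _ : 'I_1 => [set: X].
have pA : measurable_partition A.
  split; last by move=> i; exact: measurableT.
  split.
  - by apply/seteqP; split => // x _; exists ord0.
  - by move=> i j _ _ _; rewrite !ord1.
  - by move=> i _; exists point.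
apply: (@le_trans _ _ (partition_entropy Q mu A)%:E).
  by rewrite lee_fin; exact: partition_entropy_ge0.
by apply: ereal_sup_ubound; exists 1%N, A.
Qed.

End variational_principle.

Theorem theorem4p7 (R : realType) (X : pmetricType R) (T : X -> set X)
    (cptX : compact [set: X]) (corrT : correspondence T) :
  (* (i) *)
  (forall phi : X * X -> R, continuous_on_graph T phi ->
     is_maximum (free_energies T phi) (pressure T phi) /\
     is_maximum (invariant_free_energies T phi) (pressure T phi)) /\
  (* (ii) *)
  (forall phi : X * X -> R, continuous_on_graph T phi ->
     pressure T phi < +oo ->
     forall (Q : R.-pker (borel X) ~> (borel X))
            (mu : probability (borel X) R),
       supported_by T Q ->
       is_maximum (free_energies T phi) (free_energy T phi Q mu) ->
       kernel_invariant Q mu) /\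
  (* (iii) *)
  (forall (Q : R.-pker (borel X) ~> (borel X))
          (mu : probability (borel X) R),
     supported_by T Q ->
     abstract_entropy T Q mu =
     ereal_inf [set pressure T phi - potential_integral T phi Q mu
               | phi in continuous_on_graph T]) /\
  (* (iv) *)
  (forall (Q : R.-pker (borel X) ~> (borel X))
          (mu : probability (borel X) R),
     supported_by T Q -> kernel_invariant Q mu ->
     0 <= metric_entropy Q mu <= abstract_entropy T Q mu).
Proof.
split; [|split; [|split]].
- by move=> phi cphi; exact: free_energy_maximum.
- move=> phi cphi Plty Q mu QT [inE ub].
  apply: (invariant_of_maximum cptX corrT cphi Plty QT).
  have [[inP ubP] _] := free_energy_maximum cptX corrT cphi.
  by apply/eqP; rewrite eq_le ub// ubP.
- by move=> Q mu QT; exact: abstract_entropy_dual.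
- by move=> Q mu QT invQ; exact: metric_entropy_le.
Qed.
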